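(* Let $r,s\in C^1[0,\infty)$ and $u\in C[0,\infty)$ be real-valued functions satisfying $$\dot s(t)=-2u(t)r(t),\qquad \dot r(t)=-2u(t)s(t),$$ with $\operatorname{sgn}(u(t))=-\operatorname{sgn}(r(t))$ for all $t>0$, $s(0)>0$ and $r(0)>0$ (so that $r(t),s(t)>0$ for all $t$, and $s^2-r^2$ is constant). Assume $s^2-r^2>0$ and put $C=\sqrt{s^2-r^2}$. Let $\lambda\in-\frac12+i\mathbb R_{\ge0}$ and $\varepsilon\in[0,1)$ with $(\lambda,\varepsilon)\ne(-\frac12,\frac12)$. For $t>0$ let $$W_t(x)=\frac{c(t)^{-x}}{\Gamma(x+\varepsilon+\lambda+1)\Gamma(x+\varepsilon-\lambda)},\qquad x\in\mathbb Z,$$ where $c(t)\in(0,1)$ is determined by $\frac{s(t)}{r(t)}=\frac{1+c(t)}{2\sqrt{c(t)}}$, or equivalently $c(t)=e^{-2\operatorname{arccosh}(s(t)/r(t))}$. Define $U_t:\ell^2(\mathbb Z)\to\ell^2(\mathbb Z,W_t)$ by $$[U_te_n](x)=m_n(x;\lambda,\varepsilon,c(t)).$$ Then $U_t$ is unitary and $U_t\circ\pi_{\lambda,\varepsilon}(L(t))\circ U_t^*=M(2C(x+\varepsilon))$.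
   Context: The Lie algebra considered has basis $H,E,F$ with $[H,E]=2E$, $[H,F]=-2F$, $[E,F]=H$ and $*$-structure $H^*=H$, $E^*=-F$ (i.e. $\mathfrak{su}(1,1)$). The Lax operator is $L(t)=s(t)H+r(t)(E-F)$ (with partner $M(t)=u(t)(E+F)$; the differential equations above are $\dot L=[M,L]$). The principal unitary series representation $\pi_{\lambda,\varepsilon}$ on $\ell^2(\mathbb Z)$ with standard orthonormal basis $\{e_n\}_{n\in\mathbb Z}$ is given by $\pi_{\lambda,\varepsilon}(H)e_n=2(\varepsilon+n)e_n$, $\pi_{\lambda,\varepsilon}(E)e_n=\sqrt{(n+\varepsilon-\lambda)(n+\varepsilon+\lambda+1)}\,e_{n+1}$, $\pi_{\lambda,\varepsilon}(F)e_n=-\sqrt{(n+\varepsilon-\lambda-1)(n+\varepsilon+\lambda)}\,e_{n-1}$. Hence $$\pi_{\lambda,\varepsilon}(L(t))e_n=r(t)\sqrt{(n+\varepsilon+\lambda+1)(n+\varepsilon-\lambda)}\,e_{n+1}+s(t)(2\varepsilon+2n)e_n+r(t)\sqrt{(n+\varepsilon+\lambda)(n+\varepsilon-\lambda-1)}\,e_{n-1}.$$ These operators are densely defined, with domain $\mathcal D$ the finite linear combinations of the $e_n$; the operator identity in the claim is understood on $U_t(\mathcal D)$. Meixner functions: for $x,n\in\mathbb Z$, $c\in(0,1)$, $$m_n(x;\lambda,\varepsilon,c)=\Big(\frac{\sqrt c}{c-1}\Big)^n\frac{\sqrt{\Gamma(n+\varepsilon+\lambda+1)\Gamma(n+\varepsilon-\lambda)}}{(1-c)^\varepsilon\,\Gamma(n+1-x)}\;{}_2F_1\Big({n+\varepsilon+\lambda+1,\,n+\varepsilon-\lambda\atop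 n+1-x};\frac{c}{c-1}\Big),$$ where ${}_2F_1$ is the (analytically continued, principal branch) Gauss hypergeometric function, and $\frac1{\Gamma(n+1-x)}{}_2F_1$ is interpreted by continuity in the lower parameter (regularized hypergeometric function) when $n+1-x\le0$. $\ell^2(X,W)$ has inner product $\sum_{x\in X}f(x)\overline{g(x)}W(x)$. $M(f)$ denotes multiplication: $[M(f)g](x)=f(x)g(x)$. *)

(* Defs.v *)
From Stdlib Require Import Reals ZArith ClassicalEpsilon.
From Coquelicot Require Import Coquelicot.
Open Scope R_scope.

Definition continuous_halfline (f : R -> R) : Prop :=
  forall t, 0 <= t ->
    filterlim f (within (fun y => 0 <= y) (locally t)) (locally (f t)).

(* Derivative at [t] relative to [0,+oo): one-sided at [t = 0]. *)
Definition is_derive_halfline (f : R -> R) (t l : R) : Prop :=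
  filterlim (fun y => (f y - f t) / (y - t))
    (within (fun y => 0 <= y /\ y <> t) (locally t)) (locally l).

Definition C1_halfline (f : R -> R) : Prop :=
  exists f' : R -> R,
    (forall t, 0 <= t -> is_derive_halfline f t (f' t)) /\
    continuous_halfline f'.

Definition arccosh (y : R) : R := ln (y + sqrt (y ^ 2 - 1)).

Definition IZC (n : Z) : C := RtoC (IZR n).

Definition Cexp (z : C) : C :=
  (exp (fst z) * cos (snd z), exp (fst z) * sin (snd z)).

(* Principal branch, [Re (Csqrt z) >= 0]. *)
Definition Csqrt (z : C) : C :=
  (sqrt ((Cmod z + fst z) / 2),
   (if Rlt_dec (snd z) 0 then -1 else 1) * sqrt ((Cmod z - fst z) / 2)).

Definition Clim_seq (a : nat -> C) : C :=
  (real (Lim_seq (fun n => fst (a n))), real (Lim_seq (fun n => snd (a n)))).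

Definition CSeries (a : nat -> C) : C :=
  (Series (fun n => fst (a n)), Series (fun n => snd (a n))).

Fixpoint pochhammer (a : C) (k : nat) : C :=
  match k with
  | O => RtoC 1
  | S j => Cmult (pochhammer a j) (Cplus a (RtoC (INR j)))
  end.

(* The entire function 1/Gamma, from Gauss's product
   1/Gamma(z) = lim_N z (z+1) ... (z+N) / (N! N^z). *)
Definition rGamma (z : C) : C :=
  Clim_seq (fun N =>
    Cdiv (pochhammer z (S N))
         (Cmult (RtoC (INR (fact N))) (Cexp (Cmult z (RtoC (ln (INR N))))))).

Definition Gamma (z : C) : C := Cinv (rGamma z).

(* Taylor coefficients at 0 of 2F1(a,b;c;z)/Gamma(c), with 1/(Gamma(c) (c)_k)
   written 1/Gamma(c+k): this is continuous in [c], also at c = 0, -1, ... *)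
Definition hyp2F1reg_coef (a b c : C) (k : nat) : C :=
  Cdiv (Cmult (Cmult (pochhammer a k) (pochhammer b k))
              (rGamma (Cplus c (RtoC (INR k)))))
       (RtoC (INR (fact k))).

Definition has_power_series_on_disc
    (f : C -> C) (z0 : C) (rho : R) (a : nat -> C) : Prop :=
  forall z : C, Cmod (Cminus z z0) < rho ->
    @is_pseries C_AbsRing C_NormedModule a (Cminus z z0) (f z).

Definition analytic_on (Om : C -> Prop) (f : C -> C) : Prop :=
  forall z0, Om z0 -> exists (rho : R) (a : nat -> C), 0 < rho /\
    (forall z, Cmod (Cminus z z0) < rho -> Om z) /\
    has_power_series_on_disc f z0 rho a.

Definition cut_plane (z : C) : Prop := ~ (snd z = 0 /\ 1 <= fst z).

Definition star_shaped (Om : C -> Prop) : Prop :=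
  forall z t, Om z -> 0 <= t <= 1 -> Om (Cmult (RtoC t) z).

(* [v] is the value at [z] of the principal branch, on the plane cut along
   [1,+oo), of the analytic continuation of the series.  The cut plane is
   star-shaped about 0, so the principal branch at [z] is the continuation along
   the segment [0,z]; it can be read off on any star-shaped domain in the cut
   plane that contains [z], the value being the same on all of them. *)
Definition is_hyp2F1reg (a b c z v : C) : Prop :=
  exists (Om : C -> Prop) (f : C -> C),
    (forall w, Om w -> cut_plane w) /\ star_shaped Om /\ Om z /\
    analytic_on Om f /\
    (exists rho, 0 < rho /\
       has_power_series_on_disc f (RtoC 0) rho (hyp2F1reg_coef a b c)) /\
    f z = v.

Definition hyp2F1reg (a b c z : C) : C :=
  epsilon (inhabits (RtoC 0)) (is_hyp2F1reg a b c z).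

Definition par1 (lam : C) (eps : R) (n : Z) : C :=
  Cplus (Cplus (RtoC (IZR n + eps)) lam) (RtoC 1).
Definition par2 (lam : C) (eps : R) (n : Z) : C :=
  Cminus (RtoC (IZR n + eps)) lam.

Definition meixner (n x : Z) (lam : C) (eps c : R) : C :=
  Cmult
    (Cmult (RtoC (powerRZ (sqrt c / (c - 1)) n))
       (Cdiv (Csqrt (Cmult (Gamma (par1 lam eps n)) (Gamma (par2 lam eps n))))
             (RtoC (Rpower (1 - c) eps))))
    (hyp2F1reg (par1 lam eps n) (par2 lam eps n) (IZC (n + 1 - x))
       (RtoC (c / (c - 1)))).

(* For Re lam = -1/2 the two Gamma factors are complex conjugates, so the
   quotient is real and taking [Re] only changes its type. *)
Definition meixner_weight (lam : C) (eps c : R) (x : Z) : R :=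
  Re (Cdiv (RtoC (powerRZ c (- x)))
           (Cmult (Gamma (par1 lam eps x)) (Gamma (par2 lam eps x)))).

Definition ZSeries (f : Z -> C) : C :=
  Cplus (CSeries (fun n => f (Z.of_nat n)))
        (CSeries (fun n => f (- Z.of_nat (S n))%Z)).

Definition in_l2 (W : Z -> R) (f : Z -> C) : Prop :=
  ex_series (fun n => Cmod (f (Z.of_nat n)) ^ 2 * W (Z.of_nat n)) /\
  ex_series (fun n => Cmod (f (- Z.of_nat (S n))%Z) ^ 2 * W (- Z.of_nat (S n))%Z).

Definition inner (W : Z -> R) (f g : Z -> C) : C :=
  ZSeries (fun x => Cmult (Cmult (f x) (Cconj (g x))) (RtoC (W x))).

Definition norm_l2 (W : Z -> R) (f : Z -> C) : R := sqrt (Re (inner W f f)).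

Definition weight1 (x : Z) : R := 1.

Definition basis_vec (n k : Z) : C := if Z.eq_dec k n then RtoC 1 else RtoC 0.

Definition finite_support (f : Z -> C) : Prop :=
  exists N : Z, forall k : Z, (N < Z.abs k)%Z -> f k = RtoC 0.

(* Operators l^2(Z,W1) -> l^2(Z,W2) are represented by maps on all of Z -> C;
   only their values on l^2(Z,W1) matter. *)
Definition bounded_linear (W1 W2 : Z -> R) (U : (Z -> C) -> (Z -> C)) : Prop :=
  (forall f, in_l2 W1 f -> in_l2 W2 (U f)) /\
  (forall (a : C) (f g : Z -> C), in_l2 W1 f -> in_l2 W1 g ->
     forall x, U (fun k => Cplus (Cmult a (f k)) (g k)) x
               = Cplus (Cmult a (U f x)) (U g x)) /\
  (exists K : R, forall f, in_l2 W1 f -> norm_l2 W2 (U f) <= K * norm_l2 W1 f).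

Definition unitary (W1 W2 : Z -> R) (U : (Z -> C) -> (Z -> C)) : Prop :=
  bounded_linear W1 W2 U /\
  (forall f g, in_l2 W1 f -> in_l2 W1 g -> inner W2 (U f) (U g) = inner W1 f g) /\
  (forall g, in_l2 W2 g -> exists f, in_l2 W1 f /\ forall x, U f x = g x).

Definition is_adjoint (W1 W2 : Z -> R) (U V : (Z -> C) -> (Z -> C)) : Prop :=
  bounded_linear W2 W1 V /\
  forall f g, in_l2 W1 f -> in_l2 W2 g -> inner W2 (U f) g = inner W1 f (V g).

(* Coordinates in the basis H, E, F. *)
Record su11 : Type := Su11 { coefH : C; coefE : C; coefF : C }.

(* s H + r (E - F) *)
Definition lax (s r : R) : su11 := Su11 (RtoC s) (RtoC r) (Copp (RtoC r)).

(* pi(H), pi(E), pi(F) on f = sum_n f(n) e_n; the value at [k] is the coefficient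
   of e_k in the image, so e_n |-> e_(n+1) reads off f at k-1. *)
Definition piH (eps : R) (f : Z -> C) (k : Z) : C :=
  Cmult (RtoC (2 * (eps + IZR k))) (f k).

Definition coef_up (lam : C) (eps : R) (n : Z) : C :=
  Csqrt (Cmult (Cminus (RtoC (IZR n + eps)) lam)
               (Cplus (Cplus (RtoC (IZR n + eps)) lam) (RtoC 1))).

Definition coef_down (lam : C) (eps : R) (n : Z) : C :=
  Copp (Csqrt (Cmult (Cminus (Cminus (RtoC (IZR n + eps)) lam) (RtoC 1))
                     (Cplus (RtoC (IZR n + eps)) lam))).

Definition piE (lam : C) (eps : R) (f : Z -> C) (k : Z) : C :=
  Cmult (coef_up lam eps (k - 1)) (f (k - 1)%Z).

Definition piF (lam : C) (eps : R) (f : Z -> C) (k : Z) : C :=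
  Cmult (coef_down lam eps (k + 1)) (f (k + 1)%Z).

Definition pi_rep (lam : C) (eps : R) (X : su11) (f : Z -> C) (k : Z) : C :=
  Cplus (Cplus (Cmult (coefH X) (piH eps f k)) (Cmult (coefE X) (piE lam eps f k)))
        (Cmult (coefF X) (piF lam eps f k)).

(* The bounded operator l^2(Z) -> l^2(Z,W) determined by e_n |-> m_n. *)
Definition is_meixner_transform (lam : C) (eps c : R)
    (U : (Z -> C) -> (Z -> C)) : Prop :=
  bounded_linear weight1 (meixner_weight lam eps c) U /\
  forall n x : Z, U (basis_vec n) x = meixner n x lam eps c.

Definition mult_op (h : Z -> R) (g : Z -> C) (x : Z) : C :=
  Cmult (RtoC (h x)) (g x).

(* Main.v *)
(* Put q = sqrt c, sigma = eps + lam + 1 and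
     phi_n(w) = w^n (1 - q w)^(-n-sigma) (1 - q/w)^(n-1+conj sigma).
   Up to the factor sqrt (1-c) these are the images of the w^n under an element of
   SU(1,1) acting in the principal series on the circle, so they are orthonormal.
   By Pfaff's transformation, m_n(x) sqrt (W(x)) is sqrt (1-c) times the coefficient of
   w^x in phi_n, up to unimodular factors depending on n alone or on x alone.
   Orthonormality over x is a Vandermonde convolution in l^1(Z); the matrix of
   coefficients is symmetric up to unimodular factors, so it is orthonormal over n too,
   and U is unitary.  The derivation w d/dw, for which w^x has eigenvalue x, acts on the
   phi_n by the three-term recurrence that makes U diagonalize the Lax operator. *)

Require Import Defs.
From Stdlib Require Import Reals ZArith Lra Lia List Permutation Classical ClassicalEpsilon FunctionalExtensionality.
From Coquelicot Require Import Coquelicot.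
Open Scope R_scope.

(** * Unconditional sums *)

(** The principal branch of 2F1 is specified by an existential, and for c >= 1/2 the argument
    c/(c-1) lies outside the open unit disc, so the series at 0 cannot be summed there. Pfaff's
    transformation moves the argument to c. It yields an explicit continuation on a disc containing
    0 and c/(c-1), and an identity theorem along the segment shows that no other continuation gives
    another value. Complex powers never pass through a logarithm: (1-z)^(-s) is the binomial series,
    and its exponent law is Vandermonde's convolution summed over all indices. Of 1/Gamma only the
    functional equation, the conjugation symmetry, the integer values and the location of the zeros
    are used, all read off from Gauss's product. Sums are unconditional because the argument keeps
    reindexing and exchanging them; they meet the series of the statement only at the boundary. The
    factor sqrt (1-c) is the modulus of (1-c)^(sigma-eps), as sigma - eps has real part 1/2. *)

Definition Csum {I} (f : I -> C) (l : list I) : C :=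
  fold_right (fun i s => Cplus (f i) s) (RtoC 0) l.
Definition Rsum {I} (f : I -> R) (l : list I) : R :=
  fold_right (fun i s => f i + s) 0 l.

(* The limit is taken along the finite subsets of the index type, given as lists. *)
Definition has_sum {I} (f : I -> C) (s : C) : Prop :=
  forall e, 0 < e -> exists L0, forall L, NoDup L -> incl L0 L ->
    Cmod (Cminus (Csum f L) s) < e.

Definition abs_summable {I} (f : I -> C) : Prop :=
  exists M, forall L, NoDup L -> Rsum (fun i => Cmod (f i)) L <= M.

(** Total by choice: a family without a sum gets an arbitrary value, so this is meaningful only
    where some [has_sum] is known. *)
Definition tsum {I} (f : I -> C) : C := epsilon (inhabits (RtoC 0)) (has_sum f).

Section Sums.
Open Scope C_scope.

Lemma Csum_app {I} (f : I -> C) l l' : Csum f (l ++ l') = Csum f l + Csum f l'.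
Proof. induction l; simpl; [ring | rewrite IHl; ring]. Qed.

Lemma Csum_ext {I} (f g : I -> C) l :
  (forall i, In i l -> f i = g i) -> Csum f l = Csum g l.
Proof.
  induction l; simpl; intros H; auto.
  rewrite (H a) by auto. rewrite IHl; auto.
Qed.

Lemma Csum_plus {I} (f g : I -> C) l :
  Csum (fun i => f i + g i) l = Csum f l + Csum g l.
Proof. induction l; simpl; [ring | rewrite IHl; ring]. Qed.

Lemma Csum_scal {I} (k : C) (f : I -> C) l :
  Csum (fun i => k * f i) l = k * Csum f l.
Proof. induction l; simpl; [ring | rewrite IHl; ring]. Qed.

Lemma Csum_RtoC {I} (f : I -> R) l : Csum (fun i => RtoC (f i)) l = RtoC (Rsum f l).
Proof. induction l; simpl; auto. rewrite IHl, RtoC_plus. auto. Qed.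

Lemma Csum_map {I J} (phi : I -> J) (f : J -> C) l :
  Csum f (map phi l) = Csum (fun i => f (phi i)) l.
Proof. induction l; simpl; auto. rewrite IHl. auto. Qed.

Lemma Csum_Permutation {I} (f : I -> C) l l' : Permutation l l' -> Csum f l = Csum f l'.
Proof. induction 1; simpl; try congruence. ring. Qed.

Lemma Csum_same {I} (f : I -> C) l l' :
  NoDup l -> NoDup l' -> (forall i, In i l <-> In i l') -> Csum f l = Csum f l'.
Proof. intros. apply Csum_Permutation, NoDup_Permutation; auto. Qed.

Lemma Rsum_ge0 {I} (f : I -> R) l : (forall i, (0 <= f i)%R) -> (0 <= Rsum f l)%R.
Proof. intros H; induction l; simpl; [lra | specialize (H a); lra]. Qed.

Lemma Rsum_le {I} (f g : I -> R) l :
  (forall i, In i l -> f i <= g i)%R -> (Rsum f l <= Rsum g l)%R.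
Proof.
  induction l; simpl; intros H; [lra|].
  specialize (IHl (fun i h => H i (or_intror h))). specialize (H a (or_introl eq_refl)). lra.
Qed.

Lemma Rsum_plus {I} (f g : I -> R) l :
  Rsum (fun i => f i + g i)%R l = (Rsum f l + Rsum g l)%R.
Proof. induction l; simpl; [ring | rewrite IHl; ring]. Qed.

Lemma Rsum_scal {I} (k : R) (f : I -> R) l :
  Rsum (fun i => k * f i)%R l = (k * Rsum f l)%R.
Proof. induction l; simpl; [ring | rewrite IHl; ring]. Qed.

Lemma Rsum_const {I} (d : R) (l : list I) : Rsum (fun _ => d) l = (INR (length l) * d)%R.
Proof. induction l as [|a l IH]; [simpl; ring|]. simpl length. rewrite S_INR. simpl. rewrite IH. ring. Qed.

Lemma Rsum_app {I} (f : I -> R) l l' : Rsum f (l ++ l') = (Rsum f l + Rsum f l')%R.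
Proof. induction l; simpl; [ring | rewrite IHl; ring]. Qed.

Lemma Rsum_map {I J} (phi : I -> J) (f : J -> R) l :
  Rsum f (map phi l) = Rsum (fun i => f (phi i)) l.
Proof. induction l; simpl; auto. rewrite IHl. auto. Qed.

Lemma Csum_Cmod {I} (f : I -> C) l : (Cmod (Csum f l) <= Rsum (fun i => Cmod (f i)) l)%R.
Proof.
  induction l; simpl. rewrite Cmod_0; lra.
  eapply Rle_trans; [apply Cmod_triangle|]. lra.
Qed.

Lemma Rsum_incl {I} (f : I -> R) l l' :
  (forall i, (0 <= f i)%R) -> NoDup l -> incl l l' -> (Rsum f l <= Rsum f l')%R.
Proof.
  intros H. revert l'. induction l as [|a l IH]; simpl; intros l' Hn Hi.
  - apply Rsum_ge0; auto.
  - inversion Hn; subst.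
    destruct (in_split a l') as [l1 [l2 E]]; [apply Hi; simpl; auto|]. subst.
    assert (incl l (l1 ++ l2)).
    { intros x Hx. assert (h := Hi x (or_intror Hx)). apply in_app_iff in h.
      apply in_app_iff. destruct h as [h|[h|h]]; auto. subst; tauto. }
    specialize (IH _ H3 H0). rewrite Rsum_app in *. simpl. lra.
Qed.

Definition classical_eq_dec {I : Type} (x y : I) : {x = y} + {x <> y} :=
  excluded_middle_informative (x = y).

(** [has_sum] tests duplicate-free lists only; this makes the concatenation of two witnesses
    admissible. *)
Lemma exists_NoDup_list {I} (L0 : list I) : exists L, NoDup L /\ forall i, In i L <-> In i L0.
Proof.
  exists (nodup classical_eq_dec L0). split; [apply NoDup_nodup | intros; apply nodup_In].
Qed.

Lemma has_sum_unique {I} (f : I -> C) s s' : has_sum f s -> has_sum f s' -> s = s'.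
Proof.
  intros H H'. destruct (classic (s = s')) as [|Hn]; auto. exfalso.
  assert (Hd : (0 < Cmod (s - s'))%R).
  { apply Cmod_gt_0. intros E. apply Hn. replace s with ((s - s') + s') by ring. rewrite E; ring. }
  destruct (H (Cmod (s - s') / 2)%R) as [L1 H1]; [lra|].
  destruct (H' (Cmod (s - s') / 2)%R) as [L2 H2]; [lra|].
  destruct (exists_NoDup_list (L1 ++ L2)) as [L [HL Hin]].
  assert (i1 : incl L1 L) by (intros x Hx; apply Hin, in_app_iff; auto).
  assert (i2 : incl L2 L) by (intros x Hx; apply Hin, in_app_iff; auto).
  specialize (H1 L HL i1). specialize (H2 L HL i2).
  assert (T := Cmod_triangle (Csum f L - s') (- (Csum f L - s))).
  rewrite Cmod_opp in T.
  replace (Csum f L - s' + - (Csum f L - s)) with (s - s') in T by ring. lra.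
Qed.

Lemma tsum_eq {I} (f : I -> C) s : has_sum f s -> tsum f = s.
Proof.
  intros H. apply (has_sum_unique f); auto.
  unfold tsum. apply epsilon_spec. exists s; auto.
Qed.

Lemma has_sum_ext {I} (f g : I -> C) s : (forall i, f i = g i) -> has_sum f s -> has_sum g s.
Proof. intros H. replace g with f; auto. apply functional_extensionality; auto. Qed.

Lemma has_sum_plus {I} (f g : I -> C) s t :
  has_sum f s -> has_sum g t -> has_sum (fun i => f i + g i) (s + t).
Proof.
  intros H1 H2 e He.
  destruct (H1 (e/2)%R) as [L1 K1]; [lra|]. destruct (H2 (e/2)%R) as [L2 K2]; [lra|].
  exists (L1 ++ L2). intros L HL Hi. rewrite Csum_plus.
  specialize (K1 L HL (fun x h => Hi x (proj2 (in_app_iff _ _ _) (or_introl h)))).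
  specialize (K2 L HL (fun x h => Hi x (proj2 (in_app_iff _ _ _) (or_intror h)))).
  replace (Csum f L + Csum g L - (s + t)) with ((Csum f L - s) + (Csum g L - t)) by ring.
  eapply Rle_lt_trans; [apply Cmod_triangle|]. lra.
Qed.

Lemma has_sum_scal {I} (k : C) (f : I -> C) s :
  has_sum f s -> has_sum (fun i => k * f i) (k * s).
Proof.
  intros H e He. assert (Hk := Cmod_ge_0 k).
  destruct (H (e / (Cmod k + 1))%R) as [L0 K]. { apply Rdiv_lt_0_compat; lra. }
  exists L0. intros L HL Hi. specialize (K L HL Hi). rewrite Csum_scal.
  replace (k * Csum f L - k * s) with (k * (Csum f L - s)) by ring. rewrite Cmod_mult.
  assert (hm := Cmod_ge_0 (Csum f L - s)).
  apply Rle_lt_trans with ((Cmod k + 1) * Cmod (Csum f L - s))%R; [nra|].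
  apply Rlt_le_trans with ((Cmod k + 1) * (e / (Cmod k + 1)))%R.
  - apply Rmult_lt_compat_l; lra.
  - right. field. lra.
Qed.

Lemma has_sum_minus {I} (f g : I -> C) s t :
  has_sum f s -> has_sum g t -> has_sum (fun i => f i - g i) (s - t).
Proof.
  intros H1 H2. replace (s - t) with (s + (-1) * t) by ring.
  eapply has_sum_ext; [| apply (has_sum_plus f _ s _ H1 (has_sum_scal (-1) g t H2))].
  intros i; simpl; ring.
Qed.

Lemma Csum_Cconj {I} (f : I -> C) l : Csum (fun i => Cconj (f i)) l = Cconj (Csum f l).
Proof.
  induction l; simpl. unfold Cconj, RtoC; simpl; f_equal; ring.
  rewrite IHl. unfold Cconj, Cplus; simpl; f_equal; ring.
Qed.

Lemma has_sum_Cconj {I} (f : I -> C) s : has_sum f s -> has_sum (fun i => Cconj (f i)) (Cconj s).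
Proof.
  intros H e He. destruct (H e He) as [L0 K]. exists L0. intros L HL Hi.
  rewrite Csum_Cconj, <- Cminus_conj, Cmod_conj. auto.
Qed.

Lemma has_sum_finite {I} (f : I -> C) (L0 : list I) :
  NoDup L0 -> (forall i, ~ In i L0 -> f i = 0) -> has_sum f (Csum f L0).
Proof.
  intros Hn Hz e He. exists L0. intros L HL Hi.
  replace (Csum f L) with (Csum f L0).
  replace (Csum f L0 - Csum f L0) with (RtoC 0) by ring. rewrite Cmod_0; auto.
  set (P := fun i => if excluded_middle_informative (In i L0) then true else false).
  assert (E : Csum f L = Csum f (filter P L)).
  { clear HL Hi. induction L as [|a L IH]; simpl; auto. rewrite IH.
    unfold P at 2. destruct (excluded_middle_informative (In a L0)); simpl; auto.
    rewrite Hz by auto. ring. }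
  rewrite E. apply Csum_same; auto. apply NoDup_filter; auto.
  intros i. rewrite filter_In. unfold P.
  destruct (excluded_middle_informative (In i L0)) as [h|h]; split; try tauto.
  - intros _. auto.
  - intros [_ ?]; discriminate.
Qed.

Lemma has_sum_single {I} (f : I -> C) i0 :
  (forall i, i <> i0 -> f i = 0) -> has_sum f (f i0).
Proof.
  intros H. replace (f i0) with (Csum f (i0 :: nil)) by (simpl; ring).
  apply has_sum_finite. constructor; [simpl; tauto | constructor].
  intros i Hi. apply H. intros ->. apply Hi; simpl; auto.
Qed.

Lemma has_sum_zero {I} (f : I -> C) : (forall i, f i = 0) -> has_sum f 0.
Proof. intros H. change (RtoC 0) with (Csum f nil). apply has_sum_finite; auto; constructor. Qed.

(** The sum is the supremum of the finite partial sums: once one of them is within e of it,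
    monotonicity keeps all larger ones there. *)
Lemma has_sum_nonneg {I} (f : I -> R) M :
  (forall i, (0 <= f i)%R) -> (forall L, NoDup L -> (Rsum f L <= M)%R) ->
  exists S, has_sum (fun i => RtoC (f i)) (RtoC S).
Proof.
  intros Hp Hb.
  destruct (completeness (fun y => exists L, NoDup L /\ y = Rsum f L)) as [S [Hub Hlub]].
  - exists M. intros y [L [HL ->]]. auto.
  - exists 0%R, nil. split; [constructor | reflexivity].
  - exists S. intros e He.
    assert (K : exists L0, NoDup L0 /\ (S - e < Rsum f L0)%R).
    { apply NNPP. intros Hn. assert (S <= S - e)%R; [|lra]. apply Hlub.
      intros y [L [HL ->]]. apply Rnot_lt_le. intros h. apply Hn. exists L; auto. }
    destruct K as [L0 [HL0 K]]. exists L0. intros L HL Hi.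
    rewrite Csum_RtoC, <- RtoC_minus, Cmod_R.
    assert (Rsum f L <= S)%R by (apply Hub; exists L; auto).
    assert (T := Rsum_incl f L0 L Hp HL0 Hi).
    apply Rabs_def1; lra.
Qed.

Lemma has_sum_real {I} (f : I -> R) :
  abs_summable (fun i => RtoC (f i)) -> exists S, has_sum (fun i => RtoC (f i)) (RtoC S).
Proof.
  intros [M H].
  assert (H' : forall g : I -> R, (forall i, (0 <= g i <= Rabs (f i))%R) ->
     exists S, has_sum (fun i => RtoC (g i)) (RtoC S)).
  { intros g Hg. apply has_sum_nonneg with M. apply Hg.
    intros L HL. eapply Rle_trans; [|apply (H L HL)]. apply Rsum_le. intros i _.
    rewrite Cmod_R. apply Hg. }
  destruct (H' (fun i => Rmax (f i) 0)) as [S1 H1].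
  { intros i. unfold Rmax; destruct Rle_dec; split; try lra; auto using Rabs_pos.
    apply Rle_abs. }
  destruct (H' (fun i => Rmax (- f i) 0)) as [S2 H2].
  { intros i. unfold Rmax; destruct Rle_dec; split; try lra; auto using Rabs_pos.
    rewrite <- Rabs_Ropp. apply Rle_abs. }
  exists (S1 - S2)%R. rewrite RtoC_minus.
  eapply has_sum_ext; [|apply (has_sum_minus _ _ _ _ H1 H2)].
  intros i. simpl. rewrite <- RtoC_minus. f_equal.
  unfold Rmax; repeat destruct Rle_dec; lra.
Qed.

Lemma abs_summable_le {I} (f g : I -> C) :
  (forall i, (Cmod (f i) <= Cmod (g i))%R) -> abs_summable g -> abs_summable f.
Proof.
  intros H [M K]. exists M. intros L HL. eapply Rle_trans; [|apply (K L HL)].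
  apply Rsum_le; auto.
Qed.

Lemma abs_summable_has_sum {I} (f : I -> C) : abs_summable f -> has_sum f (tsum f).
Proof.
  intros H. unfold tsum. apply epsilon_spec.
  destruct (has_sum_real (fun i => fst (f i))) as [S1 H1].
  { apply abs_summable_le with f; auto. intros i. rewrite Cmod_R.
    eapply Rle_trans; [|apply Rmax_Cmod]. apply Rmax_l. }
  destruct (has_sum_real (fun i => snd (f i))) as [S2 H2].
  { apply abs_summable_le with f; auto. intros i. rewrite Cmod_R.
    eapply Rle_trans; [|apply Rmax_Cmod]. apply Rmax_r. }
  exists (RtoC S1 + Ci * RtoC S2).
  eapply has_sum_ext; [|apply (has_sum_plus _ _ _ _ H1 (has_sum_scal Ci _ _ H2))].
  intros i. simpl. destruct (f i) as [u v]. simpl.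
  unfold Ci, RtoC, Cplus, Cmult; simpl; f_equal; ring.
Qed.

Lemma has_sum_Cmod_le {I} (f : I -> C) s M :
  has_sum f s -> (forall L, NoDup L -> (Rsum (fun i => Cmod (f i)) L <= M)%R) -> (Cmod s <= M)%R.
Proof.
  intros H Hb. apply Rnot_lt_le. intros Hlt.
  destruct (H (Cmod s - M)%R) as [L0 K]; [lra|].
  destruct (exists_NoDup_list L0) as [L [HL Hin]].
  specialize (K L HL (fun x h => proj2 (Hin x) h)).
  assert (T := Cmod_triangle (Csum f L) (- (Csum f L - s))). rewrite Cmod_opp in T.
  replace (Csum f L + - (Csum f L - s)) with s in T by ring.
  assert (T2 := Csum_Cmod f L). specialize (Hb L HL). lra.
Qed.

Lemma has_sum_ge {I} (f : I -> R) S L :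
  (forall i, (0 <= f i)%R) -> has_sum (fun i => RtoC (f i)) (RtoC S) ->
  NoDup L -> (Rsum f L <= S)%R.
Proof.
  intros Hp H HL. apply Rnot_lt_le. intros Hlt.
  destruct (H (Rsum f L - S)%R) as [L0 K]; [lra|].
  destruct (exists_NoDup_list (L0 ++ L)) as [L' [HL' Hin]].
  assert (K' := K L' HL' (fun x h => proj2 (Hin x) (proj2 (in_app_iff _ _ _) (or_introl h)))).
  assert (T := Rsum_incl f L L' Hp HL (fun x h => proj2 (Hin x) (proj2 (in_app_iff _ _ _) (or_intror h)))).
  rewrite Csum_RtoC, <- RtoC_minus, Cmod_R in K'. apply Rabs_def2 in K'. lra.
Qed.

Lemma has_sum_abs_summable {I} (f : I -> R) S :
  (forall i, (0 <= f i)%R) -> has_sum (fun i => RtoC (f i)) (RtoC S) ->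
  abs_summable (fun i => RtoC (f i)).
Proof.
  intros Hp H. exists S. intros L HL.
  eapply Rle_trans; [|apply (has_sum_ge f S L Hp H HL)]. apply Rsum_le. intros i _.
  rewrite Cmod_R, Rabs_pos_eq; auto. lra.
Qed.

Lemma abs_summable_plus {I} (f g : I -> C) :
  abs_summable f -> abs_summable g -> abs_summable (fun i => f i + g i).
Proof.
  intros [M H] [N K]. exists (M + N)%R. intros L HL. specialize (H L HL). specialize (K L HL).
  eapply Rle_trans with (Rsum (fun i => Cmod (f i) + Cmod (g i))%R L).
  apply Rsum_le. intros; apply Cmod_triangle. rewrite Rsum_plus. lra.
Qed.

Lemma abs_summable_scal {I} (k : C) (f : I -> C) :
  abs_summable f -> abs_summable (fun i => k * f i).
Proof.
  intros [M H]. exists (Cmod k * M)%R. intros L HL.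
  eapply Rle_trans with (Rsum (fun i => Cmod k * Cmod (f i))%R L).
  apply Rsum_le. intros; rewrite Cmod_mult; lra. rewrite Rsum_scal.
  apply Rmult_le_compat_l; auto. apply Cmod_ge_0.
Qed.

Lemma abs_summable_ext {I} (f g : I -> C) :
  (forall i, f i = g i) -> abs_summable f -> abs_summable g.
Proof. intros H. replace g with f; auto. apply functional_extensionality; auto. Qed.

Lemma abs_summable_inj {I J} (phi : I -> J) (f : J -> C) :
  (forall i i', phi i = phi i' -> i = i') -> abs_summable f -> abs_summable (fun i => f (phi i)).
Proof.
  intros Hinj [M H]. exists M. intros L HL.
  rewrite <- (Rsum_map phi (fun j => Cmod (f j))). apply H.
  apply FinFun.Injective_map_NoDup; auto.
Qed.

Lemma preimage_list {I J} (phi : I -> J) (L : list J) :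
  (forall i i', phi i = phi i' -> i = i') -> NoDup L ->
  exists K, NoDup K /\ forall i, In i K <-> In (phi i) L.
Proof.
  intros Hinj. induction L as [|j L IH]; intros HL.
  - exists nil. split; [constructor | intros; simpl; tauto].
  - inversion HL; subst. destruct (IH H2) as [K [HK Hin]].
    destruct (classic (exists i, phi i = j)) as [[i Hi]|Hn].
    + exists (i :: K). split.
      * constructor; auto. rewrite Hin, Hi. auto.
      * intros i'. simpl. rewrite Hin. split; intros [h|h]; auto; subst; auto.
    + exists K. split; auto. intros i. simpl. rewrite Hin. split; auto.
      intros [h|h]; auto. exfalso; apply Hn. exists i; auto.
Qed.

Lemma Csum_preimage {I J} (phi : I -> J) (f : J -> C) K L :
  (forall i i', phi i = phi i' -> i = i') ->
  (forall j, (forall i, phi i <> j) -> f j = 0) -> NoDup K -> NoDup L ->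
  (forall i, In i K <-> In (phi i) L) -> Csum f L = Csum (fun i => f (phi i)) K.
Proof.
  intros Hinj Hz HK HL Hin. rewrite <- (Csum_map phi f).
  set (P := fun j => if excluded_middle_informative (In j (map phi K)) then true else false).
  assert (E : Csum f L = Csum f (filter P L)).
  { assert (Hin' : forall j, In j L -> In j (map phi K) \/ f j = 0).
    { intros j Hj. destruct (classic (exists i, phi i = j)) as [[i Hi]|Hn].
      - left. apply in_map_iff. exists i; split; auto. apply Hin. rewrite Hi. auto.
      - right. apply Hz. intros i h. apply Hn. exists i; auto. }
    clear HL Hin. induction L as [|a L IH]; simpl; auto. rewrite IH; [|simpl in Hin'; auto].
    unfold P at 2. destruct (excluded_middle_informative (In a (map phi K))); simpl; auto.
    destruct (Hin' a); simpl; auto. tauto. rewrite H. ring. }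
  rewrite E. apply Csum_same.
  - apply NoDup_filter; auto.
  - apply FinFun.Injective_map_NoDup; auto.
  - intros j. rewrite filter_In. unfold P. destruct excluded_middle_informative as [h|h].
    + split; auto. intros _. split; auto. apply in_map_iff in h. destruct h as [i [<- Hi]].
      apply Hin; auto.
    + split; [intros [_ ?]; discriminate | tauto].
Qed.

(** The common source of all reindexings: translations and reflections of Z, exchange of the
    coordinates of a pair, extension by 0 from the naturals to Z, and regrouping along
    antidiagonals. *)
Lemma has_sum_inj {I J} (phi : I -> J) (f : J -> C) s :
  (forall i i', phi i = phi i' -> i = i') ->
  (forall j, (forall i, phi i <> j) -> f j = 0) ->
  has_sum (fun i => f (phi i)) s <-> has_sum f s.
Proof.
  intros Hinj Hz. split; intros H e He.
  - destruct (H e He) as [L0 K]. exists (map phi L0). intros L HL Hi.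
    destruct (preimage_list phi L Hinj HL) as [L' [HL' Hin]].
    rewrite (Csum_preimage phi f L' L); auto. apply K; auto.
    intros i h. apply Hin, Hi, in_map; auto.
  - destruct (H e He) as [L0 K].
    destruct (exists_NoDup_list L0) as [L1 [HL1 Hin1]].
    destruct (preimage_list phi L1 Hinj HL1) as [K0 [HK0 HinK]].
    exists K0. intros L HL Hi.
    destruct (exists_NoDup_list (L1 ++ map phi L)) as [L2 [HL2 Hin2]].
    rewrite <- (Csum_preimage phi f L L2); auto.
    + apply K; auto. intros x hx. apply Hin2, in_app_iff. left. apply Hin1; auto.
    + intros i. rewrite Hin2, in_app_iff, in_map_iff. split.
      * intros h. right. exists i; auto.
      * intros [h|[i' [E h]]]; [apply Hi, HinK; auto | apply Hinj in E; subst; auto].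
Qed.

Lemma abs_summable_inj_iff {I J} (phi : I -> J) (f : J -> C) :
  (forall i i', phi i = phi i' -> i = i') ->
  (forall j, (forall i, phi i <> j) -> f j = 0) ->
  abs_summable (fun i => f (phi i)) -> abs_summable f.
Proof.
  intros Hinj Hz [M H]. exists M. intros L HL.
  destruct (preimage_list phi L Hinj HL) as [K [HK Hin]].
  specialize (H K HK).
  assert (E := Csum_preimage phi (fun j => RtoC (Cmod (f j))) K L Hinj).
  rewrite !Csum_RtoC in E. apply RtoC_inj in E; auto. rewrite E; auto.
  intros j Hj. rewrite Hz, Cmod_0; auto.
Qed.

(** Finitely many convergent rows share one finite set of columns; Fubini and the contraction bound
    for kernels both need this uniformity. *)
Lemma common_list {I J} (f : I -> J -> C) (R : I -> C) (K : list I) d :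
  (0 < d)%R -> (forall i, has_sum (f i) (R i)) ->
  exists M0, forall M, NoDup M -> incl M0 M ->
    forall i, In i K -> (Cmod (Csum (f i) M - R i) < d)%R.
Proof.
  intros Hd H. induction K as [|i K [M0 IH]].
  - exists nil. intros; simpl in *; tauto.
  - destruct (H i d Hd) as [M1 H1]. exists (M1 ++ M0). intros M HM Hi i' [->|h].
    + apply H1; auto. intros x hx. apply Hi, in_app_iff; auto.
    + apply IH; auto. intros x hx. apply Hi, in_app_iff; auto.
Qed.

Lemma Csum_list_prod {I J} (f : I * J -> C) K M :
  Csum f (list_prod K M) = Csum (fun i => Csum (fun j => f (i, j)) M) K.
Proof.
  induction K; simpl; auto. rewrite Csum_app, IHK, Csum_map. auto.
Qed.

Lemma NoDup_list_prod {I J} (K : list I) (M : list J) :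
  NoDup K -> NoDup M -> NoDup (list_prod K M).
Proof.
  intros HK HM. induction HK as [|i K Hi HK IH]; simpl. constructor.
  apply NoDup_app; auto.
  - apply FinFun.Injective_map_NoDup; auto. intros x y h; inversion h; auto.
  - intros [a b] h h'. apply in_map_iff in h. destruct h as [x [E _]]. inversion E; subst.
    apply in_prod_iff in h'. tauto.
Qed.

(** A rectangle K x M that contains the witness for s has sum within e/2 of s. Enlarging M brings
    each row over K within d of its own sum, so the row errors add up to at most e/2. *)
Lemma has_sum_fubini {I J} (f : I * J -> C) (R : I -> C) s :
  has_sum f s -> (forall i, has_sum (fun j => f (i, j)) (R i)) -> has_sum R s.
Proof.
  intros H HR e He.
  destruct (H (e/2)%R) as [L0 HL0]; [lra|].
  exists (map fst L0). intros K HK Hi.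
  (* The added 1 keeps the quotient defined when K is empty. *)
  set (d := (e / 2 / (INR (length K) + 1))%R).
  assert (Hlen := pos_INR (length K)).
  assert (Hd : (0 < d)%R) by (apply Rdiv_lt_0_compat; lra).
  destruct (common_list (fun i j => f (i, j)) R K d Hd HR) as [M0 HM0].
  destruct (exists_NoDup_list (M0 ++ map snd L0)) as [M [HM Hin]].
  assert (h1 : incl L0 (list_prod K M)).
  { intros [i j] hij. apply in_prod_iff. split.
    - apply Hi. apply in_map_iff. exists (i, j); auto.
    - apply Hin, in_app_iff. right. apply in_map_iff. exists (i, j); auto. }
  specialize (HL0 _ (NoDup_list_prod K M HK HM) h1). rewrite Csum_list_prod in HL0.
  assert (h2 := HM0 M HM (fun x h => proj2 (Hin x) (proj2 (in_app_iff _ _ _) (or_introl h)))).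
  assert (h3 : (Cmod (Csum (fun i => R i - Csum (fun j => f (i, j)) M)%C K) <= e / 2)%R).
  { eapply Rle_trans; [apply Csum_Cmod|].
    apply Rle_trans with (Rsum (fun _ => d) K).
    - apply Rsum_le. intros i hi. specialize (h2 i hi).
      rewrite <- Cmod_opp. left.
      replace (- (R i - Csum (fun j => f (i, j)) M)) with (Csum (fun j => f (i, j)) M - R i) by ring.
      exact h2.
    - apply Rle_trans with (INR (length K) * d)%R.
      + right. apply Rsum_const.
      + unfold d. apply Rmult_le_reg_r with (INR (length K) + 1)%R; [lra|].
        field_simplify; [|lra]. nra. }
  replace (Csum R K - s) with
    (Csum (fun i => R i - Csum (fun j => f (i, j)) M) K
     + (Csum (fun i => Csum (fun j => f (i, j)) M) K - s)).
  - eapply Rle_lt_trans; [apply Cmod_triangle|]. lra.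
  - replace (Csum R K) with (Csum (fun i => (R i - Csum (fun j => f (i, j)) M) + Csum (fun j => f (i, j)) M) K).
    rewrite Csum_plus. ring.
    apply Csum_ext. intros; ring.
Qed.

Lemma Rsum_list_prod {I J} (f : I * J -> R) K M :
  Rsum f (list_prod K M) = Rsum (fun i => Rsum (fun j => f (i, j)) M) K.
Proof.
  induction K; simpl; auto. rewrite Rsum_app, IHK, Rsum_map. auto.
Qed.

(** Any finite set of pairs lies in the rectangle spanned by its two projections, where the iterated
    bound applies. *)
Lemma abs_summable_tonelli {I J} (f : I * J -> C) (R : I -> R) N :
  (forall i M, NoDup M -> (Rsum (fun j => Cmod (f (i, j))) M <= R i)%R) ->
  (forall K, NoDup K -> (Rsum R K <= N)%R) -> abs_summable f.
Proof.
  intros H1 H2. exists N. intros L HL.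
  destruct (exists_NoDup_list (map fst L)) as [K [HK HinK]].
  destruct (exists_NoDup_list (map snd L)) as [M [HM HinM]].
  apply Rle_trans with (Rsum (fun x => Cmod (f x)) (list_prod K M)).
  - apply Rsum_incl; auto. intros; apply Cmod_ge_0.
    intros [i j] h. apply in_prod_iff. rewrite HinK, HinM, !in_map_iff.
    split; exists (i, j); auto.
  - rewrite Rsum_list_prod. eapply Rle_trans; [|apply (H2 K HK)].
    apply Rsum_le. auto.
Qed.

Definition tnorm {I} (f : I -> C) : R := Re (tsum (fun i => RtoC (Cmod (f i)))).

Lemma tnorm_sum {I} (f : I -> C) : abs_summable f ->
  has_sum (fun i => RtoC (Cmod (f i))) (RtoC (tnorm f)).
Proof.
  intros H. destruct (has_sum_real (fun i => Cmod (f i))) as [S HS].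
  - eapply abs_summable_le; [|apply H]. intros; rewrite Cmod_R, Rabs_pos_eq. lra. apply Cmod_ge_0.
  - unfold tnorm. rewrite (tsum_eq _ _ HS). exact HS.
Qed.

Lemma Rsum_le_tnorm {I} (f : I -> C) L : abs_summable f -> NoDup L ->
  (Rsum (fun i => Cmod (f i)) L <= tnorm f)%R.
Proof.
  intros H HL. apply has_sum_ge; auto using tnorm_sum. intros; apply Cmod_ge_0.
Qed.

Lemma tnorm_le {I} (f : I -> C) N : abs_summable f ->
  (forall L, NoDup L -> (Rsum (fun i => Cmod (f i)) L <= N)%R) -> (tnorm f <= N)%R.
Proof.
  intros H Hb. apply Rle_trans with (Cmod (RtoC (tnorm f))). rewrite Cmod_R; apply Rle_abs.
  apply (has_sum_Cmod_le _ _ N (tnorm_sum f H)). intros L HL.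
  eapply Rle_trans; [|apply (Hb L HL)]. apply Rsum_le. intros.
  rewrite Cmod_R, Rabs_pos_eq. lra. apply Cmod_ge_0.
Qed.

Lemma Cmod_le_tnorm {I} (f : I -> C) i : abs_summable f -> (Cmod (f i) <= tnorm f)%R.
Proof.
  intros H. assert (T := Rsum_le_tnorm f (i :: nil) H). simpl in T.
  rewrite Rplus_0_r in T. apply T. constructor; simpl; auto. constructor.
Qed.

Lemma tsum_le_tnorm {I} (f : I -> C) : abs_summable f -> (Cmod (tsum f) <= tnorm f)%R.
Proof.
  intros H. apply (has_sum_Cmod_le f). apply abs_summable_has_sum; auto.
  intros; apply Rsum_le_tnorm; auto.
Qed.

Lemma abs_summable_mul {I J} (f : I -> C) (g : J -> C) :
  abs_summable f -> abs_summable g -> abs_summable (fun p => f (fst p) * g (snd p)).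
Proof.
  intros [M H] Hg.
  apply abs_summable_tonelli with (R := fun i => (tnorm g * Cmod (f i))%R) (N := (tnorm g * M)%R).
  - intros i L HL. simpl.
    apply Rle_trans with (Rsum (fun j => Cmod (f i) * Cmod (g j))%R L).
    { apply Rsum_le. intros; rewrite Cmod_mult; lra. }
    rewrite Rsum_scal, Rmult_comm. apply Rmult_le_compat_r. apply Cmod_ge_0.
    apply Rsum_le_tnorm; auto.
  - intros K HK. rewrite Rsum_scal. apply Rmult_le_compat_l; auto.
    assert (T := Rsum_le_tnorm g nil Hg (NoDup_nil _)). exact T.
Qed.

Lemma fubini_swap {I J} (f : I * J -> C) (R : I -> C) (S : J -> C) s :
  abs_summable f -> (forall i, has_sum (fun j => f (i, j)) (R i)) ->
  (forall j, has_sum (fun i => f (i, j)) (S j)) -> has_sum R s -> has_sum S s.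
Proof.
  intros H HR HS Hs.
  assert (Hf := abs_summable_has_sum f H).
  assert (E := has_sum_fubini f R _ Hf HR). rewrite (has_sum_unique _ _ _ Hs E).
  apply (has_sum_fubini (fun p => f (snd p, fst p))); auto.
  apply (has_sum_inj (fun p : J * I => (snd p, fst p)) f); auto.
  - intros [a b] [a' b'] h; simpl in h; inversion h; auto.
  - intros [a b] h. destruct (h (b, a)); auto.
Qed.

Lemma abs_summable_row {I J} (f : I * J -> C) i :
  abs_summable f -> abs_summable (fun j => f (i, j)).
Proof. apply (abs_summable_inj (fun j => (i, j)) f). intros ? ? h; inversion h; auto. Qed.

Lemma abs_summable_col {I J} (f : I * J -> C) j :
  abs_summable f -> abs_summable (fun i => f (i, j)).
Proof. apply (abs_summable_inj (fun i => (i, j)) f). intros ? ? h; inversion h; auto. Qed.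

(** * Unconditional sums compared with series over the naturals *)

Lemma sum_n_Csum (a : nat -> C) n : @sum_n C_AbelianMonoid a n = Csum a (seq 0 (S n)).
Proof.
  induction n.
  - rewrite sum_O. simpl. ring.
  - rewrite sum_Sn, IHn. rewrite (seq_S (S n)), Csum_app.
    unfold plus; simpl. change (0 + S n)%nat with (S n). ring.
Qed.

Lemma is_series_C_iff (a : nat -> C) (s : C) :
  @is_series C_AbsRing C_NormedModule a s <->
  forall e, (0 < e)%R -> exists N, forall n, (N <= n)%nat -> (Cmod (Csum a (seq 0 (S n)) - s) < e)%R.
Proof.
  assert (B := @filterlim_locally_ball_norm C_AbsRing nat C_NormedModule eventually
    (@filter_filter _ _ eventually_filter) (sum_n a) s).
  split; intros H.
  - intros e He. destruct (proj1 B H (mkposreal e He)) as [N HN]. exists N. intros n Hn.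
    specialize (HN n Hn). unfold ball_norm in HN. simpl pos in HN.
    change (@sum_n (NormedModule.AbelianMonoid C_AbsRing C_NormedModule) a n)
      with (@sum_n C_AbelianMonoid a n) in HN.
    rewrite sum_n_Csum in HN. exact HN.
  - apply B. intros [e He]. destruct (H e He) as [N HN]. exists N. intros n Hn. specialize (HN n Hn).
    unfold ball_norm. rewrite <- sum_n_Csum in HN. exact HN.
Qed.

Lemma has_sum_is_series (a : nat -> C) s :
  has_sum a s -> @is_series C_AbsRing C_NormedModule a s.
Proof.
  intros H. apply is_series_C_iff. intros e He. destruct (H e He) as [L0 K].
  exists (list_max L0). intros n Hn. apply K. apply seq_NoDup.
  intros x hx. apply in_seq. assert (T := proj1 (list_max_le L0 _) (le_n _)).
  rewrite Forall_forall in T. specialize (T x hx). lia.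
Qed.

Lemma is_series_has_sum (a : nat -> C) s :
  abs_summable a -> @is_series C_AbsRing C_NormedModule a s -> has_sum a s.
Proof.
  intros Ha H. assert (Hs := abs_summable_has_sum a Ha).
  replace s with (tsum a); auto. apply has_sum_is_series in Hs.
  rewrite is_series_C_iff in H, Hs.
  apply NNPP. intros Hn.
  assert (Hd : (0 < Cmod (tsum a - s))%R).
  { apply Cmod_gt_0. intros E. apply Hn. replace (tsum a) with ((tsum a - s) + s) by ring. rewrite E; ring. }
  destruct (H (Cmod (tsum a - s) / 2)%R) as [N1 H1]; [lra|].
  destruct (Hs (Cmod (tsum a - s) / 2)%R) as [N2 H2]; [lra|].
  specialize (H1 (N1 + N2)%nat ltac:(lia)). specialize (H2 (N1 + N2)%nat ltac:(lia)).
  set (u := Csum a _) in *.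
  assert (T := Cmod_triangle (u - s) (- (u - tsum a))). rewrite Cmod_opp in T.
  replace (u - s + - (u - tsum a)) with (tsum a - s) in T by ring. lra.
Qed.

Lemma fst_Csum {I} (f : I -> C) l : fst (Csum f l) = Rsum (fun i => fst (f i)) l.
Proof. induction l; simpl; auto. rewrite IHl; auto. Qed.
Lemma snd_Csum {I} (f : I -> C) l : snd (Csum f l) = Rsum (fun i => snd (f i)) l.
Proof. induction l; simpl; auto. rewrite IHl; auto. Qed.

Lemma sum_n_Rsum (a : nat -> R) n : sum_n a n = Rsum a (seq 0 (S n)).
Proof.
  induction n.
  - rewrite sum_O. simpl. ring.
  - rewrite sum_Sn, IHn. rewrite (seq_S (S n)), Rsum_app.
    unfold plus; simpl. change (0 + S n)%nat with (S n). ring.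
Qed.

Lemma is_series_R_iff (a : nat -> R) (s : R) : is_series a s <->
  forall e, (0 < e)%R -> exists N, forall n, (N <= n)%nat -> (Rabs (Rsum a (seq 0 (S n)) - s) < e)%R.
Proof.
  assert (B := @filterlim_locally_ball_norm R_AbsRing nat R_NormedModule eventually
    (@filter_filter _ _ eventually_filter) (sum_n a) s).
  split; intros H.
  - intros e He. destruct (proj1 B H (mkposreal e He)) as [N HN]. exists N. intros n Hn.
    specialize (HN n Hn). unfold ball_norm in HN. simpl pos in HN.
    rewrite sum_n_Rsum in HN. exact HN.
  - apply B. intros [e He]. destruct (H e He) as [N HN]. exists N. intros n Hn. specialize (HN n Hn).
    unfold ball_norm. rewrite <- sum_n_Rsum in HN. exact HN.
Qed.

Lemma has_sum_is_series_parts (a : nat -> C) s :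
  has_sum a s -> is_series (fun n => fst (a n)) (fst s) /\ is_series (fun n => snd (a n)) (snd s).
Proof.
  intros H. apply has_sum_is_series in H. rewrite is_series_C_iff in H.
  split; apply is_series_R_iff; intros e He; destruct (H e He) as [N HN]; exists N; intros n Hn;
    specialize (HN n Hn); eapply Rle_lt_trans; try apply HN.
  - rewrite <- fst_Csum. set (u := Csum _ _).
    apply Rle_trans with (2 := Rmax_Cmod (u - s)). apply Rmax_l.
  - rewrite <- snd_Csum. set (u := Csum _ _).
    apply Rle_trans with (2 := Rmax_Cmod (u - s)). apply Rmax_r.
Qed.

Lemma CSeries_tsum (a : nat -> C) s : has_sum a s -> CSeries a = s.
Proof.
  intros H. destruct (has_sum_is_series_parts a s H) as [H1 H2].
  unfold CSeries. rewrite (is_series_unique _ _ H1), (is_series_unique _ _ H2).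
  destruct s; auto.
Qed.

Lemma abs_summable_ex_series (f : nat -> R) :
  (forall n, (0 <= f n)%R) -> abs_summable (fun n => RtoC (f n)) <-> ex_series f.
Proof.
  intros Hp. split.
  - intros H. destruct (has_sum_real f H) as [S HS]. exists S.
    apply (has_sum_is_series_parts _ _ HS).
  - intros [S HS]. exists S. intros L HL.
    apply Rle_trans with (Rsum f (seq 0 (1 + list_max L))).
    + apply Rle_trans with (Rsum f L).
      * apply Rsum_le. intros. rewrite Cmod_R, Rabs_pos_eq; auto; lra.
      * apply Rsum_incl; auto. intros x hx. apply in_seq.
        assert (T := proj1 (list_max_le L _) (le_n _)).
        rewrite Forall_forall in T. specialize (T x hx). lia.
    + apply Rnot_lt_le. intros Hlt. rewrite is_series_R_iff in HS.
      destruct (HS (Rsum f (seq 0 (1 + list_max L)) - S)%R) as [N HN]; [lra|].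
      specialize (HN (N + list_max L)%nat ltac:(lia)).
      assert (T : (Rsum f (seq 0 (1 + list_max L)) <= Rsum f (seq 0 (Datatypes.S (N + list_max L))))%R).
      { apply Rsum_incl; auto. apply seq_NoDup. intros x. rewrite !in_seq. lia. }
      apply Rabs_def2 in HN. lra.
Qed.

(** * Sums over Z, split as in [ZSeries] and [in_l2] into x >= 0 and x <= -1 *)

Definition Znonneg (n : nat) : Z := Z.of_nat n.
Definition Zneg_S (n : nat) : Z := (- Z.of_nat (S n))%Z.

Lemma Znonneg_inj i j : Znonneg i = Znonneg j -> i = j. Proof. unfold Znonneg; lia. Qed.
Lemma Zneg_S_inj i j : Zneg_S i = Zneg_S j -> i = j. Proof. unfold Zneg_S; lia. Qed.

Lemma Z_split (f : Z -> C) : exists f1 f2 : Z -> C,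
  (forall x, f x = f1 x + f2 x) /\
  (forall n, f1 (Znonneg n) = f (Znonneg n)) /\ (forall n, f2 (Zneg_S n) = f (Zneg_S n)) /\
  (forall x, (forall n, Znonneg n <> x) -> f1 x = 0) /\ (forall x, (forall n, Zneg_S n <> x) -> f2 x = 0).
Proof.
  exists (fun x => if Z_le_dec 0 x then f x else RtoC 0),
         (fun x => if Z_le_dec 0 x then RtoC 0 else f x).
  repeat split.
  - intros x. destruct Z_le_dec; ring.
  - intros n. destruct Z_le_dec as [h|h]; auto. unfold Znonneg in h; lia.
  - intros x H. destruct Z_le_dec as [h|h]; auto. destruct (H (Z.to_nat x)). unfold Znonneg; lia.
  - intros x H. destruct Z_le_dec as [h|h]; auto. destruct (H (Z.to_nat (- x - 1))). unfold Zneg_S; lia.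
Qed.

Lemma has_sum_Z (f : Z -> C) s1 s2 :
  has_sum (fun n => f (Znonneg n)) s1 -> has_sum (fun n => f (Zneg_S n)) s2 -> has_sum f (s1 + s2).
Proof.
  intros H1 H2. destruct (Z_split f) as [f1 [f2 [E [E1 [E2 [Z1 Z2]]]]]].
  apply has_sum_ext with (fun x => f1 x + f2 x). intros; auto.
  apply has_sum_plus.
  - apply (has_sum_inj Znonneg f1); auto using Znonneg_inj. eapply has_sum_ext; [|apply H1]. auto.
  - apply (has_sum_inj Zneg_S f2); auto using Zneg_S_inj. eapply has_sum_ext; [|apply H2]. auto.
Qed.

Lemma abs_summable_Z (f : Z -> C) :
  abs_summable f <-> abs_summable (fun n => f (Znonneg n)) /\ abs_summable (fun n => f (Zneg_S n)).
Proof.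
  split.
  - intros H. split; apply abs_summable_inj; auto using Znonneg_inj, Zneg_S_inj.
  - intros [H1 H2]. destruct (Z_split f) as [f1 [f2 [E [E1 [E2 [Z1 Z2]]]]]].
    apply abs_summable_ext with (fun x => f1 x + f2 x). intros; auto.
    apply abs_summable_plus.
    + apply (abs_summable_inj_iff Znonneg f1); auto using Znonneg_inj. eapply abs_summable_ext; [|apply H1]. auto.
    + apply (abs_summable_inj_iff Zneg_S f2); auto using Zneg_S_inj. eapply abs_summable_ext; [|apply H2]. auto.
Qed.

Lemma ZSeries_tsum (f : Z -> C) : abs_summable f -> ZSeries f = tsum f.
Proof.
  intros H. apply abs_summable_Z in H. destruct H as [H1 H2].
  apply abs_summable_has_sum in H1. apply abs_summable_has_sum in H2.
  unfold ZSeries. rewrite (tsum_eq _ _ (has_sum_Z f _ _ H1 H2)).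
  f_equal; apply CSeries_tsum; auto.
Qed.

Lemma in_l2_iff (W : Z -> R) (f : Z -> C) : (forall x, (0 <= W x)%R) ->
  in_l2 W f <-> abs_summable (fun x => RtoC (Cmod (f x) ^ 2 * W x)).
Proof.
  intros HW. rewrite abs_summable_Z.
  assert (P : forall x, (0 <= Cmod (f x) ^ 2 * W x)%R).
  { intros x. apply Rmult_le_pos; auto. apply pow2_ge_0. }
  unfold in_l2. rewrite <- !abs_summable_ex_series by auto. tauto.
Qed.

End Sums.

(** * Weighted l2 spaces and orthonormal kernels *)

(** The square of [norm_l2] as an unconditional real sum, which keeps square roots and complex
    values out of the estimates. *)
Definition sqnorm (W : Z -> R) (f : Z -> C) : R :=
  tnorm (fun x => RtoC (Cmod (f x) ^ 2 * W x)).

Definition lincomb (a : C) (g f : Z -> C) : Z -> C := fun k => Cplus (Cmult a (g k)) (f k).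

(** With the weight inside the sum, the operator of the conjugate transposed kernel is the formal
    adjoint, so a unitary and its inverse are two instances of one construction. *)
Definition kernel_op (W : Z -> R) (m : Z -> Z -> C) (f : Z -> C) (x : Z) : C :=
  tsum (fun n => Cmult (Cmult (f n) (RtoC (W n))) (m n x)).

Section Hilbert.
Open Scope C_scope.

Lemma Cmod_sq (z : C) : RtoC (Cmod z ^ 2) = z * Cconj z.
Proof. apply Cmod2_conj. Qed.

Lemma sq_weight_pos (W : Z -> R) (f : Z -> C) : (forall x, (0 < W x)%R) ->
  forall x, (0 <= Cmod (f x) ^ 2 * W x)%R.
Proof. intros HW x. apply Rmult_le_pos. apply pow2_ge_0. left; auto. Qed.

Section Weight.
Variable W : Z -> R.
Hypothesis HW : forall x, (0 < W x)%R.

Lemma in_l2_abs f : in_l2 W f <-> abs_summable (fun x => RtoC (Cmod (f x) ^ 2 * W x)).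
Proof. apply in_l2_iff. intros; left; auto. Qed.

Lemma sqnorm_sum f : in_l2 W f ->
  has_sum (fun x => RtoC (Cmod (f x) ^ 2 * W x)) (RtoC (sqnorm W f)).
Proof.
  intros H. apply in_l2_abs in H. eapply has_sum_ext; [|apply (tnorm_sum _ H)].
  intros x. simpl. rewrite Cmod_R, Rabs_pos_eq; auto. apply sq_weight_pos; auto.
Qed.

Lemma sqnorm_ge f L : in_l2 W f -> NoDup L ->
  (Rsum (fun x => Cmod (f x) ^ 2 * W x)%R L <= sqnorm W f)%R.
Proof.
  intros H HL. apply has_sum_ge; auto using sqnorm_sum. apply sq_weight_pos; auto.
Qed.

Lemma sqnorm_point f x : in_l2 W f -> (Cmod (f x) ^ 2 * W x <= sqnorm W f)%R.
Proof.
  intros H. assert (T := sqnorm_ge f (x :: nil) H). simpl in T.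
  rewrite Rplus_0_r in T. apply T. constructor; simpl; auto. constructor.
Qed.

Lemma sqnorm_ge0 f : in_l2 W f -> (0 <= sqnorm W f)%R.
Proof. intros H. apply (sqnorm_ge f nil H). constructor. Qed.

Lemma in_l2_of_bound (f : Z -> C) M :
  (forall L, NoDup L -> (Rsum (fun x => Cmod (f x) ^ 2 * W x)%R L <= M)%R) ->
  in_l2 W f /\ (sqnorm W f <= M)%R.
Proof.
  intros H.
  assert (H' : forall L, NoDup L -> (Rsum (fun x => Cmod (RtoC (Cmod (f x) ^ 2 * W x))) L <= M)%R).
  { intros L HL. eapply Rle_trans; [|apply (H L HL)]. apply Rsum_le. intros.
    rewrite Cmod_R, Rabs_pos_eq. lra. apply sq_weight_pos; auto. }
  assert (K : in_l2 W f) by (apply in_l2_abs; exists M; auto).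
  split; auto. apply tnorm_le; auto. apply in_l2_abs; auto.
Qed.

Lemma abs_summable_inner f g : in_l2 W f -> in_l2 W g ->
  abs_summable (fun x => f x * Cconj (g x) * RtoC (W x)).
Proof.
  intros Hf Hg. apply in_l2_abs in Hf. apply in_l2_abs in Hg.
  apply abs_summable_le with (2 := abs_summable_plus _ _ Hf Hg).
  intros x. rewrite <- RtoC_plus, !Cmod_mult, Cmod_conj, !Cmod_R.
  rewrite (Rabs_pos_eq (W x)) by (left; auto). rewrite Rabs_pos_eq.
  2: { apply Rplus_le_le_0_compat; apply sq_weight_pos; auto. }
  specialize (HW x). assert (0 <= Cmod (f x))%R by apply Cmod_ge_0.
  assert (0 <= Cmod (g x))%R by apply Cmod_ge_0.
  rewrite <- Rmult_plus_distr_r. apply Rmult_le_compat_r. lra.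
  nra.
Qed.

Lemma inner_sum f g : in_l2 W f -> in_l2 W g ->
  has_sum (fun x => f x * Cconj (g x) * RtoC (W x)) (inner W f g).
Proof.
  intros Hf Hg. assert (H := abs_summable_inner f g Hf Hg).
  unfold inner. rewrite ZSeries_tsum by auto. apply abs_summable_has_sum; auto.
Qed.

Lemma inner_self f : in_l2 W f -> inner W f f = RtoC (sqnorm W f).
Proof.
  intros Hf. apply (has_sum_unique _ _ _ (inner_sum f f Hf Hf)).
  eapply has_sum_ext; [|apply (sqnorm_sum f Hf)]. intros x. simpl.
  rewrite RtoC_mult. f_equal. apply Cmod_sq.
Qed.

Lemma norm_sq f : in_l2 W f -> norm_l2 W f = sqrt (sqnorm W f).
Proof. intros Hf. unfold norm_l2. rewrite inner_self; auto. Qed.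

Lemma in_l2_lincomb a f g : in_l2 W f -> in_l2 W g -> in_l2 W (lincomb a f g).
Proof.
  intros Hf Hg. apply in_l2_abs in Hf. apply in_l2_abs in Hg. apply in_l2_abs.
  apply abs_summable_le with
    (2 := abs_summable_plus _ _ (abs_summable_scal (RtoC (2 * Cmod a ^ 2)) _ Hf)
                                (abs_summable_scal (RtoC 2) _ Hg)).
  intros x. rewrite <- !RtoC_mult, <- RtoC_plus, !Cmod_R.
  assert (T : (Cmod (lincomb a f g x) <= Cmod a * Cmod (f x) + Cmod (g x))%R).
  { unfold lincomb. rewrite <- Cmod_mult. apply Cmod_triangle. }
  specialize (HW x). assert (0 <= Cmod (f x))%R by apply Cmod_ge_0.
  assert (0 <= Cmod (g x))%R by apply Cmod_ge_0.
  assert (0 <= Cmod a)%R by apply Cmod_ge_0.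
  assert (0 <= Cmod (lincomb a f g x))%R by apply Cmod_ge_0.
  rewrite !Rabs_pos_eq.
  - replace (2 * Cmod a ^ 2 * (Cmod (f x) ^ 2 * W x) + 2 * (Cmod (g x) ^ 2 * W x))%R
      with ((2 * (Cmod a * Cmod (f x)) ^ 2 + 2 * Cmod (g x) ^ 2) * W x)%R by ring.
    apply Rmult_le_compat_r; [lra|].
    apply Rle_trans with ((Cmod a * Cmod (f x) + Cmod (g x)) ^ 2)%R.
    + apply pow_incr; lra.
    + assert (0 <= (Cmod a * Cmod (f x) - Cmod (g x)) ^ 2)%R by apply pow2_ge_0. nra.
  - apply Rplus_le_le_0_compat; repeat apply Rmult_le_pos; try lra; apply pow2_ge_0.
  - apply Rmult_le_pos; [apply pow2_ge_0 | lra].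
Qed.

Lemma polarization f g : in_l2 W f -> in_l2 W g ->
  inner W f g = / 4 * (RtoC (sqnorm W (lincomb 1 g f)) - RtoC (sqnorm W (lincomb (-1) g f))
    + Ci * RtoC (sqnorm W (lincomb Ci g f)) - Ci * RtoC (sqnorm W (lincomb (- Ci) g f))).
Proof.
  intros Hf Hg. apply (has_sum_unique _ _ _ (inner_sum f g Hf Hg)).
  assert (S : forall a, has_sum (fun x => RtoC (Cmod (lincomb a g f x) ^ 2 * W x))
                          (RtoC (sqnorm W (lincomb a g f)))).
  { intros a. apply sqnorm_sum, in_l2_lincomb; auto. }
  eapply has_sum_ext; [| apply has_sum_scal, has_sum_minus;
    [apply has_sum_plus; [apply has_sum_minus; apply S | apply has_sum_scal; apply S]
    | apply has_sum_scal; apply S]].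
  intros x. cbv beta. rewrite !RtoC_mult, !Cmod_sq. unfold lincomb.
  destruct (f x) as [p q], (g x) as [p' q'].
  unfold Cconj, Ci, RtoC, Cmult, Cplus, Cminus, Copp, Cinv; simpl; f_equal; field.
Qed.

Lemma finite_in_l2 (f : Z -> C) L : NoDup L -> (forall k, ~ In k L -> f k = 0) ->
  in_l2 W f /\ sqnorm W f = Rsum (fun x => Cmod (f x) ^ 2 * W x)%R L.
Proof.
  intros HL Hz.
  assert (S : has_sum (fun x => RtoC (Cmod (f x) ^ 2 * W x))
                (RtoC (Rsum (fun x => Cmod (f x) ^ 2 * W x)%R L))).
  { rewrite <- Csum_RtoC. apply has_sum_finite; auto. intros i Hi. rewrite Hz by auto.
    rewrite Cmod_0. f_equal. ring. }
  assert (K : in_l2 W f).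
  { apply in_l2_abs. apply has_sum_abs_summable with (2 := S). apply sq_weight_pos; auto. }
  split; auto. apply RtoC_inj. apply (has_sum_unique _ _ _ (sqnorm_sum f K) S).
Qed.

Lemma basis_in_l2 n : in_l2 W (basis_vec n).
Proof.
  refine (proj1 (finite_in_l2 (basis_vec n) (n :: nil) _ _)). constructor; simpl; auto; constructor.
  intros k Hk. unfold basis_vec. destruct Z.eq_dec; auto. destruct Hk. simpl; auto.
Qed.

Definition restrict_to (L : list Z) (f : Z -> C) (k : Z) : C := if in_dec Z.eq_dec k L then f k else 0.

Lemma cut_in_l2 L f : in_l2 W (restrict_to L f).
Proof.
  destruct (exists_NoDup_list L) as [L' [HL' Hin]].
  refine (proj1 (finite_in_l2 (restrict_to L f) L' HL' _)). intros k Hk. unfold restrict_to. destruct in_dec; auto.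
  destruct Hk. apply Hin; auto.
Qed.

Lemma tail_small f e : in_l2 W f -> (0 < e)%R ->
  exists L, (sqnorm W (lincomb (-1) (restrict_to L f) f) < e)%R.
Proof.
  intros Hf He. assert (S := sqnorm_sum f Hf).
  destruct (S e He) as [L0 K]. destruct (exists_NoDup_list L0) as [L [HL Hin]].
  exists L. specialize (K L HL (fun x h => proj2 (Hin x) h)).
  assert (S2 : has_sum (fun x => RtoC (Cmod (restrict_to L f x) ^ 2 * W x))
      (Csum (fun x => RtoC (Cmod (f x) ^ 2 * W x)) L)).
  { replace (Csum (fun x => RtoC (Cmod (f x) ^ 2 * W x)) L)
      with (Csum (fun x => RtoC (Cmod (restrict_to L f x) ^ 2 * W x)) L).
    - apply has_sum_finite; auto. intros i Hi. unfold restrict_to. destruct in_dec; [tauto|].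
      rewrite Cmod_0. f_equal. ring.
    - apply Csum_ext. intros i Hi. unfold restrict_to. destruct in_dec; tauto. }
  assert (T := has_sum_minus _ _ _ _ S S2).
  assert (G : in_l2 W (lincomb (-1) (restrict_to L f) f)).
  { apply in_l2_lincomb; auto using cut_in_l2. }
  assert (E : RtoC (sqnorm W (lincomb (-1) (restrict_to L f) f))
    = RtoC (sqnorm W f) - Csum (fun x => RtoC (Cmod (f x) ^ 2 * W x)) L).
  { apply (has_sum_unique _ _ _ (sqnorm_sum _ G)). eapply has_sum_ext; [|apply T].
    intros x. cbv beta. unfold lincomb, restrict_to. destruct in_dec.
    - replace ((-1) * f x + f x) with (RtoC 0) by ring. rewrite Cmod_0.
      rewrite <- RtoC_minus. f_equal. ring.
    - replace ((-1) * 0 + f x) with (f x) by ring. rewrite Cmod_0, <- RtoC_minus. f_equal. ring. }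
  rewrite <- Cmod_opp in K.
  replace (- (Csum (fun x => RtoC (Cmod (f x) ^ 2 * W x)) L - RtoC (sqnorm W f)))
    with (RtoC (sqnorm W f) - Csum (fun x => RtoC (Cmod (f x) ^ 2 * W x)) L) in K by ring.
  rewrite <- E, Cmod_R, Rabs_pos_eq in K; auto. apply sqnorm_ge0; auto.
Qed.

End Weight.

Lemma bounded_sqnorm W1 W2 U : (forall x, (0 < W1 x)%R) -> (forall x, (0 < W2 x)%R) ->
  bounded_linear W1 W2 U ->
  exists K, (0 <= K)%R /\ forall f, in_l2 W1 f -> (sqnorm W2 (U f) <= K * sqnorm W1 f)%R.
Proof.
  intros H1 H2 [Hl [_ [K HK]]]. exists (K ^ 2)%R. split. apply pow2_ge_0.
  intros f Hf. specialize (HK f Hf). rewrite (norm_sq W2), (norm_sq W1) in HK; auto.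
  assert (P1 := sqnorm_ge0 W1 H1 f Hf). assert (P2 := sqnorm_ge0 W2 H2 _ (Hl f Hf)).
  rewrite <- (sqrt_sqrt _ P2), <- (sqrt_sqrt (sqnorm W1 f) P1).
  assert (Q2 := sqrt_pos (sqnorm W2 (U f))).
  replace (K ^ 2 * (sqrt (sqnorm W1 f) * sqrt (sqnorm W1 f)))%R
    with ((K * sqrt (sqnorm W1 f)) * (K * sqrt (sqnorm W1 f)))%R by ring.
  apply Rmult_le_compat; auto.
Qed.

(** Point evaluation is continuous on l^2 by [sqnorm_point]. The two operators agree on truncations
    of f, so a difference at x would have to come from a tail of f, whose norm is as small as
    desired. *)
Lemma bounded_linear_density W1 W2 A B :
  (forall x, (0 < W1 x)%R) -> (forall x, (0 < W2 x)%R) ->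
  bounded_linear W1 W2 A -> bounded_linear W1 W2 B ->
  (forall n x, A (basis_vec n) x = B (basis_vec n) x) ->
  forall f, in_l2 W1 f -> forall x, A f x = B f x.
Proof.
  intros H1 H2 HA HB E f Hf x.
  destruct (bounded_sqnorm W1 W2 A H1 H2 HA) as [KA [PA NA]].
  destruct (bounded_sqnorm W1 W2 B H1 H2 HB) as [KB [PB NB]].
  destruct HA as [lA [linA _]], HB as [lB [linB _]].
  (* Linearity is available only in the form a f + g; a = -1 with f = g = 0 yields that U maps 0 to
     0. *)
  assert (Zr : forall U : (Z -> C) -> Z -> C,
     (forall (a : C) (f g : Z -> C), in_l2 W1 f -> in_l2 W1 g ->
     forall x, U (fun k => Cplus (Cmult a (f k)) (g k)) x = Cplus (Cmult a (U f x)) (U g x)) ->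
     forall y, U (fun _ => RtoC 0) y = 0).
  { intros U HU y. assert (Z0 : in_l2 W1 (fun _ => RtoC 0)).
    { refine (proj1 (finite_in_l2 W1 H1 _ nil _ _)); auto. constructor. }
    assert (T := HU (-1) _ _ Z0 Z0 y).
    set (z := U (fun _ => RtoC 0) y) in *.
    assert (T' : z = (-1) * z + z).
    { rewrite <- T. unfold z. f_equal. apply functional_extensionality; intros; ring. }
    rewrite T'. ring. }
  assert (Ecut : forall L, NoDup L -> A (restrict_to L f) x = B (restrict_to L f) x).
  { induction L as [|a L IH]; intros HL.
    - replace (restrict_to nil f) with (fun _ : Z => RtoC 0).
      rewrite !Zr; auto. apply functional_extensionality; intros; reflexivity.
    - inversion HL; subst.
      replace (restrict_to (a :: L) f) with (fun k => f a * basis_vec a k + restrict_to L f k).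
      + rewrite linA, linB, E, IH; auto using basis_in_l2, cut_in_l2.
      + apply functional_extensionality; intros k. unfold restrict_to, basis_vec.
        destruct (in_dec Z.eq_dec k L), (in_dec Z.eq_dec k (a :: L)), (Z.eq_dec k a);
          subst; simpl in *; try tauto; try ring; exfalso; intuition. }
  apply NNPP. intros Hne.
  assert (Hd : (0 < Cmod (A f x - B f x))%R).
  { apply Cmod_gt_0. intros h. apply Hne. replace (A f x) with ((A f x - B f x) + B f x) by ring. rewrite h; ring. }
  set (d := Cmod (A f x - B f x)) in *.
  (* A tail of squared norm below e contributes at most 2 (KA + KB) e to d^2 W2(x), which is less
     than 4 (KA + KB + 1) e. *)
  set (e := (d ^ 2 * W2 x / (4 * (KA + KB + 1)))%R).
  assert (W2x := H2 x).
  assert (He : (0 < e)%R).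
  { apply Rdiv_lt_0_compat; [|lra]. apply Rmult_lt_0_compat; auto. apply pow_lt; auto. }
  destruct (tail_small W1 H1 f e Hf He) as [L0 K0].
  destruct (exists_NoDup_list L0) as [L [HL Hin]].
  replace (restrict_to L0 f) with (restrict_to L f) in K0.
  2: { apply functional_extensionality; intros k. unfold restrict_to.
       destruct (in_dec Z.eq_dec k L), (in_dec Z.eq_dec k L0); auto; exfalso; specialize (Hin k); tauto. }
  set (g := lincomb (-1) (restrict_to L f) f) in *.
  assert (Hg : in_l2 W1 g) by (apply in_l2_lincomb; auto using cut_in_l2).
  assert (D : A f x - B f x = A g x - B g x).
  { unfold g, lincomb. rewrite linA, linB, (Ecut L HL); auto using cut_in_l2. ring. }
  assert (TA := sqnorm_point W2 H2 (A g) x (lA g Hg)).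
  assert (TB := sqnorm_point W2 H2 (B g) x (lB g Hg)).
  specialize (NA g Hg). specialize (NB g Hg).
  assert (T : (d <= Cmod (A g x) + Cmod (B g x))%R).
  { unfold d. rewrite D. rewrite <- (Cmod_opp (B g x)). apply Cmod_triangle. }
  assert (PG := sqnorm_ge0 W1 H1 g Hg).
  assert (p1 := Cmod_ge_0 (A g x)). assert (p2 := Cmod_ge_0 (B g x)).
  assert (d ^ 2 * W2 x <= 2 * (KA + KB) * sqnorm W1 g)%R.
  { apply Rle_trans with ((2 * Cmod (A g x) ^ 2 + 2 * Cmod (B g x) ^ 2) * W2 x)%R; [|nra].
    apply Rmult_le_compat_r; [lra|].
    apply Rle_trans with ((Cmod (A g x) + Cmod (B g x)) ^ 2)%R.
    - apply pow_incr; lra.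
    - assert (0 <= (Cmod (A g x) - Cmod (B g x)) ^ 2)%R by apply pow2_ge_0. nra. }
  assert (E2 : (d ^ 2 * W2 x = 4 * (KA + KB + 1) * e)%R) by (unfold e; field; lra).
  rewrite E2 in H. nra.
Qed.

Lemma bounded_linear_id W : bounded_linear W W (fun f => f).
Proof. repeat split; auto. apply H. apply H. exists 1%R. intros; lra. Qed.

Lemma bounded_linear_comp W1 W2 W3 U V : (forall x, (0 < W1 x)%R) ->
  (forall x, (0 < W2 x)%R) -> (forall x, (0 < W3 x)%R) ->
  bounded_linear W1 W2 U -> bounded_linear W2 W3 V -> bounded_linear W1 W3 (fun f => V (U f)).
Proof.
  intros H1 H2 H3 HU HV.
  assert (BU := bounded_sqnorm _ _ _ H1 H2 HU). assert (BV := bounded_sqnorm _ _ _ H2 H3 HV).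
  destruct BU as [KU [PU NU]], BV as [KV [PV NV]].
  destruct HU as [lU [linU _]], HV as [lV [linV _]].
  split; [|split]; auto.
  - intros a f g Hf Hg x.
    replace (U (fun k : Z => a * f k + g k)) with (fun k => a * U f k + U g k). auto.
    apply functional_extensionality; intros. rewrite linU; auto.
  - exists (sqrt (KV * KU)). intros f Hf. rewrite (norm_sq W3), (norm_sq W1); auto.
    rewrite <- sqrt_mult_alt by (apply Rmult_le_pos; auto). apply sqrt_le_1_alt.
    eapply Rle_trans. apply NV; auto. rewrite Rmult_assoc. apply Rmult_le_compat_l; auto.
Qed.

Lemma has_sum_Csum {I J} (f : I -> J -> C) (s : I -> C) L :
  (forall i, In i L -> has_sum (f i) (s i)) -> has_sum (fun j => Csum (fun i => f i j) L) (Csum s L).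
Proof.
  induction L as [|a L IH]; simpl; intros H.
  - apply has_sum_zero; auto.
  - apply has_sum_plus; auto.
Qed.

Lemma Csum_delta {I} (f : I -> C) L n : NoDup L -> In n L -> (forall k, k <> n -> f k = 0) ->
  Csum f L = f n.
Proof.
  intros HL Hn H. apply (has_sum_unique f); [apply has_sum_finite | apply has_sum_single]; auto.
  intros k Hk. apply H. intros ->. auto.
Qed.

(** * Operators given by a kernel with orthogonal rows *)

Section Kernel.
Variables W1 W2 : Z -> R.
Variable m : Z -> Z -> C.
Hypothesis HW1 : forall x, (0 < W1 x)%R.
Hypothesis HW2 : forall x, (0 < W2 x)%R.
(** The vector [basis_vec n] has squared norm W1(n) and is sent to W1(n) m(n, .), so an isometry
    forces the row m(n, .) to have squared norm 1/W1(n). *)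
Hypothesis rows : forall n k, has_sum (fun x => m n x * Cconj (m k x) * RtoC (W2 x))
   (if Z.eq_dec n k then RtoC (/ W1 n) else 0).
Hypothesis cols : forall x, in_l2 W1 (fun n => m n x).

Lemma kernel_terms f x : in_l2 W1 f ->
  abs_summable (fun n => f n * RtoC (W1 n) * m n x).
Proof.
  intros Hf. eapply abs_summable_le; [|apply (abs_summable_inner W1 HW1 _ _ Hf (cols x))].
  intros n. rewrite !Cmod_mult, Cmod_conj. nra.
Qed.

(** Pythagoras: expand the square of a finite combination of rows; the Gram relations leave only the
    diagonal. *)
Lemma kernel_finite_norm (f : Z -> C) L : NoDup L ->
  has_sum (fun x => RtoC (Cmod (Csum (fun n => f n * RtoC (W1 n) * m n x) L) ^ 2 * W2 x))
    (RtoC (Rsum (fun n => Cmod (f n) ^ 2 * W1 n)%R L)).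
Proof.
  intros HL.
  assert (S : has_sum (fun x => Csum (fun n => Csum (fun k =>
       (f n * RtoC (W1 n) * Cconj (f k * RtoC (W1 k))) * (m n x * Cconj (m k x) * RtoC (W2 x))) L) L)
     (Csum (fun n => Csum (fun k => (f n * RtoC (W1 n) * Cconj (f k * RtoC (W1 k))) *
       (if Z.eq_dec n k then RtoC (/ W1 n) else 0)) L) L)).
  { apply (has_sum_Csum (fun n x => Csum (fun k =>
       (f n * RtoC (W1 n) * Cconj (f k * RtoC (W1 k))) * (m n x * Cconj (m k x) * RtoC (W2 x))) L)).
    intros n Hn. apply (has_sum_Csum (fun k x =>
       (f n * RtoC (W1 n) * Cconj (f k * RtoC (W1 k))) * (m n x * Cconj (m k x) * RtoC (W2 x)))).
    intros k Hk. apply has_sum_scal. apply rows. }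
  replace (RtoC (Rsum (fun n => Cmod (f n) ^ 2 * W1 n)%R L)) with
     (Csum (fun n => Csum (fun k => (f n * RtoC (W1 n) * Cconj (f k * RtoC (W1 k))) *
       (if Z.eq_dec n k then RtoC (/ W1 n) else 0)) L) L).
  - eapply has_sum_ext; [|apply S]. intros x. cbv beta.
    rewrite RtoC_mult, Cmod_sq, <- Csum_Cconj.
    set (a := fun n => f n * RtoC (W1 n) * m n x).
    rewrite (Csum_ext _ (fun n => (RtoC (W2 x) * Csum (fun k => Cconj (a k)) L) * a n)).
    + rewrite (Csum_scal (RtoC (W2 x) * Csum (fun k => Cconj (a k)) L) a). unfold a. ring.
    + intros n _. rewrite (Csum_ext _ (fun k => (a n * RtoC (W2 x)) * Cconj (a k))).
      rewrite Csum_scal; ring.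
      intros k _. unfold a. rewrite !Cmult_conj. ring.
  - rewrite <- Csum_RtoC. apply Csum_ext. intros n Hn.
    rewrite (Csum_delta _ L n HL Hn).
    + destruct Z.eq_dec; [|tauto]. rewrite RtoC_mult, Cmod_sq, Cmult_conj.
      assert (h := HW1 n). rewrite RtoC_inv by lra.
      replace (Cconj (RtoC (W1 n))) with (RtoC (W1 n)) by (unfold Cconj, RtoC; simpl; f_equal; ring).
      field. intros h'. apply RtoC_inj in h'. lra.
    + intros k Hk. destruct Z.eq_dec; subst; [tauto | ring].
Qed.

(** A Fatou argument. On a finite set X of points the image of f is a uniform limit of images of
    finite truncations, whose norms are known exactly and bounded by that of f. In the limit only an
    inequality survives; equality comes later from the inverse contraction. *)
Lemma kernel_contraction f : in_l2 W1 f ->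
  in_l2 W2 (kernel_op W1 m f) /\ (sqnorm W2 (kernel_op W1 m f) <= sqnorm W1 f)%R.
Proof.
  intros Hf. apply in_l2_of_bound; auto. intros X HX.
  set (N := sqnorm W1 f). assert (PN : (0 <= N)%R) by (apply sqnorm_ge0; auto).
  set (S := Rsum W2 X). assert (PS : (0 <= S)%R) by (apply Rsum_ge0; intros; left; auto).
  apply Rle_plus_epsilon. intros e He.
  (* From (v + d)^2 <= (1 + d) v^2 + d + d^2 and d <= 1, the weighted sum over X is at most N + d (N
     + 2 S). *)
  set (d := Rmin 1 (e / (N + 2 * S + 1))).
  assert (Hd : (0 < d)%R). { apply Rmin_pos. lra. apply Rdiv_lt_0_compat; lra. }
  assert (Hd1 : (d <= 1)%R) by apply Rmin_l.
  assert (Hd2 : (d * (N + 2 * S + 1) <= e)%R).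
  { apply Rle_trans with (e / (N + 2 * S + 1) * (N + 2 * S + 1))%R.
    apply Rmult_le_compat_r. lra. apply Rmin_r. right; field; lra. }
  destruct (common_list (fun x n => f n * RtoC (W1 n) * m n x) (kernel_op W1 m f) X d Hd) as [M0 HM0].
  { intros x. apply abs_summable_has_sum, kernel_terms; auto. }
  destruct (exists_NoDup_list M0) as [L [HL Hin]].
  specialize (HM0 L HL (fun x h => proj2 (Hin x) h)).
  assert (B := has_sum_ge _ _ X (sq_weight_pos W2
    (fun x => Csum (fun n => f n * RtoC (W1 n) * m n x) L) HW2) (kernel_finite_norm f L HL) HX).
  assert (B2 := sqnorm_ge W1 HW1 f L Hf HL). fold N in B2.
  set (v := fun x => Csum (fun n => f n * RtoC (W1 n) * m n x) L) in *.
  assert (B3 : (Rsum (fun x => Cmod (kernel_op W1 m f x) ^ 2 * W2 x) X <=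
     Rsum (fun x => (1 + d) * (Cmod (v x) ^ 2 * W2 x) + (d + d ^ 2) * W2 x) X)%R).
  { apply Rsum_le. intros x Hx. specialize (HM0 x Hx). specialize (HW2 x).
    assert (T : (Cmod (kernel_op W1 m f x) <= Cmod (v x) + d)%R).
    { replace (kernel_op W1 m f x) with (v x + - (v x - kernel_op W1 m f x)) by ring.
      eapply Rle_trans; [apply Cmod_triangle|]. rewrite Cmod_opp. unfold v in *; lra. }
    replace ((1 + d) * (Cmod (v x) ^ 2 * W2 x) + (d + d ^ 2) * W2 x)%R
      with (((1 + d) * (Cmod (v x) ^ 2) + (d + d ^ 2)) * W2 x)%R by ring.
    apply Rmult_le_compat_r; [lra|].
    apply Rle_trans with ((Cmod (v x) + d) ^ 2)%R.
    - apply pow_incr. split; auto. apply Cmod_ge_0.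
    - assert (0 <= d * (Cmod (v x) - 1) ^ 2)%R.
      { apply Rmult_le_pos; [lra | apply pow2_ge_0]. } nra. }
  rewrite Rsum_plus, !Rsum_scal in B3. fold S in B3.
  change (Rsum (fun i : Z => (Cmod (v i) ^ 2 * W2 i)%R) X <= Rsum (fun n => Cmod (f n) ^ 2 * W1 n) L)%R in B.
  set (V := Rsum (fun i : Z => (Cmod (v i) ^ 2 * W2 i)%R) X) in *.
  assert (V <= N)%R by lra.
  assert ((1 + d) * V <= (1 + d) * N)%R by (apply Rmult_le_compat_l; lra).
  assert (d * d * S <= d * S)%R by (apply Rmult_le_compat_r; auto; nra).
  nra.
Qed.

Lemma kernel_bounded_linear : bounded_linear W1 W2 (kernel_op W1 m).
Proof.
  split; [|split].
  - intros f Hf. apply kernel_contraction; auto.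
  - intros a f g Hf Hg x. apply tsum_eq. unfold kernel_op.
    eapply has_sum_ext; [|apply has_sum_plus; [apply (has_sum_scal a)|];
      apply abs_summable_has_sum, kernel_terms; eauto].
    intros n. cbv beta. ring.
  - exists 1%R. intros f Hf. rewrite Rmult_1_l, (norm_sq W2), (norm_sq W1); auto.
    apply sqrt_le_1_alt, kernel_contraction; auto. apply kernel_contraction; auto.
Qed.

Lemma kernel_basis n x : kernel_op W1 m (basis_vec n) x = RtoC (W1 n) * m n x.
Proof.
  apply tsum_eq.
  assert (T := has_sum_single (fun k => basis_vec n k * RtoC (W1 k) * m k x) n).
  replace (RtoC (W1 n) * m n x) with (basis_vec n n * RtoC (W1 n) * m n x).
  apply T. intros k Hk. unfold basis_vec. destruct Z.eq_dec; [tauto | ring].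
  unfold basis_vec. destruct Z.eq_dec; [ring | tauto].
Qed.
End Kernel.

Lemma isometry_inner W1 W2 U :
  (forall x, (0 < W1 x)%R) -> (forall x, (0 < W2 x)%R) -> bounded_linear W1 W2 U ->
  (forall f, in_l2 W1 f -> sqnorm W2 (U f) = sqnorm W1 f) ->
  forall f g, in_l2 W1 f -> in_l2 W1 g -> inner W2 (U f) (U g) = inner W1 f g.
Proof.
  intros H1 H2 [lU [linU _]] N f g Hf Hg.
  rewrite !polarization; auto.
  assert (E : forall a, lincomb a (U g) (U f) = U (lincomb a g f)).
  { intros a. apply functional_extensionality; intros x. unfold lincomb. rewrite linU; auto. }
  rewrite !E, !N; auto using in_l2_lincomb.
Qed.

(* Contractions inverse to each other are isometries, and polarization does the rest. *)
Lemma orthonormal_kernel_unitary W1 W2 m U :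
  (forall x, (0 < W1 x)%R) -> (forall x, (0 < W2 x)%R) ->
  (forall n k, has_sum (fun x => m n x * Cconj (m k x) * RtoC (W2 x))
     (if Z.eq_dec n k then RtoC (/ W1 n) else 0)) ->
  (forall x y, has_sum (fun n => Cconj (m n x) * Cconj (Cconj (m n y)) * RtoC (W1 n))
     (if Z.eq_dec x y then RtoC (/ W2 x) else 0)) ->
  bounded_linear W1 W2 U -> (forall n x, U (basis_vec n) x = RtoC (W1 n) * m n x) ->
  let V := kernel_op W2 (fun x n => Cconj (m n x)) in
  bounded_linear W2 W1 V /\ unitary W1 W2 U /\ is_adjoint W1 W2 U V /\
  (forall f, in_l2 W1 f -> V (U f) = f).
Proof.
  intros H1 H2 rows cols BU EU V.
  assert (cl : forall x, in_l2 W1 (fun n => m n x)).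
  { intros x. apply in_l2_abs; auto. specialize (cols x x).
    destruct Z.eq_dec; [|tauto]. apply has_sum_abs_summable with (/ W2 x)%R.
    apply sq_weight_pos; auto.
    eapply has_sum_ext; [|apply cols]. intros n. cbv beta.
    rewrite Cconj_conj, RtoC_mult, Cmod_sq. ring. }
  assert (rl : forall n, in_l2 W2 (fun x => Cconj (m n x))).
  { intros n. apply in_l2_abs; auto. specialize (rows n n).
    destruct Z.eq_dec; [|tauto]. apply has_sum_abs_summable with (/ W1 n)%R.
    apply sq_weight_pos; auto.
    eapply has_sum_ext; [|apply rows]. intros x. cbv beta.
    rewrite Cmod_conj, RtoC_mult, Cmod_sq. ring. }
  set (U0 := kernel_op W1 m).
  assert (B0 : bounded_linear W1 W2 U0) by (apply kernel_bounded_linear; auto).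
  assert (BV : bounded_linear W2 W1 V) by (apply kernel_bounded_linear; auto).
  (* U is known only through its values on basis vectors; density identifies it with the kernel
     operator on all of l^2. *)
  assert (UU : forall f, in_l2 W1 f -> U f = U0 f).
  { intros f Hf. apply functional_extensionality.
    apply (bounded_linear_density W1 W2); auto. intros n x.
    rewrite EU. unfold U0. rewrite kernel_basis; auto. }
  assert (VU : forall f, in_l2 W1 f -> V (U0 f) = f).
  { intros f Hf. apply functional_extensionality.
    apply (bounded_linear_density W1 W1 (fun f => V (U0 f)) (fun f => f)); auto.
    apply (bounded_linear_comp W1 W2 W1 U0 V); auto. apply bounded_linear_id.
    intros n k. apply tsum_eq. unfold U0.
    specialize (rows n k).
    replace (basis_vec n k) with (RtoC (W1 n) * (if Z.eq_dec n k then RtoC (/ W1 n) else 0)).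
    - eapply has_sum_ext; [|apply (has_sum_scal (RtoC (W1 n)) _ _ rows)].
      intros x. cbv beta. rewrite kernel_basis; auto. ring.
    - unfold basis_vec. specialize (H1 n). destruct Z.eq_dec, Z.eq_dec; subst; try tauto.
      rewrite RtoC_inv by lra. field. intros h; apply RtoC_inj in h; lra. ring. }
  assert (UV : forall g, in_l2 W2 g -> U0 (V g) = g).
  { intros f Hf. apply functional_extensionality.
    apply (bounded_linear_density W2 W2 (fun f => U0 (V f)) (fun f => f)); auto.
    apply (bounded_linear_comp W2 W1 W2 V U0); auto. apply bounded_linear_id.
    intros n k. apply tsum_eq. unfold V.
    specialize (cols n k).
    replace (basis_vec n k) with (RtoC (W2 n) * (if Z.eq_dec n k then RtoC (/ W2 n) else 0)).
    - eapply has_sum_ext; [|apply (has_sum_scal (RtoC (W2 n)) _ _ cols)].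
      intros x. cbv beta. rewrite kernel_basis, Cconj_conj; auto. ring.
    - unfold basis_vec. specialize (H2 n). destruct Z.eq_dec, Z.eq_dec; subst; try tauto.
      rewrite RtoC_inv by lra. field. intros h; apply RtoC_inj in h; lra. ring. }
  assert (lU : forall f, in_l2 W1 f -> in_l2 W2 (U f)) by apply BU.
  assert (lV : forall f, in_l2 W2 f -> in_l2 W1 (V f)) by apply BV.
  assert (VU' : forall f, in_l2 W1 f -> V (U f) = f).
  { intros f Hf. rewrite UU; auto. }
  assert (UV' : forall g, in_l2 W2 g -> U (V g) = g).
  { intros g Hg. rewrite UU; auto. }
  assert (iso : forall f, in_l2 W1 f -> sqnorm W2 (U f) = sqnorm W1 f).
  { intros f Hf. apply Rle_antisym.
    - rewrite UU by auto. apply kernel_contraction; auto.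
    - rewrite <- (VU' f Hf) at 1. apply kernel_contraction; auto. }
  assert (I := isometry_inner W1 W2 U H1 H2 BU iso).
  split; [|split; [|split]]; auto.
  - split; [|split]; auto. intros g Hg. exists (V g). split; auto.
    intros x. rewrite UV'; auto.
  - split; auto. intros f g Hf Hg. rewrite <- (UV' g Hg) at 1. auto.
Qed.

End Hilbert.

(** * The reciprocal Gamma function *)

Definition C_limit (a : nat -> C) (s : C) : Prop :=
  forall e, 0 < e -> exists N, forall n, (N <= n)%nat -> Cmod (Cminus (a n) s) < e.

Section GammaFunction.
Open Scope C_scope.

Lemma RtoC_neq x y : x <> y -> RtoC x <> RtoC y.
Proof. intros H h. apply H, RtoC_inj; auto. Qed.

Lemma Clim_seq_eq a s : C_limit a s -> Clim_seq a = s.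
Proof.
  intros H. unfold Clim_seq.
  assert (L1 : is_lim_seq (fun n => fst (a n)) (fst s)).
  { apply is_lim_seq_spec. intros [e He]. destruct (H e He) as [N HN]. exists N.
    intros n Hn. specialize (HN n Hn). simpl. eapply Rle_lt_trans; [|apply HN].
    apply Rle_trans with (2 := Rmax_Cmod (a n - s)). apply Rmax_l. }
  assert (L2 : is_lim_seq (fun n => snd (a n)) (snd s)).
  { apply is_lim_seq_spec. intros [e He]. destruct (H e He) as [N HN]. exists N.
    intros n Hn. specialize (HN n Hn). simpl. eapply Rle_lt_trans; [|apply HN].
    apply Rle_trans with (2 := Rmax_Cmod (a n - s)). apply Rmax_r. }
  rewrite (is_lim_seq_unique _ _ L1), (is_lim_seq_unique _ _ L2). destruct s; auto.
Qed.

Lemma Clim_unique a s t : C_limit a s -> C_limit a t -> s = t.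
Proof. intros H1 H2. rewrite <- (Clim_seq_eq a s H1). apply Clim_seq_eq; auto. Qed.

Lemma Clim_of_parts a : (exists l, is_lim_seq (fun n => fst (a n)) (Finite l)) ->
  (exists l, is_lim_seq (fun n => snd (a n)) (Finite l)) -> exists s, C_limit a s.
Proof.
  intros [l H1] [l' H2]. exists (l, l'). intros e He.
  apply is_lim_seq_spec in H1. apply is_lim_seq_spec in H2.
  assert (He2 : (0 < e / 2)%R) by lra.
  destruct (H1 (mkposreal _ He2)) as [N1 K1]. destruct (H2 (mkposreal _ He2)) as [N2 K2].
  simpl in K1, K2.
  exists (N1 + N2)%nat. intros n Hn. specialize (K1 n ltac:(lia)). specialize (K2 n ltac:(lia)).
  replace (a n - (l, l')) with (RtoC (fst (a n) - l) + Ci * RtoC (snd (a n) - l')).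
  eapply Rle_lt_trans; [apply Cmod_triangle|]. rewrite Cmod_mult, Cmod_Ci, !Cmod_R. lra.
  destruct (a n). unfold Ci, RtoC, Cplus, Cmult, Cminus, Copp, Cplus; simpl; f_equal; ring.
Qed.

Lemma Clim_cauchy a : (forall e, (0 < e)%R -> exists N, forall n m, (N <= n)%nat -> (N <= m)%nat ->
  (Cmod (a n - a m) < e)%R) -> exists s, C_limit a s.
Proof.
  intros H.
  assert (G : forall p : C -> R, (forall u v, p u - p v <= Cmod (u - v))%R ->
     exists l, is_lim_seq (fun n => p (a n)) (Finite l)).
  { intros p Hp. apply ex_lim_seq_cauchy_corr. intros [e He].
    destruct (H e He) as [N HN]. exists N. intros n m Hn Hm. simpl.
    assert (T1 := HN n m Hn Hm). assert (T2 := HN m n Hm Hn).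
    assert (S1 := Hp (a n) (a m)). assert (S2 := Hp (a m) (a n)). apply Rabs_def1; lra. }
  apply Clim_of_parts; apply G; intros u v.
  - eapply Rle_trans; [|apply Rmax_Cmod]. eapply Rle_trans; [|apply Rmax_l].
    eapply Rle_trans; [|apply Rle_abs]. simpl; lra.
  - eapply Rle_trans; [|apply Rmax_Cmod]. eapply Rle_trans; [|apply Rmax_r].
    eapply Rle_trans; [|apply Rle_abs]. simpl; lra.
Qed.

Lemma Clim_mult_lim_1 a s (c : nat -> C) : C_limit a s -> C_limit c 1 -> C_limit (fun n => a n * c n) s.
Proof.
  intros H1 H2 e He. assert (p := Cmod_ge_0 s).
  destruct (H1 (Rmin 1 (e / 4))) as [N1 K1]. apply Rmin_pos; lra.
  destruct (H2 (Rmin 1 (e / (4 * (Cmod s + 1))))) as [N2 K2].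
  { apply Rmin_pos; [lra | apply Rdiv_lt_0_compat; lra]. }
  exists (N1 + N2)%nat. intros n Hn. specialize (K1 n ltac:(lia)). specialize (K2 n ltac:(lia)).
  replace (a n * c n - s) with ((a n - s) + (a n - s) * (c n - 1) + s * (c n - 1)) by ring.
  eapply Rle_lt_trans; [apply Cmod_triangle|].
  eapply Rle_lt_trans; [apply Rplus_le_compat_r, Cmod_triangle|]. rewrite !Cmod_mult.
  set (u := Cmod (a n - s)) in *. set (v := Cmod (c n - 1)) in *.
  assert (0 <= u)%R by apply Cmod_ge_0. assert (0 <= v)%R by apply Cmod_ge_0.
  assert (M1 := Rmin_l 1 (e/4)). assert (M2 := Rmin_r 1 (e/4)).
  assert (M3 := Rmin_l 1 (e / (4 * (Cmod s + 1)))). assert (M4 := Rmin_r 1 (e / (4 * (Cmod s + 1)))).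
  assert (Cmod s * v <= e / 4)%R.
  { apply Rle_trans with ((Cmod s + 1) * (e / (4 * (Cmod s + 1))))%R.
    apply Rmult_le_compat; lra. right; field; lra. }
  assert (u * v <= u * 1)%R by (apply Rmult_le_compat_l; lra).
  lra.
Qed.

(* The bound K/n^2 <= K/(n-1) - K/n makes [|a n| exp(K/(n-1))] nonincreasing. *)
Lemma quadratic_product_limit (a : nat -> C) K n0 : (0 <= K)%R ->
  (forall n, (n0 <= n)%nat -> (Cmod (a (S n) - a n) <= K / INR n ^ 2 * Cmod (a n))%R) ->
  exists s, C_limit a s /\ ((forall n, a n <> 0) -> s <> 0).
Proof.
  intros HK H.
  set (g := fun n => (K / (INR n - 1))%R).
  assert (gdec : forall n, (2 <= n)%nat -> (K / INR n ^ 2 <= g n - g (S n))%R).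
  { intros n Hn. unfold g. rewrite S_INR. apply le_INR in Hn. simpl in Hn.
    replace (K / (INR n - 1) - K / (INR n + 1 - 1))%R with (K * (/ (INR n * (INR n - 1))))%R by (field; lra).
    unfold Rdiv. apply Rmult_le_compat_l; auto. apply Rinv_le_contravar; nra. }
  assert (gpos : forall n, (2 <= n)%nat -> (0 <= g n)%R).
  { intros n Hn. unfold g. apply le_INR in Hn. simpl in Hn.
    apply Rmult_le_pos; auto. left. apply Rinv_0_lt_compat; lra. }
  assert (gsmall : forall e, (0 < e)%R -> exists N, forall n, (N <= n)%nat -> (g n < e)%R).
  { intros e He. destruct (nfloor_ex (K / e + 1)) as [N [_ HN]].
    { assert (0 <= K / e)%R; [|lra]. apply Rmult_le_pos; auto. left; apply Rinv_0_lt_compat; lra. }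
    exists (N + 2)%nat. intros n Hn. unfold g. apply le_INR in Hn. rewrite plus_INR in Hn. simpl in Hn.
    assert (K / e < INR n - 1)%R by lra.
    assert (0 <= INR N)%R by apply pos_INR.
    apply Rmult_lt_reg_r with (INR n - 1)%R; [lra|].
    replace (K / (INR n - 1) * (INR n - 1))%R with K by (field; lra).
    apply Rmult_lt_reg_r with (/ e)%R; [apply Rinv_0_lt_compat; auto|].
    replace (e * (INR n - 1) * / e)%R with (INR n - 1)%R by (field; lra). exact H0. }
  (* A discrete Gronwall estimate: growth and displacement after n0' are controlled together by the
     telescoping quantity g. *)
  assert (step : forall n0', (n0 <= n0')%nat -> (2 <= n0')%nat -> forall k,
     (Cmod (a (n0' + k)%nat) <= Cmod (a n0') * exp (g n0' - g (n0' + k)%nat))%R /\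
     (Cmod (a (n0' + k)%nat - a n0') <= Cmod (a n0') * exp (g n0') * (g n0' - g (n0' + k)%nat))%R).
  { intros n1 h1 h2. induction k as [|k [IH1 IH2]].
    - rewrite Nat.add_0_r. replace (g n1 - g n1)%R with 0%R by ring. rewrite exp_0.
      replace (a n1 - a n1) with (RtoC 0) by ring. rewrite Cmod_0. lra.
    - rewrite Nat.add_succ_r. specialize (H (n1 + k)%nat ltac:(lia)).
      assert (G := gdec (n1 + k)%nat ltac:(lia)).
      set (n := (n1 + k)%nat) in *.
      assert (P := Cmod_ge_0 (a n)). assert (Q := Cmod_ge_0 (a n1)).
      assert (Kn : (0 <= K / INR n ^ 2)%R).
      { apply Rmult_le_pos; auto. left. apply Rinv_0_lt_compat, pow_lt, lt_0_INR. unfold n; lia. }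
      split.
      + replace (a (S n)) with ((a (S n) - a n) + a n) by ring.
        eapply Rle_trans; [apply Cmod_triangle|].
        apply Rle_trans with (Cmod (a n) * (1 + (g n - g (S n))))%R. nra.
        replace (g n1 - g (S n))%R with ((g n1 - g n) + (g n - g (S n)))%R by ring.
        rewrite exp_plus, <- Rmult_assoc.
        apply Rmult_le_compat; auto. lra. apply exp_ineq1_le.
      + replace (a (S n) - a n1) with ((a (S n) - a n) + (a n - a n1)) by ring.
        eapply Rle_trans; [apply Cmod_triangle|].
        replace (g n1 - g (S n))%R with ((g n - g (S n)) + (g n1 - g n))%R by ring.
        rewrite Rmult_plus_distr_l. apply Rplus_le_compat; auto.
        eapply Rle_trans; [apply H|]. rewrite Rmult_comm. apply Rmult_le_compat; auto.
        eapply Rle_trans; [apply IH1|]. apply Rmult_le_compat_l; auto.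
        assert (0 <= g n)%R by (apply gpos; unfold n; lia).
        destruct (Req_dec (g n) 0) as [->|hn]. right; f_equal; ring.
        left. apply exp_increasing. lra. }
  assert (near : forall n0', (n0 <= n0')%nat -> (2 <= n0')%nat -> forall m, (n0' <= m)%nat ->
     (Cmod (a m - a n0') <= Cmod (a n0') * exp (g n0') * g n0')%R).
  { intros n1 h1 h2 m Hm. replace m with (n1 + (m - n1))%nat by lia.
    eapply Rle_trans; [apply (step n1 h1 h2)|]. apply Rmult_le_compat_l.
    apply Rmult_le_pos. apply Cmod_ge_0. left; apply exp_pos.
    assert (0 <= g (n1 + (m - n1))%nat)%R by (apply gpos; lia). lra. }
  set (n1 := (n0 + 2)%nat).
  set (M := (Cmod (a n1) * exp (g n1))%R).
  assert (bnd : forall m, (n1 <= m)%nat -> (Cmod (a m) <= M)%R).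
  { intros m Hm. replace m with (n1 + (m - n1))%nat by lia.
    eapply Rle_trans; [apply (step n1)|]; [unfold n1; lia.. |]. unfold M.
    apply Rmult_le_compat_l. apply Cmod_ge_0.
    assert (0 <= g (n1 + (m - n1))%nat)%R by (apply gpos; unfold n1; lia).
    destruct (Req_dec (g (n1 + (m - n1))%nat) 0) as [->|hn]. right; f_equal; ring.
    left. apply exp_increasing. lra. }
  assert (M0 : (0 <= M)%R). { apply Rmult_le_pos. apply Cmod_ge_0. left; apply exp_pos. }
  assert (Hs : exists s, C_limit a s).
  { apply Clim_cauchy. intros e He.
    destruct (gsmall (Rmin 1 (e / (2 * (M * exp 1 + 1))))) as [N HN].
    { apply Rmin_pos. lra. apply Rdiv_lt_0_compat; auto.
      assert (0 <= M * exp 1)%R. apply Rmult_le_pos; auto. left; apply exp_pos. lra. }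
    set (p := (N + n1)%nat).
    assert (Q : forall m, (p <= m)%nat -> (Cmod (a m - a p) < e / 2)%R).
    { intros m Hm. eapply Rle_lt_trans; [apply near; auto; unfold p, n1; lia|].
      specialize (HN p ltac:(unfold p; lia)).
      assert (0 <= g p)%R by (apply gpos; unfold p, n1; lia).
      assert (g p < 1)%R by (eapply Rlt_le_trans; [apply HN | apply Rmin_l]).
      assert (g2 : (g p < e / (2 * (M * exp 1 + 1)))%R) by (eapply Rlt_le_trans; [apply HN | apply Rmin_r]).
      assert (E1 := exp_pos 1).
      apply Rle_lt_trans with ((M * exp 1) * g p)%R.
      - apply Rmult_le_compat_r; auto. apply Rmult_le_compat; auto using Cmod_ge_0.
        left; apply exp_pos. apply bnd; unfold p; lia. left; apply exp_increasing; auto.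
      - apply Rle_lt_trans with ((M * exp 1 + 1) * g p)%R; [nra|].
        replace (e / 2)%R with ((M * exp 1 + 1) * (e / (2 * (M * exp 1 + 1))))%R.
        apply Rmult_lt_compat_l; nra. field. nra. }
    exists p. intros n m Hn Hm.
    replace (a n - a m) with ((a n - a p) + - (a m - a p)) by ring.
    eapply Rle_lt_trans; [apply Cmod_triangle|]. rewrite Cmod_opp.
    assert (A := Q n Hn). assert (B := Q m Hm). lra. }
  destruct Hs as [s Hs]. exists s. split; auto.
  intros Hnz ->.
  (* Nonvanishing of the limit: choose p with exp(g p) g p <= 1/2, so that all later terms stay
     within |a p|/2 of a p, whereas a zero limit would bring them strictly below |a p|/2 in
     modulus. *)
  destruct (gsmall (Rmin 1 (/ (2 * exp 1)))) as [N HN].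
  { apply Rmin_pos. lra. apply Rinv_0_lt_compat. assert (E := exp_pos 1). lra. }
  set (p := (N + n1)%nat).
  specialize (HN p ltac:(unfold p; lia)).
  assert (hp : (0 < Cmod (a p))%R) by (apply Cmod_gt_0; auto).
  destruct (Hs (Cmod (a p) / 2)%R) as [N' HN']; [lra|].
  specialize (HN' (N' + p)%nat ltac:(lia)).
  assert (Q := near p ltac:(unfold p, n1; lia) ltac:(unfold p, n1; lia) (N' + p)%nat ltac:(lia)).
  assert (gp0 : (0 <= g p)%R) by (apply gpos; unfold p, n1; lia).
  assert (gp1 : (g p < 1)%R) by (eapply Rlt_le_trans; [apply HN | apply Rmin_l]).
  assert (g2 : (g p < / (2 * exp 1))%R) by (eapply Rlt_le_trans; [apply HN | apply Rmin_r]).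
  assert (E1 := exp_pos 1).
  assert (exp (g p) * g p <= / 2)%R.
  { apply Rle_trans with (exp 1 * / (2 * exp 1))%R. apply Rmult_le_compat; auto.
    left; apply exp_pos. left; apply exp_increasing; auto. left; auto. right; field; lra. }
  rewrite Rmult_assoc in Q.
  assert (Cmod (a p) * (exp (g p) * g p) <= Cmod (a p) * / 2)%R by (apply Rmult_le_compat_l; lra).
  replace (a (N' + p)%nat - 0) with (a (N' + p)%nat) in HN' by ring.
  assert (T := Cmod_triangle (a (N' + p)%nat) (- (a (N' + p)%nat - a p))).
  replace (a (N' + p)%nat + - (a (N' + p)%nat - a p)) with (a p) in T by ring.
  rewrite Cmod_opp in T. lra.
Qed.

(** * The complex exponential and its second-order remainder *)

Lemma Cexp_plus z w : Cexp (z + w) = Cexp z * Cexp w.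
Proof.
  unfold Cexp, Cplus, Cmult; simpl. rewrite exp_plus, cos_plus, sin_plus. f_equal; ring.
Qed.

Lemma Cexp_0 : Cexp 0 = 1.
Proof. unfold Cexp; simpl. rewrite exp_0, cos_0, sin_0. unfold RtoC; f_equal; ring. Qed.

Lemma Cexp_neq_0 z : Cexp z <> 0.
Proof.
  intros H. assert (T := Cexp_plus z (- z)). replace (z + - z) with (RtoC 0) in T by ring.
  rewrite H, Cexp_0 in T. ring_simplify in T. apply RtoC_inj in T. lra.
Qed.

Lemma Cexp_conj z : Cexp (Cconj z) = Cconj (Cexp z).
Proof. unfold Cexp, Cconj; simpl. rewrite cos_neg, sin_neg. f_equal; ring. Qed.

Lemma abs_sin_le b : (Rabs (sin b) <= Rabs b)%R.
Proof.
  destruct (MVT_gen sin 0 b cos) as [c [_ Hc]].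
  - intros x _. auto_derive; auto; ring.
  - intros x _. apply continuity_sin.
  - rewrite sin_0, !Rminus_0_r in Hc. rewrite Hc, Rabs_mult.
    assert (Rabs (cos c) <= 1)%R by (apply Rabs_le, COS_bound). assert (0 <= Rabs b)%R by apply Rabs_pos. nra.
Qed.

Lemma one_minus_cos_le b : (0 <= 1 - cos b <= b ^ 2 / 2)%R.
Proof.
  replace b with (2 * (b / 2))%R at 1 2 by field. rewrite cos_2a_sin.
  assert (T := abs_sin_le (b / 2)). assert (P := Rabs_pos (sin (b / 2))).
  assert (Q : (sin (b / 2) ^ 2 <= (b / 2) ^ 2)%R).
  { rewrite <- (pow2_abs (sin _)), <- (pow2_abs (b / 2)). apply pow_incr; auto. }
  assert (0 <= sin (b / 2) ^ 2)%R by apply pow2_ge_0. nra.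
Qed.

Lemma sin_minus_id_le b : (Rabs b <= 1)%R -> (Rabs (sin b - b) <= b ^ 2)%R.
Proof.
  intros Hb.
  destruct (MVT_gen (fun x => sin x - x)%R 0 b (fun x => cos x - 1)%R) as [c [Hc1 Hc]].
  - intros x _. auto_derive; auto; ring.
  - intros x _. apply continuity_pt_minus. apply continuity_sin. apply derivable_continuous, derivable_id.
  - rewrite sin_0, !Rminus_0_r in Hc. rewrite Hc, Rabs_mult.
    assert (T := one_minus_cos_le c). rewrite Rabs_minus_sym, Rabs_pos_eq by lra.
    assert (D : (c ^ 2 <= b ^ 2)%R).
    { unfold Rmin, Rmax in Hc1. destruct Rle_dec; nra. }
    assert (P := Rabs_pos b). rewrite <- (pow2_abs b) in D |- *.
    apply Rle_trans with (Rabs b ^ 2 / 2 * Rabs b)%R. nra. nra.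
Qed.

Lemma exp_minus_1_id_le a : (Rabs a <= 1 / 2)%R -> (0 <= exp a - 1 - a <= 2 * a ^ 2)%R.
Proof.
  intros Ha. apply Rabs_le_between in Ha.
  assert (T := exp_ineq1_le a). assert (S := exp_ineq1_le (- a)). rewrite exp_Ropp in S.
  assert (P := exp_pos a). split; [lra|].
  assert (exp a <= / (1 - a))%R.
  { rewrite <- (Rinv_inv (exp a)). apply Rinv_le_contravar; lra. }
  assert (/ (1 - a) <= 1 + a + 2 * a ^ 2)%R; [|lra].
  apply Rmult_le_reg_l with (1 - a)%R; [lra|]. rewrite Rinv_r by lra. nra.
Qed.

(** The real and imaginary parts of the remainder are at most 3 |v|^2 and 4 |v|^2. Gauss's product
    calls only for the quadratic order, so the constant 10 is left crude. *)
Lemma Cexp_taylor v : (Cmod v <= 1 / 2)%R -> (Cmod (Cexp v - 1 - v) <= 10 * Cmod v ^ 2)%R.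
Proof.
  destruct v as [a b]. intros Hv.
  assert (Ha : (Rabs a <= Cmod (a, b))%R).
  { eapply Rle_trans; [|apply (Rmax_Cmod (a, b))]. apply Rmax_l. }
  assert (Hb : (Rabs b <= Cmod (a, b))%R).
  { eapply Rle_trans; [|apply (Rmax_Cmod (a, b))]. apply Rmax_r. }
  set (r := Cmod (a, b)) in *.
  assert (E : Cexp (a, b) - 1 - (a, b) =
    RtoC ((exp a - 1 - a) - exp a * (1 - cos b)) + Ci * RtoC (exp a * (sin b - b) + (exp a - 1) * b)).
  { unfold Cexp, Ci, RtoC, Cplus, Cmult, Cminus, Copp, Cplus; simpl; f_equal; ring. }
  rewrite E. eapply Rle_trans; [apply Cmod_triangle|]. rewrite Cmod_mult, Cmod_Ci, !Cmod_R.
  assert (A1 := exp_minus_1_id_le a ltac:(lra)). assert (B1 := one_minus_cos_le b).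
  assert (B2 := sin_minus_id_le b ltac:(lra)).
  assert (r0 : (0 <= r)%R) by apply Cmod_ge_0.
  assert (Sa : (a ^ 2 <= r ^ 2)%R) by (rewrite <- (pow2_abs a); apply pow_incr; split; auto using Rabs_pos).
  assert (Sb : (b ^ 2 <= r ^ 2)%R) by (rewrite <- (pow2_abs b); apply pow_incr; split; auto using Rabs_pos).
  assert (Pa := exp_pos a).
  assert (Ua : (exp a <= 2)%R). { apply Rabs_le_between in Ha. nra. }
  assert (Va : (Rabs (exp a - 1) <= 2 * r)%R).
  { apply Rabs_le. apply Rabs_le_between in Ha. nra. }
  assert (F1 : (Rabs (exp a - 1 - a - exp a * (1 - cos b)) <= 3 * r ^ 2)%R).
  { apply Rabs_le. nra. }
  assert (F2 : (Rabs (exp a * (sin b - b) + (exp a - 1) * b) <= 4 * r ^ 2)%R).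
  { eapply Rle_trans; [apply Rabs_triang|]. rewrite !Rabs_mult, (Rabs_pos_eq (exp a)) by lra.
    assert (exp a * Rabs (sin b - b) <= 2 * r ^ 2)%R.
    { apply Rmult_le_compat; try lra. apply Rabs_pos. }
    assert (Rabs (exp a - 1) * Rabs b <= 2 * r * r)%R.
    { apply Rmult_le_compat; auto using Rabs_pos. }
    nra. }
  nra.
Qed.

(** * Gauss's product: convergence, zeros and functional equation of 1/Gamma *)

Definition gauss_product (z : C) (N : nat) : C :=
  pochhammer z (S N) / (RtoC (INR (fact N)) * Cexp (z * RtoC (ln (INR N)))).

Lemma fact_C_neq_0 n : RtoC (INR (fact n)) <> 0.
Proof. apply RtoC_neq, INR_fact_neq_0. Qed.

(** The quotient of successive terms is (1 + z/(N+1)) exp(-z ln(1 + 1/N)) = 1 + O(1/N^2), the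
    situation of [quadratic_product_limit]. *)
Lemma gauss_product_step z N : (1 <= N)%nat ->
  gauss_product z (S N) = gauss_product z N *
    ((1 + z * RtoC (/ (INR N + 1))) * Cexp (- z * RtoC (ln (INR N + 1) - ln (INR N)))).
Proof.
  intros HN. unfold gauss_product.
  change (pochhammer z (S (S N))) with (pochhammer z (S N) * (z + RtoC (INR (S N)))).
  rewrite fact_simpl, mult_INR, S_INR, RtoC_mult.
  replace (z * RtoC (ln (INR N + 1))) with
    (z * RtoC (ln (INR N)) + (z * RtoC (ln (INR N + 1) - ln (INR N))))
    by (rewrite RtoC_minus; ring).
  rewrite Cexp_plus.
  set (w := z * RtoC (ln (INR N + 1) - ln (INR N))).
  replace (- z * RtoC (ln (INR N + 1) - ln (INR N))) with (- w) by (unfold w; ring).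
  assert (I : Cexp (- w) = / Cexp w).
  { assert (T := Cexp_plus w (- w)). replace (w + - w) with (RtoC 0) in T by ring. rewrite Cexp_0 in T.
    assert (h := Cexp_neq_0 w). replace (Cexp (- w)) with (/ Cexp w * (Cexp w * Cexp (- w))) by (field; auto).
    rewrite <- T. field; auto. }
  rewrite I. assert (P := pos_INR N).
  assert (n1 : RtoC (INR N + 1) <> 0) by (apply RtoC_neq; lra).
  rewrite RtoC_inv by lra.
  field. repeat split; auto using Cexp_neq_0, fact_C_neq_0.
Qed.

Lemma ln_ratio_bounds N : (1 <= N)%nat ->
  (/ (INR N + 1) <= ln (INR N + 1) - ln (INR N) <= / INR N)%R.
Proof.
  intros HN. apply le_INR in HN. simpl in HN. split.
  - assert (T := exp_ineq1_le (ln (INR N) - ln (INR N + 1))).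
    unfold Rminus in T. rewrite exp_plus, exp_Ropp, !exp_ln in T by lra.
    replace (/ (INR N + 1))%R with (1 - INR N * / (INR N + 1))%R by (field; lra). lra.
  - assert (T := exp_ineq1_le (ln (INR N + 1) - ln (INR N))).
    unfold Rminus in T. rewrite exp_plus, exp_Ropp, !exp_ln in T by lra.
    replace (/ INR N)%R with ((INR N + 1) * / INR N - 1)%R by (field; lra). lra.
Qed.

Lemma gauss_product_limit z : exists s, C_limit (gauss_product z) s /\
  ((forall j, z + RtoC (INR j) <> 0) -> s <> 0).
Proof.
  set (r := Cmod z). assert (r0 : (0 <= r)%R) by apply Cmod_ge_0.
  destruct (nfloor_ex (2 * r)) as [N0 [_ HN0]]; [lra|].
  (* The three summands of the constant bound the three terms of the increment: the difference
     between 1/(n+1) and ln(1 + 1/n), the product of the two first-order terms, and the exponential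
     remainder. Starting at N0 + 1 > 2 |z| keeps the exponent within 1/2. *)
  destruct (quadratic_product_limit (gauss_product z) (r + r ^ 2 + (1 + r) * (10 * r ^ 2))%R (N0 + 1)) as [s [H1 H2]].
  - nra.
  - intros n Hn. rewrite gauss_product_step by lia.
    set (w := (ln (INR n + 1) - ln (INR n))%R).
    assert (W := ln_ratio_bounds n ltac:(lia)). fold w in W.
    apply le_INR in Hn. rewrite plus_INR in Hn. simpl in Hn.
    assert (PN := pos_INR N0).
    set (t := (/ INR n)%R) in *. set (t1 := (/ (INR n + 1))%R) in *.
    assert (ht : (0 < t)%R) by (apply Rinv_0_lt_compat; lra).
    assert (ht1 : (0 < t1)%R) by (apply Rinv_0_lt_compat; lra).
    assert (ht2 : (t1 <= t)%R) by (apply Rinv_le_contravar; lra).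
    assert (htt : (t - t1 = t * t1)%R) by (unfold t, t1; field; lra).
    assert (hrt : (r * t <= 1 / 2)%R).
    { unfold t. apply Rmult_le_reg_r with (INR n); [lra|].
      rewrite Rmult_assoc, Rinv_l by lra. lra. }
    assert (ht3 : (t <= 1)%R). { unfold t. rewrite <- Rinv_1. apply Rinv_le_contravar; lra. }
    set (v := - z * RtoC w).
    assert (hv : (Cmod v = r * w)%R).
    { unfold v. rewrite Cmod_mult, Cmod_opp, Cmod_R, Rabs_pos_eq; auto. lra. }
    assert (hv2 : (Cmod v <= r * t)%R) by (rewrite hv; apply Rmult_le_compat_l; lra).
    assert (T := Cexp_taylor v ltac:(lra)).
    set (rho := Cexp v - 1 - v) in *.
    replace (gauss_product z n * ((1 + z * RtoC t1) * Cexp v) - gauss_product z n) with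
      (gauss_product z n * (z * RtoC (t1 - w) + z * RtoC t1 * v + (1 + z * RtoC t1) * rho))
      by (unfold rho, v; rewrite RtoC_minus; ring).
    rewrite Cmod_mult, Rmult_comm. apply Rmult_le_compat_r. apply Cmod_ge_0.
    eapply Rle_trans; [apply Cmod_triangle|].
    eapply Rle_trans; [apply Rplus_le_compat_r, Cmod_triangle|].
    rewrite !Cmod_mult, !Cmod_R. fold r.
    assert (A1 : (Rabs (t1 - w) <= t ^ 2)%R). { apply Rabs_le. nra. }
    assert (A2 : (Cmod (1 + z * RtoC t1) <= 1 + r)%R).
    { eapply Rle_trans; [apply Cmod_triangle|]. rewrite Cmod_1, Cmod_mult, Cmod_R, Rabs_pos_eq by lra.
      fold r. nra. }
    assert (A3 : (Cmod rho <= 10 * r ^ 2 * t ^ 2)%R).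
    { eapply Rle_trans; [apply T|].
      replace (10 * r ^ 2 * t ^ 2)%R with (10 * (r * t) ^ 2)%R by ring.
      apply Rmult_le_compat_l; [lra|]. apply pow_incr. split; auto. apply Cmod_ge_0. }
    rewrite (Rabs_pos_eq t1) by lra.
    replace ((r + r ^ 2 + (1 + r) * (10 * r ^ 2)) / INR n ^ 2)%R with
      (r * t ^ 2 + r * t * (r * t) + (1 + r) * (10 * r ^ 2 * t ^ 2))%R by (unfold t; field; lra).
    apply Rplus_le_compat; [apply Rplus_le_compat|].
    + apply Rmult_le_compat_l; auto.
    + apply Rmult_le_compat; auto. nra. apply Cmod_ge_0. apply Rmult_le_compat_l; auto.
    + apply Rmult_le_compat; auto; apply Cmod_ge_0.
  - exists s. split; auto. intros Hz. apply H2. intros n. unfold gauss_product.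
    assert (P : forall k, pochhammer z k <> 0).
    { induction k; simpl. apply RtoC_neq; lra. apply Cmult_neq_0; auto. }
    intros E. apply (P (S n)).
    replace (pochhammer z (S n)) with (gauss_product z n * (RtoC (INR (fact n)) * Cexp (z * RtoC (ln (INR n))))).
    unfold gauss_product. rewrite E. ring.
    unfold gauss_product. field. auto using Cexp_neq_0, fact_C_neq_0.
Qed.

Lemma rGamma_lim z : C_limit (gauss_product z) (rGamma z).
Proof.
  destruct (gauss_product_limit z) as [s [H _]].
  unfold rGamma. change (C_limit (gauss_product z) (Clim_seq (gauss_product z))).
  rewrite (Clim_seq_eq _ _ H). auto.
Qed.

Lemma rGamma_neq_0 z : (forall j, z + RtoC (INR j) <> 0) -> rGamma z <> 0.
Proof.
  intros Hz. destruct (gauss_product_limit z) as [s [H1 H2]].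
  rewrite (Clim_unique _ _ _ (rGamma_lim z) H1). auto.
Qed.

Lemma pochhammer_S_l a k : pochhammer a (S k) = a * pochhammer (a + 1) k.
Proof.
  induction k.
  - simpl. ring.
  - change (pochhammer a (S (S k))) with (pochhammer a (S k) * (a + RtoC (INR (S k)))).
    rewrite IHk. simpl pochhammer. rewrite S_INR, RtoC_plus. ring.
Qed.

Lemma Clim_inv_nat (K : C) : C_limit (fun n => 1 + K * RtoC (/ INR n)) 1.
Proof.
  intros e He. assert (P := Cmod_ge_0 K).
  destruct (nfloor_ex (Cmod K / e)) as [N [_ HN]].
  { apply Rmult_le_pos; auto. left; apply Rinv_0_lt_compat; auto. }
  exists (N + 1)%nat. intros n Hn. apply le_INR in Hn. rewrite plus_INR in Hn. simpl in Hn.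
  assert (PN := pos_INR N).
  replace (1 + K * RtoC (/ INR n) - 1) with (K * RtoC (/ INR n)) by ring.
  rewrite Cmod_mult, Cmod_R, Rabs_pos_eq.
  2: { left; apply Rinv_0_lt_compat; lra. }
  apply Rmult_lt_reg_r with (INR n); [lra|]. rewrite Rmult_assoc, Rinv_l, Rmult_1_r by lra.
  apply Rle_lt_trans with (e * (Cmod K / e))%R. right; field; lra. apply Rmult_lt_compat_l; lra.
Qed.

Lemma Clim_scal (k : C) a s : C_limit a s -> C_limit (fun n => k * a n) (k * s).
Proof.
  intros H e He. assert (P := Cmod_ge_0 k).
  destruct (H (e / (Cmod k + 1))%R) as [N HN]. apply Rdiv_lt_0_compat; lra.
  exists N. intros n Hn. specialize (HN n Hn).
  replace (k * a n - k * s) with (k * (a n - s)) by ring. rewrite Cmod_mult.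
  assert (Q := Cmod_ge_0 (a n - s)).
  apply Rle_lt_trans with ((Cmod k + 1) * Cmod (a n - s))%R; [nra|].
  replace e with ((Cmod k + 1) * (e / (Cmod k + 1)))%R by (field; lra).
  apply Rmult_lt_compat_l; lra.
Qed.

Lemma Clim_eventually a b s n0 : (forall n, (n0 <= n)%nat -> a n = b n) -> C_limit a s -> C_limit b s.
Proof.
  intros E H e He. destruct (H e He) as [N HN]. exists (N + n0)%nat. intros n Hn.
  rewrite <- E by lia. apply HN; lia.
Qed.

(** The Gauss products satisfy this equation up to the factor 1 + (z + 1)/n, which tends to 1. *)
Lemma rGamma_step z : rGamma z = z * rGamma (z + 1).
Proof.
  apply (Clim_unique (fun n => gauss_product z n * (1 + (z + 1) * RtoC (/ INR n)))).
  - apply Clim_mult_lim_1. apply rGamma_lim. apply Clim_inv_nat.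
  - apply Clim_eventually with (n0 := 1%nat) (2 := Clim_scal z _ _ (rGamma_lim (z + 1))).
    intros n Hn. unfold gauss_product.
    change (pochhammer (z + 1) (S n)) with (pochhammer (z + 1) n * (z + 1 + RtoC (INR n))).
    rewrite (pochhammer_S_l z n).
    replace ((z + 1) * RtoC (ln (INR n))) with (z * RtoC (ln (INR n)) + RtoC (ln (INR n))) by ring.
    rewrite Cexp_plus. apply le_INR in Hn. simpl in Hn.
    replace (Cexp (RtoC (ln (INR n)))) with (RtoC (INR n)).
    2: { unfold Cexp, RtoC; simpl. rewrite exp_ln, cos_0, sin_0 by lra. f_equal; ring. }
    rewrite RtoC_inv by lra. field.
    repeat split; auto using Cexp_neq_0, fact_C_neq_0. apply RtoC_neq; lra.
Qed.

Lemma pochhammer_conj a k : pochhammer (Cconj a) k = Cconj (pochhammer a k).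
Proof.
  induction k; simpl. unfold Cconj, RtoC; simpl; f_equal; ring.
  rewrite IHk, Cmult_conj, Cplus_conj. f_equal. f_equal. unfold Cconj, RtoC; simpl; f_equal; ring.
Qed.

Lemma Cconj_RtoC x : Cconj (RtoC x) = RtoC x.
Proof. unfold Cconj, RtoC; simpl; f_equal; ring. Qed.

Lemma Clim_Cconj a s : C_limit a s -> C_limit (fun n => Cconj (a n)) (Cconj s).
Proof.
  intros H e He. destruct (H e He) as [N HN]. exists N. intros n Hn.
  rewrite <- Cminus_conj, Cmod_conj. auto.
Qed.

Lemma rGamma_conj z : rGamma (Cconj z) = Cconj (rGamma z).
Proof.
  apply (Clim_unique (gauss_product (Cconj z))). apply rGamma_lim.
  apply Clim_eventually with (n0 := O) (2 := Clim_Cconj _ _ (rGamma_lim z)).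
  intros n _. unfold gauss_product. rewrite Cdiv_conj, Cmult_conj.
  rewrite <- pochhammer_conj, <- Cexp_conj, Cmult_conj, !Cconj_RtoC. auto.
  apply Cmult_neq_0; auto using Cexp_neq_0, fact_C_neq_0.
Qed.

Lemma pochhammer_1 n : pochhammer 1 n = RtoC (INR (fact n)).
Proof.
  induction n. simpl. auto. simpl pochhammer. rewrite IHn, fact_simpl, mult_INR, S_INR, RtoC_mult, RtoC_plus.
  ring.
Qed.

Lemma rGamma_1 : rGamma 1 = 1.
Proof.
  apply (Clim_unique (gauss_product 1)). apply rGamma_lim.
  apply Clim_eventually with (n0 := 1%nat) (2 := Clim_inv_nat 1).
  intros n Hn. unfold gauss_product. rewrite pochhammer_1, fact_simpl, mult_INR, S_INR, RtoC_mult, RtoC_plus.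
  apply le_INR in Hn. simpl in Hn.
  replace (Cexp (1 * RtoC (ln (INR n)))) with (RtoC (INR n)).
  2: { rewrite Cmult_1_l. unfold Cexp, RtoC; simpl. rewrite exp_ln, cos_0, sin_0 by lra. f_equal; ring. }
  rewrite RtoC_inv by lra. field. split; first [apply fact_C_neq_0 | apply RtoC_neq; lra].
Qed.

Lemma rGamma_nat n : rGamma (RtoC (INR n) + 1) = / RtoC (INR (fact n)).
Proof.
  induction n.
  - simpl. rewrite Cplus_0_l, rGamma_1. field.
  - rewrite rGamma_step in IHn. rewrite S_INR, RtoC_plus.
    assert (h : RtoC (INR n) + 1 <> 0).
    { rewrite <- RtoC_plus. apply RtoC_neq. assert (T := pos_INR n). lra. }
    replace (rGamma (RtoC (INR n) + 1 + 1)) with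
      (/ (RtoC (INR n) + 1) * ((RtoC (INR n) + 1) * rGamma (RtoC (INR n) + 1 + 1))) by (field; auto).
    rewrite IHn, fact_simpl, mult_INR, S_INR, RtoC_mult, RtoC_plus. field. auto using fact_C_neq_0.
Qed.

(** These zeros cut off the initial terms of the regularized hypergeometric series when its lower
    parameter is a nonpositive integer. *)
Lemma rGamma_nonpos_nat n : rGamma (- RtoC (INR n)) = 0.
Proof.
  induction n.
  - rewrite rGamma_step. simpl. ring.
  - rewrite rGamma_step. replace (- RtoC (INR (S n)) + 1) with (- RtoC (INR n)).
    rewrite IHn; ring. rewrite S_INR, RtoC_plus. ring.
Qed.

Lemma rGamma_pochhammer z k : rGamma z = pochhammer z k * rGamma (z + RtoC (INR k)).
Proof.
  induction k. simpl. rewrite Cplus_0_r. ring.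
  rewrite IHk, (rGamma_step (z + _)). simpl pochhammer. rewrite S_INR, RtoC_plus.
  rewrite !Cplus_assoc. ring.
Qed.

End GammaFunction.

(** * Convolution on Z and binomial coefficients *)

(** Equivalent to a radius of convergence of at least 1; this form is stable under termwise
    products. *)
Definition subexp (g : nat -> C) : Prop :=
  forall r, 0 <= r < 1 -> exists M, forall k, Cmod (g k) * r ^ k <= M.

(** Coefficient of z^k in (1 - z)^(-s). The negative exponent avoids alternating signs and makes the
    coefficients nonnegative for s >= 0, which supplies majorants. *)
Definition binc (s : C) (k : nat) : C := Cdiv (pochhammer s k) (RtoC (INR (fact k))).

Definition conv (f g : Z -> C) (x : Z) : C := tsum (fun y => Cmult (f y) (g (x - y)%Z)).

(* Coefficient of w^k in (1 - q w)^(-s), extended by 0 to k < 0. *)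
Definition bincZ (q s : C) (k : Z) : C :=
  if Z_lt_dec k 0 then RtoC 0 else Cmult (binc s (Z.to_nat k)) (Cpow q (Z.to_nat k)).

(* Coefficient of w^d in (1 - q w)^(-s) (1 - q / w)^(-t). *)
Definition laurent (q s t : C) : Z -> C := conv (bincZ q s) (fun k => bincZ q t (- k)%Z).

Section Convolution.
Open Scope C_scope.

Lemma eventually_nonincr_bounded (u : nat -> R) k0 :
  (forall k, (k0 <= k)%nat -> (u (S k) <= u k)%R) -> exists M, forall k, (u k <= M)%R.
Proof.
  intros H.
  assert (P : forall n, exists M, forall k, (k <= n)%nat -> (u k <= M)%R).
  { induction n as [|n [M IH]].
    - exists (u O). intros k Hk. replace k with O by lia. lra.
    - exists (Rmax M (u (S n))). intros k Hk. destruct (Nat.eq_dec k (S n)) as [->|].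
      apply Rmax_r. eapply Rle_trans; [apply IH; lia | apply Rmax_l]. }
  destruct (P k0) as [M HM]. exists M. intros k.
  destruct (Nat.le_gt_cases k k0); [apply HM; auto|].
  replace k with (k0 + (k - k0))%nat by lia. induction (k - k0)%nat as [|n IH].
  - rewrite Nat.add_0_r. apply HM; auto.
  - rewrite Nat.add_succ_r. eapply Rle_trans; [apply H; lia | auto].
Qed.

(** Successive terms have ratio r (s + k)/(k + 1), whose modulus is at most 1 as soon as k exceeds
    |s|/(1 - r). *)
Lemma subexp_binc s : subexp (binc s).
Proof.
  intros r Hr. assert (P := Cmod_ge_0 s).
  destruct (nfloor_ex (Cmod s / (1 - r))) as [N [_ HN]].
  { apply Rmult_le_pos; auto. left; apply Rinv_0_lt_compat; lra. }
  apply eventually_nonincr_bounded with (S N). intros k Hk.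
  apply le_INR in Hk. rewrite S_INR in Hk.
  assert (Pk := pos_INR k).
  assert (E : binc s (S k) = binc s k * ((s + RtoC (INR k)) * RtoC (/ (INR k + 1)))).
  { unfold binc. simpl pochhammer. rewrite fact_simpl, mult_INR, S_INR, RtoC_mult, RtoC_inv by lra.
    field. split; first [apply fact_C_neq_0 | apply RtoC_neq; lra]. }
  rewrite E, !Cmod_mult, Cmod_R, Rabs_pos_eq by (left; apply Rinv_0_lt_compat; lra).
  assert (T : (Cmod (s + RtoC (INR k)) <= Cmod s + INR k)%R).
  { eapply Rle_trans; [apply Cmod_triangle|]. rewrite Cmod_R, Rabs_pos_eq; lra. }
  assert (T2 : (Cmod s < (1 - r) * (INR k))%R).
  { apply Rmult_lt_reg_r with (/ (1 - r))%R. apply Rinv_0_lt_compat; lra.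
    replace ((1 - r) * INR k * / (1 - r))%R with (INR k) by (field; lra).
    unfold Rdiv in HN. lra. }
  assert (T3 : (Cmod (s + RtoC (INR k)) * / (INR k + 1) * r <= 1)%R).
  { apply Rmult_le_reg_r with (INR k + 1)%R; [lra|].
    replace (Cmod (s + RtoC (INR k)) * / (INR k + 1) * r * (INR k + 1))%R
      with (Cmod (s + RtoC (INR k)) * r)%R by (field; lra).
    assert (0 <= Cmod (s + RtoC (INR k)))%R by apply Cmod_ge_0. nra. }
  simpl pow.
  replace (Cmod (binc s k) * (Cmod (s + RtoC (INR k)) * / (INR k + 1)) * (r * r ^ k))%R with
    ((Cmod (binc s k) * r ^ k) * (Cmod (s + RtoC (INR k)) * / (INR k + 1) * r))%R by ring.
  rewrite <- (Rmult_1_r (Cmod (binc s k) * r ^ k)) at 2.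
  apply Rmult_le_compat_l; auto. apply Rmult_le_pos. apply Cmod_ge_0. apply pow_le; lra.
Qed.

(** Give each factor a share sqrt r of the radius, which is still below 1. *)
Lemma subexp_mult g h : subexp g -> subexp h -> subexp (fun k => g k * h k).
Proof.
  intros Hg Hh r Hr.
  assert (S : (0 <= sqrt r < 1)%R).
  { split. apply sqrt_pos. rewrite <- sqrt_1. apply sqrt_lt_1; lra. }
  destruct (Hg _ S) as [M HM]. destruct (Hh _ S) as [N HN]. exists (M * N)%R. intros k.
  rewrite <- (sqrt_sqrt r) by lra. rewrite Rpow_mult_distr, Cmod_mult.
  replace (Cmod (g k) * Cmod (h k) * (sqrt r ^ k * sqrt r ^ k))%R with
    ((Cmod (g k) * sqrt r ^ k) * (Cmod (h k) * sqrt r ^ k))%R by ring.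
  apply Rmult_le_compat; auto; apply Rmult_le_pos; try apply Cmod_ge_0; apply pow_le; apply S.
Qed.

Lemma abs_summable_geom (M r : R) : (0 <= r < 1)%R ->
  abs_summable (fun k : nat => RtoC (M * r ^ k)).
Proof.
  intros Hr. apply abs_summable_ext with (fun k => RtoC M * RtoC (r ^ k)).
  intros; rewrite <- RtoC_mult; auto.
  apply abs_summable_scal. apply abs_summable_ex_series. intros; apply pow_le; lra.
  apply ex_series_geom. rewrite Rabs_pos_eq; lra.
Qed.

Lemma subexp_summable g z : subexp g -> (Cmod z < 1)%R -> abs_summable (fun k => g k * z ^ k).
Proof.
  intros Hg Hz. assert (P := Cmod_ge_0 z).
  set (r := ((1 + Cmod z) / 2)%R).
  destruct (Hg r) as [M HM]. unfold r; lra.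
  apply abs_summable_le with (fun k => RtoC (M * (Cmod z / r) ^ k)).
  2: { apply abs_summable_geom. split. apply Rmult_le_pos; auto. left; apply Rinv_0_lt_compat; unfold r; lra.
       apply Rmult_lt_reg_r with r. unfold r; lra. unfold Rdiv. rewrite Rmult_assoc, Rinv_l; unfold r; lra. }
  intros k. specialize (HM k). rewrite Cmod_mult, Cmod_pow, Cmod_R.
  assert (rk : (0 < r ^ k)%R) by (apply pow_lt; unfold r; lra).
  assert (zk : (0 <= Cmod z ^ k)%R) by (apply pow_le; auto).
  assert (gk := Cmod_ge_0 (g k)).
  unfold Rdiv. rewrite Rpow_mult_distr, pow_inv.
  rewrite Rabs_pos_eq.
  - replace (Cmod (g k) * Cmod z ^ k)%R with (Cmod (g k) * r ^ k * (Cmod z ^ k * / r ^ k))%R by (field; lra).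
    apply Rmult_le_compat_r; auto. apply Rmult_le_pos; auto. left; apply Rinv_0_lt_compat; auto.
  - assert (0 < / r ^ k)%R by (apply Rinv_0_lt_compat; auto).
    apply Rmult_le_pos; [|apply Rmult_le_pos; lra].
    apply Rle_trans with (2 := HM). apply Rmult_le_pos; lra.
Qed.

(** * The convolution algebra l^1(Z) *)

Lemma conv_family (f g : Z -> C) : abs_summable f -> abs_summable g ->
  abs_summable (fun p : Z * Z => f (fst p) * g (snd p - fst p)%Z).
Proof.
  intros Hf Hg.
  apply (abs_summable_inj (fun p : Z * Z => (fst p, (snd p - fst p)%Z))
           (fun p => f (fst p) * g (snd p))).
  - intros [a b] [a' b'] h. simpl in h. inversion h. f_equal; lia.
  - apply abs_summable_mul; auto.
Qed.

Lemma conv_family' (f g : Z -> C) x : abs_summable f -> abs_summable g ->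
  abs_summable (fun y => f y * g (x - y)%Z).
Proof.
  intros Hf Hg.
  apply (abs_summable_col (fun p : Z * Z => f (fst p) * g (snd p - fst p)%Z) x).
  apply conv_family; auto.
Qed.

Lemma conv_sum (f g : Z -> C) x : abs_summable f -> abs_summable g ->
  has_sum (fun y => f y * g (x - y)%Z) (conv f g x).
Proof. intros Hf Hg. apply abs_summable_has_sum, conv_family'; auto. Qed.

Lemma has_sum_reindex (f : Z -> C) (phi psi : Z -> Z) s :
  (forall x, phi (psi x) = x) -> (forall x, psi (phi x) = x) ->
  has_sum f s -> has_sum (fun x => f (phi x)) s.
Proof.
  intros H1 H2. apply has_sum_inj.
  - intros i i' h. rewrite <- (H2 i), <- (H2 i'), h. auto.
  - intros j h. destruct (h (psi j)); auto.
Qed.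

Lemma abs_summable_reindex (f : Z -> C) (phi psi : Z -> Z) :
  (forall x, psi (phi x) = x) -> abs_summable f -> abs_summable (fun x => f (phi x)).
Proof.
  intros H2. apply abs_summable_inj. intros i i' h. rewrite <- (H2 i), <- (H2 i'), h. auto.
Qed.

(** Besides closure of l^1(Z) under convolution, this gives multiplicativity of the total sum, which
    turns identities between coefficients into identities between values. *)
Lemma conv_has_sum (f g : Z -> C) : abs_summable f -> abs_summable g ->
  abs_summable (conv f g) /\ has_sum (conv f g) (tsum f * tsum g).
Proof.
  intros Hf Hg. assert (F := conv_family f g Hf Hg). split.
  - assert (Hn : abs_summable (fun p : Z * Z => RtoC (Cmod (f (fst p) * g (snd p - fst p)%Z)))).
    { eapply abs_summable_le; [|apply F]. intros; rewrite Cmod_R, Rabs_pos_eq. lra. apply Cmod_ge_0. }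
    assert (T := tnorm_sum _ F).
    set (N := tnorm _) in T.
    assert (T2 : has_sum (fun p : Z * Z => RtoC (Cmod (f (snd p) * g (fst p - snd p)%Z))) (RtoC N)).
    { apply (has_sum_inj (fun p : Z * Z => (snd p, fst p)) (fun p => RtoC (Cmod (f (fst p) * g (snd p - fst p)%Z)))); auto.
      intros [a b] [a' b'] h; simpl in h; inversion h; auto.
      intros [a b] h. destruct (h (b, a)); auto. }
    set (R := fun y => tnorm (fun z => f z * g (y - z)%Z)).
    assert (T3 : has_sum (fun y => RtoC (R y)) (RtoC N)).
    { apply (has_sum_fubini _ _ _ T2). intros y. simpl. apply tnorm_sum. apply conv_family'; auto. }
    apply abs_summable_le with (fun y => RtoC (R y)).
    + intros y. rewrite Cmod_R. eapply Rle_trans; [|apply Rle_abs].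
      apply tsum_le_tnorm. apply conv_family'; auto.
    + apply has_sum_abs_summable with N; auto. intros y. unfold R.
      eapply Rle_trans; [apply Cmod_ge_0|]. apply (tsum_le_tnorm _ (conv_family' f g y Hf Hg)).
  - apply (fubini_swap _ (fun z => f z * tsum g) _ _ F).
    + intros z. simpl. apply has_sum_scal.
      apply (has_sum_reindex g (fun y => (y - z)%Z) (fun y => (y + z)%Z)); try (intros; lia).
      apply abs_summable_has_sum; auto.
    + intros y. exact (conv_sum f g y Hf Hg).
    + rewrite Cmult_comm. eapply has_sum_ext; [|apply has_sum_scal, abs_summable_has_sum, Hf].
      intros; simpl; ring.
Qed.

Lemma conv_comm f g x : abs_summable f -> abs_summable g -> conv f g x = conv g f x.
Proof.
  intros Hf Hg. apply tsum_eq.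
  eapply has_sum_ext; [|apply (has_sum_reindex (fun y => g y * f (x - y)%Z) (fun y => (x - y)%Z) (fun y => (x - y)%Z))].
  - intros y. simpl. replace (x - (x - y))%Z with y by lia. ring.
  - intros; lia.
  - intros; lia.
  - apply conv_sum; auto.
Qed.

Lemma conv_assoc f g h x : abs_summable f -> abs_summable g -> abs_summable h ->
  conv (conv f g) h x = conv f (conv g h) x.
Proof.
  intros Hf Hg Hh.
  assert (F : abs_summable (fun p : Z * Z => f (fst p) * g (snd p - fst p)%Z * h (x - snd p)%Z)).
  { apply abs_summable_le with (2 := abs_summable_scal (RtoC (tnorm h)) _ (conv_family f g Hf Hg)).
    intros p. rewrite (Cmod_mult (_ * _)), (Cmod_mult (RtoC _)), Rmult_comm.
    apply Rmult_le_compat_r. apply Cmod_ge_0. rewrite Cmod_R.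
    eapply Rle_trans; [|apply Rle_abs]. apply Cmod_le_tnorm; auto. }
  apply tsum_eq.
  apply (fubini_swap _ (fun z => f z * conv g h (x - z)%Z) _ _ F).
  - intros z. simpl.
    eapply has_sum_ext; [|apply has_sum_scal, (has_sum_reindex (fun y => g y * h (x - z - y)%Z) (fun y => (y - z)%Z) (fun y => (y + z)%Z))].
    + intros y. simpl. replace (x - z - (y - z))%Z with (x - y)%Z by lia. ring.
    + intros; lia.
    + intros; lia.
    + apply conv_sum; auto.
  - intros y. simpl. rewrite Cmult_comm.
    eapply has_sum_ext; [|apply has_sum_scal, conv_sum; auto]. intros; simpl; ring.
  - apply conv_sum; auto. apply conv_has_sum; auto.
Qed.

Lemma conv_ext f f' g g' x : (forall y, f y = f' y) -> (forall y, g y = g' y) -> conv f g x = conv f' g' x.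
Proof.
  intros H1 H2. replace f' with f by (apply functional_extensionality; auto).
  replace g' with g by (apply functional_extensionality; auto). auto.
Qed.

Lemma conv_reflect f g x : abs_summable f -> abs_summable g ->
  conv (fun y => f (- y)%Z) (fun y => g (- y)%Z) x = conv f g (- x)%Z.
Proof.
  intros Hf Hg. apply tsum_eq.
  eapply has_sum_ext; [|apply (has_sum_reindex (fun y => f y * g (- x - y)%Z) (fun y => (- y)%Z) (fun y => (- y)%Z))].
  - intros y. simpl. do 2 f_equal. lia.
  - intros; lia.
  - intros; lia.
  - apply conv_sum; auto.
Qed.

(** * Binomial coefficients and the Vandermonde convolution *)

Lemma binc_0 s : binc s 0 = 1.
Proof. unfold binc. simpl. field. Qed.

Lemma binc_S s k : RtoC (INR k + 1) * binc s (S k) = (s + RtoC (INR k)) * binc s k.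
Proof.
  assert (P := pos_INR k).
  unfold binc. simpl pochhammer. rewrite fact_simpl, mult_INR, S_INR, RtoC_mult.
  field. split; first [apply fact_C_neq_0 | apply RtoC_neq; lra].
Qed.

Lemma bincZ_neg q s k : (k < 0)%Z -> bincZ q s k = 0.
Proof. intros H. unfold bincZ. destruct Z_lt_dec; [auto | lia]. Qed.

Lemma bincZ_nat q s k : bincZ q s (Znonneg k) = binc s k * q ^ k.
Proof. unfold bincZ, Znonneg. destruct Z_lt_dec; [lia|]. rewrite Nat2Z.id. auto. Qed.

Lemma Z_cases (k : Z) : (k < 0)%Z \/ exists j, k = Znonneg j.
Proof. destruct (Z_lt_dec k 0); auto. right. exists (Z.to_nat k). unfold Znonneg. lia. Qed.

(** Coefficient form of (1 - q w) w y' = s q w y for y = (1 - q w)^(-s). As the coefficients vanish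
    for k < 0, this equation and the value at k = 0 determine them. *)
Lemma bincZ_recurrence q s k :
  RtoC (IZR k) * bincZ q s k = q * (s + RtoC (IZR (k - 1))) * bincZ q s (k - 1)%Z.
Proof.
  destruct (Z_cases k) as [H|[j ->]].
  - rewrite !bincZ_neg by lia. ring.
  - destruct j as [|j].
    + rewrite (bincZ_neg q s (Znonneg 0 - 1)) by (unfold Znonneg; lia). unfold Znonneg. simpl. ring.
    + replace (Znonneg (S j) - 1)%Z with (Znonneg j) by (unfold Znonneg; lia). rewrite !bincZ_nat.
      unfold Znonneg. rewrite <- !INR_IZR_INZ, S_INR, Cpow_S.
      replace (RtoC (INR j + 1) * (binc s (S j) * (q * q ^ j))) with
        ((RtoC (INR j + 1) * binc s (S j)) * (q * q ^ j)) by ring.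
      rewrite binc_S. ring.
Qed.

Lemma bincZ_unique q s (u : Z -> C) : (forall k, (k < 0)%Z -> u k = 0) -> u 0%Z = 1 ->
  (forall k, RtoC (IZR k) * u k = q * (s + RtoC (IZR (k - 1))) * u (k - 1)%Z) ->
  forall k, u k = bincZ q s k.
Proof.
  intros H0 H1 H k. destruct (Z_cases k) as [h|[j ->]].
  - rewrite H0, bincZ_neg; auto.
  - induction j as [|j IH].
    + rewrite bincZ_nat, binc_0. unfold Znonneg. simpl. rewrite H1. ring.
    + assert (E1 := H (Znonneg (S j))). assert (E2 := bincZ_recurrence q s (Znonneg (S j))).
      replace (Znonneg (S j) - 1)%Z with (Znonneg j) in * by (unfold Znonneg; lia). rewrite IH, <- E2 in E1.
      assert (n : RtoC (IZR (Znonneg (S j))) <> 0).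
      { apply RtoC_neq. unfold Znonneg. rewrite <- INR_IZR_INZ. apply not_0_INR. lia. }
      replace (u (Znonneg (S j))) with (/ RtoC (IZR (Znonneg (S j))) * (RtoC (IZR (Znonneg (S j))) * u (Znonneg (S j)))) by (field; auto).
      rewrite E1. field; auto.
Qed.

Lemma bincZ_summable q s : (Cmod q < 1)%R -> abs_summable (bincZ q s).
Proof.
  intros Hq. apply (abs_summable_inj_iff Znonneg). apply Znonneg_inj.
  - intros j h. apply bincZ_neg. destruct (Z_cases j) as [|[i ->]]; auto. destruct (h i); auto.
  - eapply abs_summable_ext; [|apply (subexp_summable _ q (subexp_binc s) Hq)].
    intros. rewrite bincZ_nat. auto.
Qed.

Lemma has_sum_bincZ q s : (Cmod q < 1)%R ->
  has_sum (fun k => binc s k * q ^ k) (tsum (bincZ q s)).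
Proof.
  intros Hq. assert (T := abs_summable_has_sum _ (bincZ_summable q s Hq)).
  apply (has_sum_inj Znonneg) in T. eapply has_sum_ext; [|apply T].
  intros; simpl; rewrite bincZ_nat; auto. apply Znonneg_inj.
  intros j h. apply bincZ_neg. destruct (Z_cases j) as [|[i ->]]; auto. destruct (h i); auto.
Qed.

Lemma IZR_C_minus a b : RtoC (IZR (a - b)) = RtoC (IZR a) - RtoC (IZR b).
Proof. rewrite minus_IZR, RtoC_minus; auto. Qed.

Lemma IZR_C_plus a b : RtoC (IZR (a + b)) = RtoC (IZR a) + RtoC (IZR b).
Proof. rewrite plus_IZR, RtoC_plus; auto. Qed.

Lemma has_sum_shift (f : Z -> C) a s : has_sum f s -> has_sum (fun y => f (y - a)%Z) s.
Proof. apply (has_sum_reindex f (fun y => (y - a)%Z) (fun y => (y + a)%Z)); intros; lia. Qed.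

(** Writing x = y + (x - y) and applying the recurrence of each factor, the convolution is seen to
    satisfy the recurrence that characterizes [bincZ q (s + t)]. *)
Lemma conv_bincZ q s t x : (Cmod q < 1)%R ->
  conv (bincZ q s) (bincZ q t) x = bincZ q (s + t) x.
Proof.
  intros Hq. assert (Ss := bincZ_summable q s Hq). assert (St := bincZ_summable q t Hq).
  apply (bincZ_unique q (s + t) (conv (bincZ q s) (bincZ q t))); clear x.
  - intros x Hx. apply tsum_eq, has_sum_zero. intros y.
    destruct (Z_lt_dec y 0). rewrite bincZ_neg by auto; ring.
    rewrite (bincZ_neg q t) by lia. ring.
  - apply tsum_eq.
    replace (RtoC 1) with (bincZ q s 0 * bincZ q t (0 - 0)%Z).
    apply (has_sum_single (fun y => bincZ q s y * bincZ q t (0 - y)%Z)).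
    + intros y Hy. destruct (Z_lt_dec y 0). rewrite bincZ_neg by auto; ring.
      rewrite (bincZ_neg q t) by lia. ring.
    + change (0 - 0)%Z with (Znonneg 0). change 0%Z with (Znonneg 0). rewrite !bincZ_nat, !binc_0. simpl. ring.
  - intros x.
    set (F := fun y => bincZ q s y * bincZ q t (x - 1 - y)%Z).
    set (L := map Znonneg (seq 0 (Z.to_nat x))).
    assert (HL : NoDup L) by (apply FinFun.Injective_map_NoDup; [exact Znonneg_inj | apply seq_NoDup]).
    assert (HF : forall y, ~ In y L -> F y = 0).
    { intros y Hy. unfold F. destruct (Z_cases y) as [h|[j ->]].
      - rewrite (bincZ_neg q s) by auto. ring.
      - destruct (Z_lt_dec (x - 1 - Znonneg j) 0) as [h|h].
        + rewrite (bincZ_neg q t) by auto. ring.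
        + destruct Hy. apply in_map, in_seq. unfold Znonneg in *. lia. }
    set (G := fun y => q * (s + RtoC (IZR y)) * F y).
    set (H := fun y => q * (t + RtoC (IZR (x - 1 - y))) * F y).
    assert (SG : has_sum G (Csum G L)).
    { apply has_sum_finite; auto. intros y Hy. unfold G. rewrite HF by auto. ring. }
    assert (SH : has_sum H (Csum H L)).
    { apply has_sum_finite; auto. intros y Hy. unfold H. rewrite HF by auto. ring. }
    assert (S1 : has_sum (fun y => RtoC (IZR x) * (bincZ q s y * bincZ q t (x - y)%Z)) (Csum G L + Csum H L)).
    { eapply has_sum_ext; [|apply (has_sum_plus _ _ _ _ (has_sum_shift G 1 _ SG) SH)].
      intros y. unfold G, H, F.
      assert (R1 := bincZ_recurrence q s y). assert (R2 := bincZ_recurrence q t (x - y)).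
      replace (x - 1 - (y - 1))%Z with (x - y)%Z by lia.
      replace (x - y - 1)%Z with (x - 1 - y)%Z in R2 by lia.
      rewrite IZR_C_minus in R2 at 1.
      replace (RtoC (IZR x) * (bincZ q s y * bincZ q t (x - y)%Z)) with
        ((RtoC (IZR y) * bincZ q s y) * bincZ q t (x - y)%Z
         + bincZ q s y * ((RtoC (IZR x) - RtoC (IZR y)) * bincZ q t (x - y)%Z)) by ring.
      rewrite R1, R2. ring. }
    assert (S2 : has_sum (fun y => q * (s + t + RtoC (IZR (x - 1))) * F y) (Csum G L + Csum H L)).
    { eapply has_sum_ext; [|apply (has_sum_plus _ _ _ _ SG SH)].
      intros y. unfold G, H. rewrite (IZR_C_minus (x - 1) y). ring. }
    rewrite (has_sum_unique _ _ _ (has_sum_scal (RtoC (IZR x)) _ _ (conv_sum _ _ x Ss St)) S1).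
    symmetry. apply (has_sum_unique _ _ _ (has_sum_scal _ _ _ (conv_sum _ _ (x - 1) Ss St)) S2).
Qed.

Lemma tsum_bincZ_mult q s t : (Cmod q < 1)%R ->
  tsum (bincZ q s) * tsum (bincZ q t) = tsum (bincZ q (s + t)).
Proof.
  intros Hq. symmetry. apply tsum_eq.
  eapply has_sum_ext; [|apply conv_has_sum; apply bincZ_summable; auto].
  intros x. apply conv_bincZ; auto.
Qed.

Lemma binc_conj s k : binc (Cconj s) k = Cconj (binc s k).
Proof.
  unfold binc. rewrite pochhammer_conj, Cdiv_conj, Cconj_RtoC by apply fact_C_neq_0. auto.
Qed.

Lemma bincZ_conj q s k : bincZ (RtoC q) (Cconj s) k = Cconj (bincZ (RtoC q) s k).
Proof.
  unfold bincZ. destruct Z_lt_dec. rewrite Cconj_RtoC; auto.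
  rewrite Cmult_conj, Cpow_conj, Cconj_RtoC, binc_conj. auto.
Qed.

(** Coefficient form of w d/dw (1 - q w)^(-s) = s q w (1 - q w)^(-s-1). *)
Lemma bincZ_weight q s k : RtoC (IZR k) * bincZ q s k = s * q * bincZ q (s + 1) (k - 1)%Z.
Proof.
  destruct (Z_cases k) as [h|[j ->]].
  - rewrite !bincZ_neg by lia. ring.
  - destruct j as [|j].
    + rewrite (bincZ_neg q (s + 1)) by (unfold Znonneg; lia). unfold Znonneg; simpl; ring.
    + replace (Znonneg (S j) - 1)%Z with (Znonneg j) by (unfold Znonneg; lia). rewrite !bincZ_nat.
      unfold Znonneg. rewrite <- INR_IZR_INZ. unfold binc.
      rewrite pochhammer_S_l, fact_simpl, mult_INR, RtoC_mult, Cpow_S.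
      assert (RtoC (INR (S j)) <> 0) by (apply RtoC_neq, not_0_INR; lia).
      field. split; auto using fact_C_neq_0.
Qed.

Lemma bincZ_lower q s k : bincZ q s k = bincZ q (s + 1) k - q * bincZ q (s + 1) (k - 1)%Z.
Proof.
  assert (R := bincZ_recurrence q (s + 1) k). assert (W := bincZ_weight q s k).
  destruct (Z_cases k) as [h|[j ->]].
  - rewrite !bincZ_neg by lia. ring.
  - destruct j as [|j].
    + rewrite (bincZ_neg q (s + 1) (Znonneg 0 - 1)) by (unfold Znonneg; lia). rewrite !bincZ_nat, !binc_0. ring.
    + assert (n : RtoC (IZR (Znonneg (S j))) <> 0).
      { apply RtoC_neq. unfold Znonneg. rewrite <- INR_IZR_INZ. apply not_0_INR. lia. }
      set (k := Znonneg (S j)) in *. rewrite IZR_C_minus in R.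
      set (u := bincZ q (s + 1) (k - 1)) in *.
      replace (bincZ q s k) with (/ RtoC (IZR k) * (RtoC (IZR k) * bincZ q s k)) by (field; auto).
      replace (bincZ q (s + 1) k) with (/ RtoC (IZR k) * (RtoC (IZR k) * bincZ q (s + 1) k)) by (field; auto).
      rewrite W, R. field. auto.
Qed.

Definition sgnZ (k : Z) : C := if Z.even k then 1 else -1.

Lemma sgnZ_plus a b : sgnZ (a + b) = sgnZ a * sgnZ b.
Proof. unfold sgnZ. rewrite Z.even_add. destruct (Z.even a), (Z.even b); simpl; ring. Qed.

Lemma sgnZ_sq a : sgnZ a * sgnZ a = 1.
Proof. unfold sgnZ. destruct (Z.even a); ring. Qed.

Lemma sgnZ_S a : sgnZ (Znonneg (S a)) = - sgnZ (Znonneg a).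
Proof.
  replace (Znonneg (S a)) with (Znonneg a + 1)%Z by (unfold Znonneg; lia). rewrite sgnZ_plus.
  unfold sgnZ at 2. simpl. ring.
Qed.

Lemma pochhammer_reflect w j : pochhammer (1 - w) j = sgnZ (Znonneg j) * pochhammer (w - RtoC (INR j)) j.
Proof.
  induction j as [|j IH].
  - simpl. unfold sgnZ, Znonneg; simpl. ring.
  - rewrite sgnZ_S, S_INR, RtoC_plus, (pochhammer_S_l (w - _)).
    change (pochhammer (1 - w) (S j)) with (pochhammer (1 - w) j * (1 - w + RtoC (INR j))). rewrite IH.
    replace (w - (RtoC (INR j) + 1) + 1) with (w - RtoC (INR j)) by ring. ring.
Qed.

(** Both sides are the product of the two Pochhammer symbols with 1/Gamma at the common point sg + n
    + k = sg + x + j. *)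
Lemma pochhammer_swap sg (n x : Z) (k j : nat) : (n + Znonneg k = x + Znonneg j)%Z ->
  (forall i : Z, sg + RtoC (IZR i) <> 0) ->
  pochhammer (RtoC (IZR n) + sg) k * rGamma (RtoC (IZR x) + sg)
   = pochhammer (RtoC (IZR x) + sg) j * rGamma (RtoC (IZR n) + sg).
Proof.
  intros H Hs.
  rewrite (rGamma_pochhammer (RtoC (IZR x) + sg) j), (rGamma_pochhammer (RtoC (IZR n) + sg) k).
  replace (RtoC (IZR n) + sg + RtoC (INR k)) with (RtoC (IZR x) + sg + RtoC (INR j)). ring.
  rewrite !INR_IZR_INZ.
  replace (RtoC (IZR n) + sg + RtoC (IZR (Z.of_nat k))) with (sg + RtoC (IZR (n + Znonneg k))) by (rewrite IZR_C_plus; unfold Znonneg; ring).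
  rewrite H, IZR_C_plus. unfold Znonneg. ring.
Qed.

Lemma rGamma_reflect w j :
  sgnZ (Znonneg j) * pochhammer (1 - w) j * rGamma w = rGamma (w - RtoC (INR j)).
Proof.
  rewrite pochhammer_reflect, (rGamma_pochhammer (w - RtoC (INR j)) j).
  replace (w - RtoC (INR j) + RtoC (INR j)) with w by ring.
  replace (sgnZ (Znonneg j) * (sgnZ (Znonneg j) * pochhammer (w - RtoC (INR j)) j) * rGamma w) with
    ((sgnZ (Znonneg j) * sgnZ (Znonneg j)) * (pochhammer (w - RtoC (INR j)) j * rGamma w)) by ring.
  rewrite sgnZ_sq. ring.
Qed.

(** Both sides equal 1/Gamma at the common point sg + x - k = sg + n - j. *)
Lemma pochhammer_swap_reflected sg (n x : Z) (k j : nat) : (n + Znonneg k = x + Znonneg j)%Z ->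
  sgnZ (Znonneg k) * pochhammer (1 - (RtoC (IZR x) + sg)) k * rGamma (RtoC (IZR x) + sg)
   = sgnZ (Znonneg j) * pochhammer (1 - (RtoC (IZR n) + sg)) j * rGamma (RtoC (IZR n) + sg).
Proof.
  intros H. rewrite !rGamma_reflect. f_equal. rewrite !INR_IZR_INZ.
  replace (RtoC (IZR x) + sg - RtoC (IZR (Z.of_nat k))) with (sg + RtoC (IZR (x - Znonneg k))) by (rewrite IZR_C_minus; unfold Znonneg; ring).
  replace (x - Znonneg k)%Z with (n - Znonneg j)%Z by lia. rewrite IZR_C_minus. unfold Znonneg. ring.
Qed.

Lemma pochhammer_vanish (m k : nat) : (m < k)%nat -> pochhammer (- RtoC (INR m)) k = 0.
Proof.
  intros H. induction k as [|k IH]; [lia|]. simpl.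
  destruct (Nat.eq_dec m k) as [->|h]. ring. rewrite IH by lia. ring.
Qed.

(** * Laurent coefficients of (1 - q w)^(-s) (1 - q/w)^(-t) and the matrix they form *)

Section Laurent.
Variable q : R.
Hypothesis q_range : (0 < q < 1)%R.

Lemma q_Cmod : (Cmod (RtoC q) < 1)%R.
Proof. rewrite Cmod_R, Rabs_pos_eq; lra. Qed.

Notation A := (bincZ (RtoC q)).
Notation Lr := (laurent (RtoC q)).

Lemma A_summable s : abs_summable (A s).
Proof. apply bincZ_summable, q_Cmod. Qed.

Lemma A_reflect_summable s : abs_summable (fun k => A s (- k)%Z).
Proof. apply (abs_summable_reindex (A s) (fun k => (- k)%Z) (fun k => (- k)%Z)). intros; lia. apply A_summable. Qed.

Hint Resolve q_Cmod A_summable A_reflect_summable : core.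

Lemma laurent_sum s t d : has_sum (fun y => A s y * A t (y - d)%Z) (Lr s t d).
Proof.
  eapply has_sum_ext; [|apply conv_sum; auto]. intros y. cbv beta. f_equal. f_equal. lia.
Qed.

Lemma laurent_summable s t : abs_summable (Lr s t).
Proof. apply conv_has_sum; auto. Qed.
Hint Resolve laurent_summable : core.

Lemma laurent_reflect s t d : Lr s t (- d)%Z = Lr t s d.
Proof.
  unfold laurent. rewrite <- conv_reflect by auto. rewrite conv_comm.
  - apply conv_ext; auto. intros y. f_equal. lia.
  - apply (abs_summable_reindex (A s) (fun k => (- k)%Z) (fun k => (- k)%Z)); auto. intros; lia.
  - eapply abs_summable_ext; [|apply (A_summable t)]. intros y. cbv beta. f_equal. lia.
Qed.

Lemma laurent_conj s t d : Cconj (Lr s t d) = Lr (Cconj s) (Cconj t) d.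
Proof.
  apply (has_sum_unique _ _ _ (has_sum_Cconj _ _ (laurent_sum s t d))).
  eapply has_sum_ext; [|apply laurent_sum]. intros y. cbv beta. rewrite Cmult_conj, !bincZ_conj. auto.
Qed.

Lemma laurent_lower_l s t d : Lr s t d = Lr (s + 1) t d - RtoC q * Lr (s + 1) t (d - 1)%Z.
Proof.
  apply (has_sum_unique _ _ _ (laurent_sum s t d)).
  eapply has_sum_ext; [| apply has_sum_minus; [apply laurent_sum |
    apply has_sum_scal, (has_sum_shift (fun y => A (s + 1) y * A t (y - (d - 1))%Z) 1), laurent_sum]].
  intros y. cbv beta. rewrite (bincZ_lower _ s). replace (y - 1 - (d - 1))%Z with (y - d)%Z by lia. ring.
Qed.

Lemma laurent_lower_r s t d : Lr s t d = Lr s (t + 1) d - RtoC q * Lr s (t + 1) (d + 1)%Z.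
Proof.
  apply (has_sum_unique _ _ _ (laurent_sum s t d)).
  eapply has_sum_ext; [| apply has_sum_minus; [apply laurent_sum | apply has_sum_scal, laurent_sum]].
  intros y. cbv beta. rewrite (bincZ_lower _ t). replace (y - d - 1)%Z with (y - (d + 1))%Z by lia. ring.
Qed.

(** Leibniz rule for w d/dw on the two factors of the generating function. *)
Lemma laurent_weight s t d : RtoC (IZR d) * Lr s t d =
  s * RtoC q * Lr (s + 1) t (d - 1)%Z - t * RtoC q * Lr s (t + 1) (d + 1)%Z.
Proof.
  apply (has_sum_unique _ _ _ (has_sum_scal _ _ _ (laurent_sum s t d))).
  eapply has_sum_ext; [| apply has_sum_minus; [
    apply has_sum_scal, (has_sum_shift (fun y => A (s + 1) y * A t (y - (d - 1))%Z) 1), laurent_sum | apply has_sum_scal, laurent_sum]].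
  intros y. cbv beta. replace (y - 1 - (d - 1))%Z with (y - d)%Z by lia.
  replace (y - (d + 1))%Z with (y - d - 1)%Z by lia.
  assert (W1 := bincZ_weight (RtoC q) s y). assert (W2 := bincZ_weight (RtoC q) t (y - d)).
  rewrite IZR_C_minus in W2.
  replace (s * RtoC q * (A (s + 1) (y - 1)%Z * A t (y - d)%Z)) with
    ((RtoC (IZR y) * A s y) * A t (y - d)%Z) by (rewrite W1; ring).
  replace (t * RtoC q * (A s y * A (t + 1) (y - d - 1)%Z)) with
    (A s y * ((RtoC (IZR y) - RtoC (IZR d)) * A t (y - d)%Z)) by (rewrite W2; ring).
  ring.
Qed.

(* Multiplication by [d] is the derivation w d/dw on the generating functions. *)
Lemma laurent_recurrence s t d :
  RtoC (1 - q ^ 2) * (RtoC (IZR d) * Lr s t d) =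
  s * (RtoC (q ^ 2) * Lr s t d + RtoC q * Lr (s + 1) (t - 1) (d - 1)%Z)
  - t * (RtoC (q ^ 2) * Lr s t d + RtoC q * Lr (s - 1) (t + 1) (d + 1)%Z).
Proof.
  rewrite laurent_weight.
  assert (E1 : RtoC (q ^ 2) * Lr s t d + RtoC q * Lr (s + 1) (t - 1) (d - 1)%Z
     = RtoC q * RtoC (1 - q ^ 2) * Lr (s + 1) t (d - 1)%Z).
  { rewrite (laurent_lower_l s t d), (laurent_lower_r (s + 1) (t - 1)).
    replace (t - 1 + 1) with t by ring. replace (d - 1 + 1)%Z with d by lia.
    rewrite RtoC_minus, RtoC_pow. ring. }
  assert (E2 : RtoC (q ^ 2) * Lr s t d + RtoC q * Lr (s - 1) (t + 1) (d + 1)%Z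
     = RtoC q * RtoC (1 - q ^ 2) * Lr s (t + 1) (d + 1)%Z).
  { rewrite (laurent_lower_r s t d), (laurent_lower_l (s - 1) (t + 1)).
    replace (s - 1 + 1) with s by ring. replace (d + 1 - 1)%Z with d by lia.
    rewrite RtoC_minus, RtoC_pow. ring. }
  rewrite E1, E2. ring.
Qed.

(** Parseval on the circle: conjugation exchanges w and 1/w, so the inner product is a single
    coefficient of a product of generating functions, in which the exponents add up. *)
Lemma laurent_inner s t s' t' n m :
  has_sum (fun x => Lr s t (x - n)%Z * Cconj (Lr s' t' (x - m)%Z))
    (Lr (s + Cconj t') (t + Cconj s') (m - n)%Z).
Proof.
  assert (E : conv (Lr s t) (Lr (Cconj t') (Cconj s')) (m - n)%Z
     = Lr (s + Cconj t') (t + Cconj s') (m - n)%Z).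
  { assert (X : forall x, Lr (s + Cconj t') (t + Cconj s') x =
       conv (conv (A s) (A (Cconj t'))) (conv (fun k => A t (- k)%Z) (fun k => A (Cconj s') (- k)%Z)) x).
    { intros x. unfold laurent. apply conv_ext.
      - intros y. rewrite conv_bincZ; auto.
      - intros y. rewrite conv_reflect, conv_bincZ; auto. }
    rewrite X. unfold laurent.
    assert (S1 : forall a b, abs_summable (conv (fun k => A a (- k)%Z) (fun k => A b (- k)%Z))) by (intros; apply conv_has_sum; auto).
    assert (S2 : forall a b, abs_summable (conv (A a) (fun k => A b (- k)%Z))) by (intros; apply conv_has_sum; auto).
    rewrite !conv_assoc by auto.
    apply conv_ext; auto. intros y.
    rewrite <- !conv_assoc by auto. apply conv_ext; auto. intros z.
    apply conv_comm; auto. }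
  rewrite <- E.
  eapply has_sum_ext; [|apply (has_sum_shift (fun y => Lr s t y * Lr (Cconj t') (Cconj s') (m - n - y)%Z) n), conv_sum; auto].
  intros x. cbv beta. rewrite laurent_conj, <- (laurent_reflect (Cconj s')). do 2 f_equal. lia.
Qed.

Lemma bincZ_vanish (m : nat) k : (Znonneg m < k)%Z -> A (- RtoC (INR m)) k = 0.
Proof.
  intros H. destruct (Z_cases k) as [h|[j ->]]. unfold Znonneg in *; lia.
  rewrite bincZ_nat. unfold binc. rewrite pochhammer_vanish by (unfold Znonneg in H; lia).
  field. apply fact_C_neq_0.
Qed.

(** For d > 0 the factor (1 - q w)^(d-1) is a polynomial of degree d - 1 and the other is a series
    in 1/w, so w^d does not occur; d < 0 is symmetric. For d = 0 the sum is the geometric series in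
    q^2. *)
Lemma laurent_delta d : Lr (1 - RtoC (IZR d)) (1 + RtoC (IZR d)) d =
  if Z.eq_dec d 0 then RtoC (/ (1 - q ^ 2)) else 0.
Proof.
  apply tsum_eq. destruct Z.eq_dec as [->|h].
  - apply (has_sum_inj Znonneg).
    + apply Znonneg_inj.
    + intros j hj. destruct (Z_cases j) as [hh|[i ->]]; [|destruct (hj i); auto].
      rewrite bincZ_neg by auto. ring.
    + assert (B1 : forall k, binc 1 k = 1).
      { intros k. unfold binc. rewrite pochhammer_1. field. apply fact_C_neq_0. }
      assert (Q : (0 <= q ^ 2 < 1)%R) by nra.
      assert (G : is_series (fun k => ((q ^ 2) ^ k)%R) (/ (1 - q ^ 2))%R).
      { apply is_series_geom. rewrite Rabs_pos_eq; lra. }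
      assert (S : abs_summable (fun k => RtoC ((q ^ 2) ^ k))).
      { apply abs_summable_ex_series. intros; apply pow_le; lra. eexists; apply G. }
      destruct (has_sum_real _ S) as [v Hv].
      assert (V := proj1 (has_sum_is_series_parts _ _ Hv)). simpl in V.
      replace (/ (1 - q ^ 2))%R with v.
      * eapply has_sum_ext; [|apply Hv]. intros k. cbv beta.
        replace (- (0 - Znonneg k))%Z with (Znonneg k) by lia. change (IZR 0) with 0%R.
        replace (1 - 0) with (RtoC 1) by ring. replace (1 + 0) with (RtoC 1) by ring.
        rewrite bincZ_nat, B1, !RtoC_pow. simpl (RtoC q ^ 2). rewrite !Cpow_mult_l, Cpow_1_l. ring.
      * rewrite <- (is_series_unique _ _ V). apply is_series_unique. exact G.
  - apply has_sum_zero. intros y. destruct (Z_lt_dec 0 d).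
    + destruct (Z_lt_dec y d).
      * rewrite (bincZ_neg _ _ (- (d - y))%Z) by lia. ring.
      * replace (1 - RtoC (IZR d)) with (- RtoC (INR (Z.to_nat (d - 1)))).
        rewrite bincZ_vanish by (unfold Znonneg; lia). ring.
        rewrite INR_IZR_INZ, Z2Nat.id, IZR_C_minus by lia. ring.
    + destruct (Z_lt_dec y 0).
      * rewrite (bincZ_neg _ _ y) by lia. ring.
      * replace (1 + RtoC (IZR d)) with (- RtoC (INR (Z.to_nat (- d - 1)))).
        rewrite bincZ_vanish by (unfold Znonneg; lia). ring.
        rewrite INR_IZR_INZ, Z2Nat.id by lia. rewrite IZR_C_minus, opp_IZR, RtoC_opp. ring.
Qed.

Variable sg : C.
(** Keeps 1/Gamma away from its zeros along sg + Z. For the Meixner functions this is what excluding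
    (lambda, epsilon) = (-1/2, 1/2) achieves. *)
Hypothesis sg_not_int : forall i : Z, sg + RtoC (IZR i) <> 0.

(** Coefficient of w^x in the function phi_n of the overview; the factor w^n accounts for the shift
    x - n. *)
Definition matcoef (n x : Z) : C :=
  Lr (RtoC (IZR n) + sg) (1 - (RtoC (IZR n) + Cconj sg)) (x - n)%Z.

(** In the product of phi_n with the conjugate of phi_m the parameter sg cancels, leaving the
    integral exponents of [laurent_delta] at d = m - n. *)
Lemma matcoef_rows n m : has_sum (fun x => matcoef n x * Cconj (matcoef m x))
  (if Z.eq_dec n m then RtoC (/ (1 - q ^ 2)) else 0).
Proof.
  assert (T := laurent_inner (RtoC (IZR n) + sg) (1 - (RtoC (IZR n) + Cconj sg))
    (RtoC (IZR m) + sg) (1 - (RtoC (IZR m) + Cconj sg)) n m).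
  replace (RtoC (IZR n) + sg + Cconj (1 - (RtoC (IZR m) + Cconj sg))) with (1 - RtoC (IZR (m - n))) in T.
  2: { rewrite IZR_C_minus, Cminus_conj, Cplus_conj, Cconj_conj, !Cconj_RtoC. ring. }
  replace (1 - (RtoC (IZR n) + Cconj sg) + Cconj (RtoC (IZR m) + sg)) with (1 + RtoC (IZR (m - n))) in T.
  2: { rewrite IZR_C_minus, Cplus_conj, !Cconj_RtoC. ring. }
  rewrite laurent_delta in T.
  destruct (Z.eq_dec (m - n) 0), (Z.eq_dec n m); try lia; exact T.
Qed.

Lemma matcoef_recurrence n x :
  RtoC (1 - q ^ 2) * (RtoC (IZR (x - n)) * matcoef n x) =
  (RtoC (IZR n) + sg) * (RtoC (q ^ 2) * matcoef n x + RtoC q * matcoef (n + 1) x)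
  + (RtoC (IZR n) + Cconj sg - 1) * (RtoC (q ^ 2) * matcoef n x + RtoC q * matcoef (n - 1) x).
Proof.
  unfold matcoef. rewrite laurent_recurrence.
  replace (RtoC (IZR (n + 1)) + sg) with (RtoC (IZR n) + sg + 1) by (rewrite IZR_C_plus; ring).
  replace (1 - (RtoC (IZR (n + 1)) + Cconj sg)) with (1 - (RtoC (IZR n) + Cconj sg) - 1) by (rewrite IZR_C_plus; ring).
  replace (RtoC (IZR (n - 1)) + sg) with (RtoC (IZR n) + sg - 1) by (rewrite IZR_C_minus; ring).
  replace (1 - (RtoC (IZR (n - 1)) + Cconj sg)) with (1 - (RtoC (IZR n) + Cconj sg) + 1) by (rewrite IZR_C_minus; ring).
  replace (x - (n + 1))%Z with (x - n - 1)%Z by lia.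
  replace (x - (n - 1))%Z with (x - n + 1)%Z by lia. ring.
Qed.

Lemma sgb_not_int (i : Z) : Cconj sg + RtoC (IZR i) <> 0.
Proof.
  intros H. apply (sg_not_int i). rewrite <- (Cconj_conj (sg + _)), Cplus_conj, Cconj_RtoC, H. apply Cconj_RtoC.
Qed.

Lemma rGamma_shift_neq_0 s n : (forall i : Z, s + RtoC (IZR i) <> 0) -> rGamma (RtoC (IZR n) + s) <> 0.
Proof.
  intros Hs. apply rGamma_neq_0. intros j.
  replace (RtoC (IZR n) + s + RtoC (INR j)) with (s + RtoC (IZR (n + Z.of_nat j))). auto.
  rewrite IZR_C_plus, <- INR_IZR_INZ. ring.
Qed.

(* Up to unimodular factors the matrix is symmetric, so row relations give column relations. *)
Lemma matcoef_swap n x :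
  matcoef n x * (rGamma (RtoC (IZR n) + Cconj sg) / rGamma (RtoC (IZR n) + sg) * sgnZ n) =
  matcoef x n * (rGamma (RtoC (IZR x) + Cconj sg) / rGamma (RtoC (IZR x) + sg) * sgnZ x).
Proof.
  set (gn := rGamma (RtoC (IZR n) + Cconj sg) / rGamma (RtoC (IZR n) + sg) * sgnZ n).
  set (gx := rGamma (RtoC (IZR x) + Cconj sg) / rGamma (RtoC (IZR x) + sg) * sgnZ x).
  rewrite (Cmult_comm _ gn), (Cmult_comm _ gx).
  apply (has_sum_unique _ _ _ (has_sum_scal gn _ _ (laurent_sum _ _ _))).
  eapply has_sum_ext; [|apply has_sum_scal, (has_sum_shift (fun y => A (RtoC (IZR x) + sg) y *
    A (1 - (RtoC (IZR x) + Cconj sg)) (y - (n - x))%Z) (x - n)), laurent_sum].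
  intros y. cbv beta. replace (y - (x - n) - (n - x))%Z with y by lia.
  (* After the shift the two sums agree term by term: with y = k and y - (x - n) = j, the exchange
     identities trade the Pochhammer symbols at n for those at x. *)
  destruct (Z_cases y) as [h|[k ->]].
  { rewrite !(bincZ_neg _ _ y) by auto. ring. }
  destruct (Z_cases (Znonneg k - (x - n))) as [h|[j Hj]].
  { rewrite !(bincZ_neg _ _ (Znonneg k - (x - n))%Z) by auto. ring. }
  rewrite Hj, !bincZ_nat. unfold binc.
  assert (E : (n + Znonneg k = x + Znonneg j)%Z) by lia.
  assert (P1 := pochhammer_swap sg n x k j E sg_not_int).
  assert (P2 := pochhammer_swap_reflected (Cconj sg) n x k j E).
  assert (N1 := rGamma_shift_neq_0 sg n sg_not_int). assert (N2 := rGamma_shift_neq_0 sg x sg_not_int).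
  set (pk := pochhammer (RtoC (IZR n) + sg) k) in *. set (pj := pochhammer (RtoC (IZR x) + sg) j) in *.
  set (rk := pochhammer (1 - (RtoC (IZR x) + Cconj sg)) k) in *.
  set (rj := pochhammer (1 - (RtoC (IZR n) + Cconj sg)) j) in *.
  unfold gn, gx.
  set (a := rGamma (RtoC (IZR n) + sg)) in *. set (b := rGamma (RtoC (IZR x) + sg)) in *.
  set (a' := rGamma (RtoC (IZR n) + Cconj sg)) in *. set (b' := rGamma (RtoC (IZR x) + Cconj sg)) in *.
  assert (S : sgnZ n * sgnZ (Znonneg k) = sgnZ x * sgnZ (Znonneg j)) by (rewrite <- !sgnZ_plus, E; auto).
  assert (Sk := sgnZ_sq (Znonneg k)). assert (Sj := sgnZ_sq (Znonneg j)).
  assert (F1 := fact_C_neq_0 k). assert (F2 := fact_C_neq_0 j).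
  assert (Q : pj * rk * b' * sgnZ x * a = pk * rj * a' * sgnZ n * b).
  { replace (pj * rk * b' * sgnZ x * a) with ((pj * a) * (rk * b') * sgnZ x) by ring.
    rewrite <- P1.
    replace (rk * b') with ((sgnZ (Znonneg k) * sgnZ (Znonneg k)) * (rk * b')) by (rewrite Sk; ring).
    replace (sgnZ (Znonneg k) * sgnZ (Znonneg k) * (rk * b')) with (sgnZ (Znonneg k) * (sgnZ (Znonneg k) * rk * b')) by ring.
    rewrite P2.
    replace (pk * b * (sgnZ (Znonneg k) * (sgnZ (Znonneg j) * rj * a')) * sgnZ x) with
      (pk * b * rj * a' * (sgnZ (Znonneg k) * (sgnZ x * sgnZ (Znonneg j)))) by ring.
    rewrite <- S. replace (sgnZ (Znonneg k) * (sgnZ n * sgnZ (Znonneg k))) with (sgnZ n * (sgnZ (Znonneg k) * sgnZ (Znonneg k))) by ring.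
    rewrite Sk. ring. }
  transitivity ((pj * rk * b' * sgnZ x * a) * (RtoC q ^ k * RtoC q ^ j
     / (a * b * RtoC (INR (fact k)) * RtoC (INR (fact j))))).
  field; auto. rewrite Q. field; auto.
Qed.

Lemma matcoef_cols x y : has_sum (fun n => matcoef n x * Cconj (matcoef n y))
  (if Z.eq_dec x y then RtoC (/ (1 - q ^ 2)) else 0).
Proof.
  set (g := fun n => rGamma (RtoC (IZR n) + Cconj sg) / rGamma (RtoC (IZR n) + sg) * sgnZ n).
  assert (Ng : forall n, g n * Cconj (g n) = 1).
  { intros n. unfold g. assert (N1 := rGamma_shift_neq_0 sg n sg_not_int).
    assert (N2 := rGamma_shift_neq_0 (Cconj sg) n sgb_not_int).
    rewrite Cmult_conj, Cdiv_conj, <- !rGamma_conj, !Cplus_conj, !Cconj_RtoC, Cconj_conj by auto.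
    replace (Cconj (sgnZ n)) with (sgnZ n).
    2: { unfold sgnZ. destruct (Z.even n); unfold Cconj, RtoC; simpl; f_equal; ring. }
    transitivity (sgnZ n * sgnZ n). field; auto. apply sgnZ_sq. }
  assert (Sw : forall n z, matcoef n z * g n = matcoef z n * g z) by (intros; apply matcoef_swap).
  assert (T := has_sum_scal (g x * Cconj (g y)) _ _ (matcoef_rows x y)).
  replace (if Z.eq_dec x y then RtoC (/ (1 - q ^ 2)) else 0) with
    (g x * Cconj (g y) * (if Z.eq_dec x y then RtoC (/ (1 - q ^ 2)) else 0)).
  - eapply has_sum_ext; [|apply T]. intros n. cbv beta.
    replace (g x * Cconj (g y) * (matcoef x n * Cconj (matcoef y n))) with
      ((matcoef x n * g x) * Cconj (matcoef y n * g y)) by (rewrite Cmult_conj; ring).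
    rewrite (Sw x n), (Sw y n), Cmult_conj.
    replace (matcoef n x * g n * (Cconj (matcoef n y) * Cconj (g n))) with
      (matcoef n x * Cconj (matcoef n y) * (g n * Cconj (g n))) by ring.
    rewrite Ng. ring.
  - destruct Z.eq_dec as [->|]; [rewrite Ng|]; ring.
Qed.

End Laurent.
End Convolution.

(** * Power series *)

(* (1 - z)^(-s) for |z| < 1, without choosing a logarithm. *)
Definition binser (s z : C) : C := tsum (bincZ z s).

Definition powser (g : nat -> C) (z : C) : C := tsum (fun k => Cmult (g k) (Cpow z k)).

Definition taylor_coef (g : nat -> C) (z0 : C) (j : nat) : C :=
  tsum (fun i => Cmult (Cmult (g (i + j)%nat) (RtoC (INR (fact (i + j)) / (INR (fact i) * INR (fact j))))) (Cpow z0 i)).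

Definition pfaff_coef (a : C) (g : nat -> C) (m : nat) : C :=
  Csum (fun k => Cmult (g k) (binc (Cplus a (RtoC (INR k))) (m - k))) (seq 0 (S m)).

Section PowerSeries.
Open Scope C_scope.

(** Puts the pairs (k, j) with k + j = m into row m and fills up with zeros, so that Fubini on a
    full product performs the regrouping. *)
Lemma antidiagonal_extension (F : nat * nat -> C) : exists G : nat * nat -> C,
  (forall k j, G ((k + j)%nat, k) = F (k, j)) /\ (forall m k, (m < k)%nat -> G (m, k) = 0).
Proof.
  exists (fun p => if le_lt_dec (snd p) (fst p) then F (snd p, (fst p - snd p)%nat) else RtoC 0).
  split; intros; simpl; destruct le_lt_dec; try lia; auto. do 2 f_equal. lia.
Qed.

Lemma antidiagonal_has_sum (F G : nat * nat -> C) s :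
  (forall k j, G ((k + j)%nat, k) = F (k, j)) -> (forall m k, (m < k)%nat -> G (m, k) = 0) ->
  has_sum F s <-> has_sum G s.
Proof.
  intros H1 H2. rewrite <- (has_sum_inj (fun p : nat * nat => ((fst p + snd p)%nat, fst p)) G).
  - split; apply has_sum_ext; intros [k j]; simpl; auto.
  - intros [k j] [k' j'] h. simpl in h. inversion h. f_equal. lia.
  - intros [m k] h. apply H2. apply Nat.nle_gt. intros hk. apply (h (k, (m - k)%nat)). simpl. f_equal. lia.
Qed.

Lemma antidiagonal_sum (F : nat * nat -> C) s : has_sum F s ->
  has_sum (fun m => Csum (fun k => F (k, (m - k)%nat)) (seq 0 (S m))) s.
Proof.
  intros HF. destruct (antidiagonal_extension F) as [G [H1 H2]].
  rewrite (antidiagonal_has_sum F G s H1 H2) in HF.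
  apply (has_sum_fubini G _ s HF). intros m.
  replace (Csum (fun k => F (k, (m - k)%nat)) (seq 0 (S m))) with (Csum (fun k => G (m, k)) (seq 0 (S m))).
  - apply (has_sum_finite (fun k => G (m, k))). apply seq_NoDup. intros k hk. apply H2.
    apply Nat.nle_gt. intros h. apply hk, in_seq. lia.
  - apply Csum_ext. intros k hk. apply in_seq in hk. rewrite <- H1. do 2 f_equal. lia.
Qed.

Lemma Csum_seq_last (f : nat -> C) n : Csum f (seq 0 (S n)) = Csum f (seq 0 n) + f n.
Proof. rewrite seq_S, Csum_app. simpl. rewrite Cplus_0_r. auto. Qed.

Lemma Csum_seq_first (f : nat -> C) n :
  Csum f (seq 0 (S n)) = f O + Csum (fun k => f (S k)) (seq 0 n).
Proof. simpl. rewrite <- seq_shift, Csum_map. auto. Qed.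

(** Turns the binomial theorem into a plain convolution without binomial coefficients. *)
Definition divided_power (x : C) (k : nat) : C := x ^ k / RtoC (INR (fact k)).

Lemma dpow_S x k : RtoC (INR (S k)) * divided_power x (S k) = x * divided_power x k.
Proof.
  unfold divided_power. rewrite fact_simpl, mult_INR, RtoC_mult, Cpow_S. field.
  split. apply fact_C_neq_0. apply RtoC_neq, not_0_INR; lia.
Qed.

Lemma INR_C_minus m k : (k <= m)%nat -> RtoC (INR (m - k)) = RtoC (INR m) - RtoC (INR k).
Proof. intros H. rewrite minus_INR by auto. apply RtoC_minus. Qed.

(** Multiply by m + 1 = (m + 1 - k) + k; each part lowers one of the two divided powers and reduces
    to the case m. *)
Lemma binomial_dpow x y m :
  Csum (fun k => divided_power x (m - k) * divided_power y k) (seq 0 (S m)) = divided_power (x + y) m.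
Proof.
  induction m as [|m IH].
  - simpl. unfold divided_power. simpl. field.
  - assert (n : RtoC (INR (S m)) <> 0) by (apply RtoC_neq, not_0_INR; lia).
    assert (E : RtoC (INR (S m)) * Csum (fun k => divided_power x (S m - k) * divided_power y k) (seq 0 (S (S m)))
       = RtoC (INR (S m)) * divided_power (x + y) (S m)).
    { rewrite dpow_S, <- IH, <- Csum_scal.
      rewrite (Csum_ext _ (fun k => RtoC (INR (S m - k)) * divided_power x (S m - k) * divided_power y k
          + divided_power x (S m - k) * (RtoC (INR k) * divided_power y k))).
      2: { intros k hk. apply in_seq in hk. rewrite INR_C_minus by lia. ring. }
      rewrite Csum_plus, Csum_seq_last, (Csum_seq_first (fun k => divided_power x (S m - k) * (RtoC (INR k) * divided_power y k))).
      rewrite Nat.sub_diag. simpl (INR 0).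
      rewrite Cmult_plus_distr_r, <- !Csum_scal.
      rewrite (Csum_ext _ (fun k => x * (divided_power x (m - k) * divided_power y k)) (seq 0 (S m))).
      2: { intros k hk. apply in_seq in hk. replace (S m - k)%nat with (S (m - k)) by lia. rewrite dpow_S. ring. }
      rewrite (Csum_ext (fun k => divided_power x (S m - S k) * (RtoC (INR (S k)) * divided_power y (S k)))
         (fun k => y * (divided_power x (m - k) * divided_power y k)) (seq 0 (S m))).
      2: { intros k hk. rewrite dpow_S. simpl (S m - S k)%nat. ring. }
      ring. }
    replace (Csum (fun k => divided_power x (S m - k) * divided_power y k) (seq 0 (S (S m)))) with
      (/ RtoC (INR (S m)) * (RtoC (INR (S m)) * Csum (fun k => divided_power x (S m - k) * divided_power y k) (seq 0 (S (S m)))))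
      by (field; auto).
    rewrite E. field; auto.
Qed.

Lemma Cmod_dpow x k : RtoC (Cmod (divided_power x k)) = divided_power (RtoC (Cmod x)) k.
Proof.
  unfold divided_power. rewrite Cmod_div by apply fact_C_neq_0. rewrite Cmod_pow, Cmod_R, Rabs_pos_eq by apply pos_INR.
  rewrite RtoC_div, RtoC_pow by apply INR_fact_neq_0. auto.
Qed.

Lemma Cpow_RtoC x k : RtoC x ^ k = RtoC (x ^ k).
Proof. symmetry. apply RtoC_pow. Qed.

(* Expand (z0 + h)^m binomially and sum over m first. *)
Lemma reexpansion (g : nat -> C) (z0 h : C) :
  abs_summable (fun m => g m * RtoC (Cmod z0 + Cmod h) ^ m) ->
  (forall j, abs_summable (fun i => g (i + j)%nat * RtoC (INR (fact (i + j)) / (INR (fact i) * INR (fact j))) * z0 ^ i * h ^ j)) /\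
  abs_summable (fun j => tsum (fun i => g (i + j)%nat * RtoC (INR (fact (i + j)) / (INR (fact i) * INR (fact j))) * z0 ^ i * h ^ j)) /\
  has_sum (fun j => tsum (fun i => g (i + j)%nat * RtoC (INR (fact (i + j)) / (INR (fact i) * INR (fact j))) * z0 ^ i * h ^ j)) (powser g (z0 + h)).
Proof.
  intros Hs.
  set (F := fun p : nat * nat => g (fst p + snd p)%nat * RtoC (INR (fact (fst p + snd p))) *
     (divided_power z0 (snd p) * divided_power h (fst p))).
  set (G := fun p : nat * nat => if le_lt_dec (snd p) (fst p) then
     g (fst p) * RtoC (INR (fact (fst p))) * (divided_power z0 (fst p - snd p) * divided_power h (snd p)) else RtoC 0).
  assert (G1 : forall k j, G ((k + j)%nat, k) = F (k, j)).
  { intros k j. unfold G, F; simpl. destruct le_lt_dec; [|lia]. replace (k + j - k)%nat with j by lia. auto. }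
  assert (G2 : forall m k, (m < k)%nat -> G (m, k) = 0).
  { intros m k h'. unfold G; simpl. destruct le_lt_dec; [lia|auto]. }
  assert (rowsum : forall x y m, Csum (fun k => RtoC (INR (fact m)) * (divided_power x (m - k) * divided_power y k)) (seq 0 (S m)) = (x + y) ^ m).
  { intros x y m. rewrite Csum_scal, binomial_dpow. unfold divided_power. field. apply fact_C_neq_0. }
  (* The moduli in row m add up to exactly |g m| (|z0| + |h|)^m, again by the binomial theorem. *)
  assert (SG : abs_summable G).
  { destruct Hs as [N HN].
    apply abs_summable_tonelli with (R := fun m => Cmod (g m * RtoC (Cmod z0 + Cmod h) ^ m)) (N := N); auto.
    intros m M HM.
    apply Rle_trans with (Rsum (fun k => Cmod (G (m, k))) (seq 0 (S m))).
    - set (v := Rsum (fun k => Cmod (G (m, k))) (seq 0 (S m))).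
      apply (has_sum_ge (fun k => Cmod (G (m, k)))); auto. intros; apply Cmod_ge_0.
      unfold v. rewrite <- Csum_RtoC. apply has_sum_finite. apply seq_NoDup.
      intros k hk. rewrite G2, Cmod_0; auto. apply Nat.nle_gt. intros h'. apply hk, in_seq. lia.
    - right. apply RtoC_inj. rewrite <- Csum_RtoC.
      rewrite Cmod_mult, Cpow_RtoC, Cmod_R, Rabs_pos_eq, RtoC_mult, RtoC_pow, RtoC_plus.
      2: { apply pow_le. apply Rplus_le_le_0_compat; apply Cmod_ge_0. }
      rewrite <- rowsum, <- Csum_scal. apply Csum_ext. intros k hk. apply in_seq in hk.
      unfold G; simpl fst; simpl snd. destruct le_lt_dec; [|lia].
      rewrite !Cmod_mult, !RtoC_mult, !Cmod_dpow, Cmod_R, (Rabs_pos_eq (INR _)) by apply pos_INR. ring. }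
  assert (SF : abs_summable F).
  { apply abs_summable_ext with (fun p => G ((fst p + snd p)%nat, fst p)). intros [k j]; auto.
    apply (abs_summable_inj (fun p : nat * nat => ((fst p + snd p)%nat, fst p)) G); auto.
    intros [k j] [k' j'] h'. simpl in h'. inversion h'. f_equal. lia. }
  assert (HG : has_sum G (powser g (z0 + h))).
  { assert (T := abs_summable_has_sum G SG).
    replace (powser g (z0 + h)) with (tsum G); auto.
    symmetry. apply tsum_eq. apply (has_sum_fubini G _ _ T). intros m.
    rewrite <- (rowsum z0 h m), <- Csum_scal.
    rewrite (Csum_ext _ (fun k => G (m, k))).
    - apply (has_sum_finite (fun k => G (m, k))). apply seq_NoDup. intros k hk. apply G2.
      apply Nat.nle_gt. intros h'. apply hk, in_seq. lia.
    - intros k hk. apply in_seq in hk. unfold G; simpl fst; simpl snd. destruct le_lt_dec; [|lia]. ring. }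
  rewrite <- (antidiagonal_has_sum F G _ G1 G2) in HG.
  assert (E : forall i j, g (i + j)%nat * RtoC (INR (fact (i + j)) / (INR (fact i) * INR (fact j))) * z0 ^ i * h ^ j = F (j, i)).
  { intros i j. unfold F, divided_power; simpl fst; simpl snd. rewrite (Nat.add_comm j i).
    assert (N1 := INR_fact_neq_0 i). assert (N2 := INR_fact_neq_0 j).
    rewrite RtoC_div, RtoC_mult by (apply Rmult_integral_contrapositive; auto).
    field. split; apply fact_C_neq_0. }
  assert (R1 : forall j, abs_summable (fun i => F (j, i))) by (intros j; apply abs_summable_row; auto).
  assert (EE : forall j, tsum (fun i => g (i + j)%nat * RtoC (INR (fact (i + j)) / (INR (fact i) * INR (fact j))) * z0 ^ i * h ^ j) = tsum (fun i => F (j, i))).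
  { intros j. f_equal. apply functional_extensionality; intros i. auto. }
  split; [|split].
  - intros j. eapply abs_summable_ext; [|apply (R1 j)]. intros; auto.
  - apply abs_summable_le with (fun j => RtoC (tnorm (fun i => F (j, i)))).
    + intros j. rewrite EE, Cmod_R. eapply Rle_trans; [|apply Rle_abs]. apply tsum_le_tnorm; auto.
    + assert (T := tnorm_sum F SF). apply has_sum_abs_summable with (tnorm F).
      { intros j. eapply Rle_trans; [|apply (tsum_le_tnorm _ (R1 j))]. apply Cmod_ge_0. }
      apply (has_sum_fubini _ _ _ T). intros j. apply tnorm_sum; auto.
  - apply (has_sum_fubini F _ _ HG). intros j. rewrite EE. apply abs_summable_has_sum; auto.
Qed.

(** The power h^j is taken out of the sum by dividing by it, hence h <> 0; [taylor_expansion]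
    settles h = 0 separately. *)
Lemma taylor_terms (g : nat -> C) (z0 h : C) j :
  abs_summable (fun i => g (i + j)%nat * RtoC (INR (fact (i + j)) / (INR (fact i) * INR (fact j))) * z0 ^ i * h ^ j) ->
  h <> 0 ->
  tsum (fun i => g (i + j)%nat * RtoC (INR (fact (i + j)) / (INR (fact i) * INR (fact j))) * z0 ^ i * h ^ j)
  = taylor_coef g z0 j * h ^ j.
Proof.
  intros H Hh. assert (N := Cpow_nz h j Hh).
  assert (T := abs_summable_has_sum _ H). set (s := tsum _) in T |- *.
  replace s with ((/ h ^ j * s) * h ^ j) by (field; auto). f_equal. symmetry. apply tsum_eq.
  eapply has_sum_ext; [|apply (has_sum_scal (/ h ^ j) _ _ T)]. intros i. cbv beta. field; auto.
Qed.

Lemma taylor_expansion_nonzero (g : nat -> C) (z0 h : C) : subexp g -> (Cmod z0 + Cmod h < 1)%R ->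
  h <> 0 ->
  abs_summable (fun j => taylor_coef g z0 j * h ^ j) /\
  has_sum (fun j => taylor_coef g z0 j * h ^ j) (powser g (z0 + h)).
Proof.
  intros Hg Hh Hn.
  destruct (reexpansion g z0 h) as [R1 [R2 R3]].
  { apply subexp_summable; auto. rewrite Cmod_R, Rabs_pos_eq; auto.
    apply Rplus_le_le_0_compat; apply Cmod_ge_0. }
  split; [eapply abs_summable_ext; [|apply R2] | eapply has_sum_ext; [|apply R3]];
    intros j; cbv beta; apply taylor_terms; auto.
Qed.

(** * The binomial series as a complex power *)

Lemma binser_sum s z : (Cmod z < 1)%R -> has_sum (fun k => binc s k * z ^ k) (binser s z).
Proof. apply has_sum_bincZ. Qed.

Lemma binser_powser s z : (Cmod z < 1)%R -> powser (binc s) z = binser s z.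
Proof. intros H. apply tsum_eq, binser_sum; auto. Qed.

Lemma binser_mult s t z : (Cmod z < 1)%R -> binser s z * binser t z = binser (s + t) z.
Proof. apply tsum_bincZ_mult. Qed.

Lemma binser_exp_0 z : binser 0 z = 1.
Proof.
  apply tsum_eq. replace (RtoC 1) with (bincZ z 0 (Znonneg 0)) by (rewrite bincZ_nat, binc_0; simpl; ring).
  apply has_sum_single. intros k hk. destruct (Z_cases k) as [h|[j ->]]. apply bincZ_neg; auto.
  destruct j; [tauto|]. rewrite bincZ_nat. unfold binc.
  replace (RtoC 0) with (- RtoC (INR 0)) by (simpl; ring). rewrite pochhammer_vanish by lia.
  unfold Cdiv. simpl (INR 0). ring.
Qed.

Lemma binser_exp_m1 z : binser (RtoC (-1)) z = 1 - z.
Proof.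
  apply tsum_eq. replace (1 - z) with (Csum (bincZ z (RtoC (-1))) (Znonneg 0 :: Znonneg 1 :: nil)).
  - apply has_sum_finite.
    + constructor. simpl. unfold Znonneg; intros [h|h]; [lia|auto]. constructor; simpl; auto. constructor.
    + intros k hk. destruct (Z_cases k) as [h|[j ->]]. apply bincZ_neg; auto.
      destruct j as [|[|j]]; [simpl in hk; tauto.. |]. rewrite bincZ_nat. unfold binc.
      replace (RtoC (-1)) with (- RtoC (INR 1)) by (rewrite <- RtoC_opp; simpl; f_equal; ring). rewrite pochhammer_vanish by lia.
      unfold Cdiv. ring.
  - unfold Csum, fold_right. rewrite !bincZ_nat. unfold binc. simpl. field.
Qed.

Lemma binser_raise s z : (Cmod z < 1)%R -> binser (s + 1) z * (1 - z) = binser s z.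
Proof.
  intros H. rewrite <- binser_exp_m1, binser_mult by auto. f_equal. ring.
Qed.

Lemma one_minus_neq_0 z : (Cmod z < 1)%R -> 1 - z <> 0.
Proof.
  intros H E. assert (z = 1). { replace z with (1 - (1 - z)) by ring. rewrite E. ring. }
  subst. rewrite Cmod_1 in H. lra.
Qed.

Lemma binser_raise_n s z k : (Cmod z < 1)%R -> binser (s + RtoC (INR k)) z = binser s z / (1 - z) ^ k.
Proof.
  intros H. assert (N := one_minus_neq_0 z H). induction k.
  - simpl. rewrite Cplus_0_r. field.
  - rewrite S_INR, RtoC_plus, Cplus_assoc.
    replace (binser (s + RtoC (INR k) + 1) z) with (binser (s + RtoC (INR k) + 1) z * (1 - z) / (1 - z)) by (field; auto).
    rewrite binser_raise, IHk, Cpow_S by auto. field. split; auto. apply Cpow_nz; auto.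
Qed.

(** The exponent law makes [binser (- s) z] the inverse. *)
Lemma binser_neq_0 s z : (Cmod z < 1)%R -> binser s z <> 0.
Proof.
  intros H E. assert (T := binser_mult s (- s) z H). rewrite E in T.
  replace (s + - s) with (RtoC 0) in T by ring. rewrite binser_exp_0, Cmult_0_l in T.
  apply RtoC_inj in T. lra.
Qed.

Lemma binser_at_0 s : binser s 0 = 1.
Proof.
  apply tsum_eq. replace (RtoC 1) with (bincZ 0 s (Znonneg 0)) by (rewrite bincZ_nat, binc_0; simpl; ring).
  apply has_sum_single. intros k hk. destruct (Z_cases k) as [h|[j ->]]. apply bincZ_neg; auto.
  destruct j; [tauto|]. rewrite bincZ_nat. simpl. ring.
Qed.

Lemma pochhammer_add a j i : pochhammer a (j + i) = pochhammer a j * pochhammer (a + RtoC (INR j)) i.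
Proof.
  induction i. rewrite Nat.add_0_r. simpl. ring.
  rewrite Nat.add_succ_r. simpl. rewrite IHi, plus_INR, RtoC_plus. ring.
Qed.

(** The branch-free form of (1 - z - h)^(-s) = (1 - z)^(-s) (1 - h/(1 - z))^(-s). The Taylor
    coefficient at z is binc s j times (1 - z)^(-s-j), so the expansion is a binomial series in h/(1
    - z). *)
Lemma binser_translate s z h : (Cmod z + Cmod h < 1)%R ->
  binser s (z + h) = binser s z * binser s (h / (1 - z)).
Proof.
  intros H. assert (P1 := Cmod_ge_0 z). assert (P2 := Cmod_ge_0 h).
  assert (Hz : (Cmod z < 1)%R) by lra. assert (N := one_minus_neq_0 z Hz).
  destruct (Ceq_dec h 0) as [->|hn].
  { replace (0 / (1 - z)) with (RtoC 0) by (field; auto). rewrite binser_at_0, Cplus_0_r. ring. }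
  assert (Hd : (Cmod (h / (1 - z)) < 1)%R).
  { rewrite Cmod_div by auto. apply Rmult_lt_reg_r with (Cmod (1 - z)). apply Cmod_gt_0; auto.
    unfold Rdiv. rewrite Rmult_assoc, Rinv_l, Rmult_1_l, Rmult_1_r.
    - assert (T := Cmod_triangle (1 - z) z). replace (1 - z + z) with (RtoC 1) in T by ring.
      rewrite Cmod_1 in T. lra.
    - intros E. apply N, Cmod_eq_0; auto. }
  destruct (taylor_expansion_nonzero (binc s) z h (subexp_binc s) H hn) as [_ T].
  assert (Hzh : (Cmod (z + h) < 1)%R) by (eapply Rle_lt_trans; [apply Cmod_triangle | auto]).
  rewrite binser_powser in T by auto.
  apply (has_sum_unique _ _ _ T).
  eapply has_sum_ext; [|apply (has_sum_scal (binser s z) _ _ (binser_sum s (h / (1 - z)) Hd))].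
  intros j. cbv beta.
  assert (E : taylor_coef (binc s) z j = binc s j * binser (s + RtoC (INR j)) z).
  { apply tsum_eq. eapply has_sum_ext; [|apply (has_sum_scal (binc s j) _ _ (binser_sum (s + RtoC (INR j)) z Hz))].
    intros i. cbv beta. unfold binc. rewrite (Nat.add_comm i j), pochhammer_add.
    assert (N1 := INR_fact_neq_0 i). assert (N2 := INR_fact_neq_0 j).
    rewrite RtoC_div, RtoC_mult by (apply Rmult_integral_contrapositive; auto).
    field. repeat split; apply fact_C_neq_0. }
  rewrite E, binser_raise_n by auto. unfold Cdiv. rewrite Cpow_mult_l, Cpow_inv by auto. field. apply Cpow_nz; auto.
Qed.

Lemma Cmod_pochhammer s k : (Cmod (pochhammer s k) <= Cmod (pochhammer (RtoC (Cmod s)) k))%R.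
Proof.
  induction k; simpl. lra. rewrite !Cmod_mult. apply Rmult_le_compat; auto using Cmod_ge_0.
  rewrite <- RtoC_plus, Cmod_R, Rabs_pos_eq.
  - eapply Rle_trans; [apply Cmod_triangle|]. rewrite Cmod_R, Rabs_pos_eq; [lra | apply pos_INR].
  - apply Rplus_le_le_0_compat. apply Cmod_ge_0. apply pos_INR.
Qed.

Lemma pochhammer_pos (p : R) k : (0 <= p)%R -> exists y, (0 <= y)%R /\ pochhammer (RtoC p) k = RtoC y.
Proof.
  intros Hp. induction k as [|k [y [Hy E]]]; simpl.
  - exists 1%R. split; [lra|auto].
  - exists (y * (p + INR k))%R. rewrite E, RtoC_mult, RtoC_plus. split; auto.
    apply Rmult_le_pos; auto. apply Rplus_le_le_0_compat; auto. apply pos_INR.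
Qed.

Lemma pochhammer_mono p p' k : (0 <= p <= p')%R ->
  (Cmod (pochhammer (RtoC p) k) <= Cmod (pochhammer (RtoC p') k))%R.
Proof.
  intros H. induction k; simpl. lra. rewrite !Cmod_mult. apply Rmult_le_compat; auto using Cmod_ge_0.
  assert (P := pos_INR k). rewrite <- !RtoC_plus, !Cmod_R, !Rabs_pos_eq; lra.
Qed.

Lemma binc_Cmod_sum p (r : R) : (0 <= p)%R -> (0 <= r < 1)%R ->
  has_sum (fun k => RtoC (Cmod (binc (RtoC p) k * RtoC r ^ k))) (binser (RtoC p) (RtoC r)).
Proof.
  intros Hp Hr. eapply has_sum_ext; [|apply binser_sum; rewrite Cmod_R, Rabs_pos_eq; lra].
  intros k. cbv beta. unfold binc. destruct (pochhammer_pos p k Hp) as [y [Hy ->]].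
  rewrite Cpow_RtoC, <- RtoC_div, <- RtoC_mult by apply INR_fact_neq_0.
  rewrite Cmod_R, Rabs_pos_eq; auto. apply Rmult_le_pos; [|apply pow_le; lra].
  apply Rmult_le_pos; auto. left; apply Rinv_0_lt_compat, INR_fact_lt_0.
Qed.

(* [pfaff_coef a g] are the coefficients of (1-u)^(-a) g(u/(1-u)). *)
Lemma pfaff_expansion (a : C) (g : nat -> C) (u T : C) : (Cmod u < 1)%R ->
  abs_summable (fun k => g k * RtoC (Cmod u / (1 - Cmod u)) ^ k) ->
  has_sum (fun k => g k * (u / (1 - u)) ^ k) T ->
  has_sum (fun m => pfaff_coef a g m * u ^ m) (binser a u * T).
Proof.
  intros Hu [N HN] HT. assert (P := Cmod_ge_0 u). assert (N1 := one_minus_neq_0 u Hu).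
  set (r := Cmod u) in *.
  set (F := fun p : nat * nat => g (fst p) * u ^ (fst p) * (binc (a + RtoC (INR (fst p))) (snd p) * u ^ (snd p))).
  assert (Hrr : (Cmod (RtoC r) < 1)%R) by (rewrite Cmod_R, Rabs_pos_eq; auto).
  set (p := Cmod a). assert (Hp : (0 <= p)%R) by apply Cmod_ge_0.
  assert (Hbeta : exists beta, binser (RtoC p) (RtoC r) = RtoC beta /\ (0 <= beta)%R).
  { assert (S := binc_Cmod_sum p r Hp ltac:(lra)).
    destruct (has_sum_nonneg (fun k => Cmod (binc (RtoC p) k * RtoC r ^ k)) (tnorm (fun k => binc (RtoC p) k * RtoC r ^ k))) as [b Hb].
    - intros; apply Cmod_ge_0.
    - intros L HL. apply Rsum_le_tnorm; auto. apply subexp_summable; auto. apply subexp_binc.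
    - exists b. split. apply (has_sum_unique _ _ _ S Hb).
      apply (has_sum_ge _ _ nil (fun k => Cmod_ge_0 (binc (RtoC p) k * RtoC r ^ k)) Hb). constructor. }
  destruct Hbeta as [beta [Hbeta Hb0]].
  assert (SF : abs_summable F).
  (* Replacing a by p = |a| majorizes row k by the nonnegative series (1 - r)^(-p-k), which leaves
     beta |g k| (r/(1 - r))^k. *)
  { apply abs_summable_tonelli with (R := fun k => (beta * Cmod (g k * RtoC (r / (1 - r)) ^ k))%R) (N := (beta * N)%R).
    - intros k M HM.
      assert (Hpk : (0 <= p + INR k)%R) by (assert (h := pos_INR k); lra).
      assert (S := binc_Cmod_sum (p + INR k) r Hpk ltac:(lra)).
      rewrite RtoC_plus, binser_raise_n, Hbeta in S by auto.
      assert (r1 : (0 < (1 - r) ^ k)%R) by (apply pow_lt; lra).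
      rewrite <- RtoC_minus, Cpow_RtoC, <- RtoC_div in S by lra.
      assert (B := has_sum_ge _ _ M (fun j => Cmod_ge_0 _) S HM).
      apply Rle_trans with (Rsum (fun j => (Cmod (g k) * r ^ k) * Cmod (binc (RtoC p + RtoC (INR k)) j * RtoC r ^ j))%R M).
      + apply Rsum_le. intros j _. unfold F; simpl fst; simpl snd. rewrite (Cmod_mult (_ * _)).
        rewrite Cmod_mult, Cmod_pow. apply Rmult_le_compat_l.
        { apply Rmult_le_pos. apply Cmod_ge_0. apply pow_le; auto. }
        rewrite !Cmod_mult, !Cmod_pow, (Cmod_R r), (Rabs_pos_eq r) by auto.
        apply Rmult_le_compat_r. apply pow_le; auto.
        unfold binc. rewrite !Cmod_div by apply fact_C_neq_0.
        apply Rmult_le_compat_r. left; apply Rinv_0_lt_compat, Cmod_gt_0, fact_C_neq_0.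
        eapply Rle_trans; [apply Cmod_pochhammer|]. rewrite <- RtoC_plus. apply pochhammer_mono.
        split. apply Cmod_ge_0. eapply Rle_trans; [apply Cmod_triangle|].
        rewrite Cmod_R, Rabs_pos_eq by apply pos_INR. unfold p; lra.
      + rewrite Rsum_scal.
        apply Rle_trans with ((Cmod (g k) * r ^ k) * (beta / (1 - r) ^ k))%R.
        * apply Rmult_le_compat_l; auto. apply Rmult_le_pos. apply Cmod_ge_0. apply pow_le; auto.
        * rewrite Cmod_mult, Cpow_RtoC, Cmod_R, Rabs_pos_eq.
          right. unfold Rdiv. rewrite Rpow_mult_distr, pow_inv. ring.
          apply pow_le. apply Rmult_le_pos; auto. left; apply Rinv_0_lt_compat; lra.
    - intros K HK. rewrite Rsum_scal. apply Rmult_le_compat_l; auto. }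
  assert (SS := abs_summable_has_sum F SF).
  assert (E : tsum F = binser a u * T).
  { refine (has_sum_unique _ _ _ (has_sum_fubini F (fun k => binser a u * (g k * (u / (1 - u)) ^ k)) _ SS _)
      (has_sum_scal _ _ _ HT)).
    intros k. assert (B := binser_sum (a + RtoC (INR k)) u Hu).
    rewrite binser_raise_n in B by auto.
    replace (binser a u * (g k * (u / (1 - u)) ^ k)) with (g k * u ^ k * (binser a u / (1 - u) ^ k)).
    exact (has_sum_scal (g k * u ^ k) _ _ B).
    unfold Cdiv. rewrite Cpow_mult_l, Cpow_inv by auto. ring. }
  rewrite <- E. eapply has_sum_ext; [|apply (antidiagonal_sum F _ SS)].
  intros m. cbv beta. unfold pfaff_coef. rewrite (Cmult_comm _ (u ^ m)), <- Csum_scal.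
  apply Csum_ext. intros k hk. apply in_seq in hk. unfold F; simpl fst; simpl snd.
  assert (Em : u ^ m = u ^ k * u ^ (m - k)) by (rewrite <- Cpow_add_r; f_equal; lia).
  rewrite Em. ring.
Qed.
End PowerSeries.

(** * Pfaff's transformation and the analytic continuation of 2F1 *)

(** Taylor coefficients of 2F1(a, c - b; c; z)/Gamma(c), regularized in the same way as
    [hyp2F1reg_coef]. *)
Definition pfaff_term (a b c : C) (k : nat) : C :=
  Cmult (binc a k) (Cmult (pochhammer (Cminus c b) k) (rGamma (Cplus c (RtoC (INR k))))).

Section Hypergeometric.
Open Scope C_scope.

(** The Pochhammer symbol alone grows factorially; the product has successive ratio r (s + k)/(c +
    k). Expressing 1/Gamma(c + k) through 1/Gamma(c + k + 1) avoids dividing by c + k, which may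
    vanish. *)
Lemma subexp_pochhammer_rGamma s c : subexp (fun k => pochhammer s k * rGamma (c + RtoC (INR k))).
Proof.
  intros r Hr. assert (P := Cmod_ge_0 s). assert (Q := Cmod_ge_0 c).
  destruct (nfloor_ex ((Cmod s + Cmod c) / (1 - r))) as [N [_ HN]].
  { apply Rmult_le_pos. lra. left; apply Rinv_0_lt_compat; lra. }
  apply eventually_nonincr_bounded with (S N). intros k Hk.
  apply le_INR in Hk. rewrite S_INR in Hk. assert (Pk := pos_INR k).
  assert (T2 : (Cmod s + Cmod c < (1 - r) * (INR k))%R).
  { apply Rmult_lt_reg_r with (/ (1 - r))%R. apply Rinv_0_lt_compat; lra.
    replace ((1 - r) * INR k * / (1 - r))%R with (INR k) by (field; lra).
    unfold Rdiv in HN. lra. }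
  assert (T : (Cmod (s + RtoC (INR k)) <= Cmod s + INR k)%R).
  { eapply Rle_trans; [apply Cmod_triangle|]. rewrite Cmod_R, Rabs_pos_eq; lra. }
  assert (T' : (INR k - Cmod c <= Cmod (c + RtoC (INR k)))%R).
  { assert (h := Cmod_triangle (c + RtoC (INR k)) (- c)). rewrite Cmod_opp in h.
    replace (c + RtoC (INR k) + - c) with (RtoC (INR k)) in h by ring. rewrite Cmod_R, Rabs_pos_eq in h; lra. }
  rewrite (rGamma_step (c + RtoC (INR k))). rewrite S_INR, RtoC_plus, Cplus_assoc. simpl pochhammer.
  rewrite !Cmod_mult. simpl pow.
  set (p := Cmod (pochhammer s k)). set (g := Cmod (rGamma _)).
  replace (p * Cmod (s + RtoC (INR k)) * g * (r * r ^ k))%R with ((p * g * r ^ k) * (Cmod (s + RtoC (INR k)) * r))%R by ring.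
  replace (p * (Cmod (c + RtoC (INR k)) * g) * r ^ k)%R with ((p * g * r ^ k) * Cmod (c + RtoC (INR k)))%R by ring.
  apply Rmult_le_compat_l.
  - apply Rmult_le_pos; [apply Rmult_le_pos; apply Cmod_ge_0 | apply pow_le; lra].
  - assert (0 <= Cmod (s + RtoC (INR k)))%R by apply Cmod_ge_0. nra.
Qed.

Lemma subexp_pfaff_term a b c : subexp (pfaff_term a b c).
Proof. apply subexp_mult. apply subexp_binc. apply subexp_pochhammer_rGamma. Qed.

(** Induction on m: multiplying by m + 1 = (m + 1 - k) + k reduces to the parameters (s, c) and (s +
    1, c + 1). Keeping 1/Gamma(c + k) in the summand covers nonpositive integers c too. *)
Lemma chu_vandermonde m : forall s c,
  Csum (fun k => (RtoC (-1)) ^ k / (RtoC (INR (fact k)) * RtoC (INR (fact (m - k)))) *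
    (pochhammer s k * rGamma (c + RtoC (INR k)))) (seq 0 (S m))
  = pochhammer (c - s) m * rGamma (c + RtoC (INR m)) / RtoC (INR (fact m)).
Proof.
  induction m as [|m IH]; intros s c.
  - simpl. field.
  - assert (n : RtoC (INR (S m)) <> 0) by (apply RtoC_neq, not_0_INR; lia).
    set (t := fun k => pochhammer s k * rGamma (c + RtoC (INR k))).
    set (w := fun m k => (RtoC (-1)) ^ k / (RtoC (INR (fact k)) * RtoC (INR (fact (m - k))))).
    assert (E : RtoC (INR (S m)) * Csum (fun k => w (S m) k * t k) (seq 0 (S (S m))) =
      Csum (fun k => w m k * t k) (seq 0 (S m))
      - s * Csum (fun k => w m k * (pochhammer (s + 1) k * rGamma (c + 1 + RtoC (INR k)))) (seq 0 (S m))).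
    { rewrite <- Csum_scal.
      rewrite (Csum_ext _ (fun k => RtoC (INR (S m - k)) * w (S m) k * t k
          + RtoC (INR k) * w (S m) k * t k)).
      2: { intros k hk. apply in_seq in hk. rewrite INR_C_minus by lia. ring. }
      rewrite Csum_plus, Csum_seq_last, (Csum_seq_first (fun k => RtoC (INR k) * w (S m) k * t k)).
      rewrite Nat.sub_diag. simpl (INR 0).
      rewrite (Csum_ext _ (fun k => w m k * t k) (seq 0 (S m))).
      2: { intros k hk. apply in_seq in hk. unfold w. replace (S m - k)%nat with (S (m - k)) by lia.
           assert (n' : RtoC (INR (S (m - k))) <> 0) by (apply RtoC_neq, not_0_INR; lia).
           rewrite (fact_simpl (m - k)), mult_INR, RtoC_mult. field. auto using fact_C_neq_0. }
      rewrite (Csum_ext (fun k => RtoC (INR (S k)) * w (S m) (S k) * t (S k))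
         (fun k => - s * (w m k * (pochhammer (s + 1) k * rGamma (c + 1 + RtoC (INR k))))) (seq 0 (S m))).
      2: { intros k hk. unfold w, t. simpl (S m - S k)%nat.
           assert (n' : RtoC (INR (S k)) <> 0) by (apply RtoC_neq, not_0_INR; lia).
           rewrite pochhammer_S_l, (fact_simpl k), mult_INR, RtoC_mult, Cpow_S.
           replace (c + RtoC (INR (S k))) with (c + 1 + RtoC (INR k)) by (rewrite S_INR, RtoC_plus; ring).
           field. auto using fact_C_neq_0. }
      rewrite Csum_scal. ring. }
    assert (I1 := IH s c). assert (I2 := IH (s + 1) (c + 1)).
    change (Csum (fun k => w m k * t k) (seq 0 (S m)) = pochhammer (c - s) m * rGamma (c + RtoC (INR m)) / RtoC (INR (fact m))) in I1.
    change (Csum (fun k => w m k * (pochhammer (s + 1) k * rGamma (c + 1 + RtoC (INR k)))) (seq 0 (S m))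
      = pochhammer (c + 1 - (s + 1)) m * rGamma (c + 1 + RtoC (INR m)) / RtoC (INR (fact m))) in I2.
    rewrite I1, I2 in E.
    change (Csum (fun k => w (S m) k * t k) (seq 0 (S (S m))) =
      pochhammer (c - s) (S m) * rGamma (c + RtoC (INR (S m))) / RtoC (INR (fact (S m)))).
    replace (Csum (fun k => w (S m) k * t k) (seq 0 (S (S m)))) with
      (/ RtoC (INR (S m)) * (RtoC (INR (S m)) * Csum (fun k => w (S m) k * t k) (seq 0 (S (S m))))) by (field; auto).
    rewrite E. replace (c + 1 - (s + 1)) with (c - s) by ring.
    rewrite (rGamma_step (c + RtoC (INR m))).
    rewrite (fact_simpl m), mult_INR, RtoC_mult. simpl pochhammer.
    replace (c + RtoC (INR (S m))) with (c + 1 + RtoC (INR m)) by (rewrite S_INR, RtoC_plus; ring).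
    replace (c + RtoC (INR m) + 1) with (c + 1 + RtoC (INR m)) by ring.
    field. auto using fact_C_neq_0.
Qed.

(** Pfaff's transformation as an identity of power series at 0: the signs (-1)^k turn the argument
    u/(1 - u) of [pfaff_coef] into u/(u - 1). *)
Lemma pfaff_coef_hyp a b c m :
  pfaff_coef a (fun k => pfaff_term a b c k * (RtoC (-1)) ^ k) m = hyp2F1reg_coef a b c m.
Proof.
  unfold pfaff_coef, hyp2F1reg_coef.
  assert (V := chu_vandermonde m (c - b) c). replace (c - (c - b)) with b in V by ring.
  transitivity (pochhammer a m * (pochhammer b m * rGamma (c + RtoC (INR m)) / RtoC (INR (fact m)))).
  2: { field. apply fact_C_neq_0. }
  rewrite <- V, <- Csum_scal. apply Csum_ext. intros k hk. apply in_seq in hk.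
  unfold pfaff_term, binc. replace m with (k + (m - k))%nat at 3 by lia. rewrite pochhammer_add.
  field. auto using fact_C_neq_0.
Qed.

Lemma taylor_coef_0 g z0 : (Cmod z0 < 1)%R -> taylor_coef g z0 0 = powser g z0.
Proof.
  intros H. unfold taylor_coef, powser. f_equal. apply functional_extensionality. intros i.
  rewrite Nat.add_0_r. simpl (fact 0). replace (INR 1) with 1%R by auto.
  replace (INR (fact i) / (INR (fact i) * 1))%R with 1%R by (field; apply INR_fact_neq_0). ring.
Qed.

Lemma taylor_coef_at_0 g j : taylor_coef g 0 j = g j.
Proof.
  unfold taylor_coef. apply tsum_eq.
  replace (g j) with (g (0 + j)%nat * RtoC (INR (fact (0 + j)) / (INR (fact 0) * INR (fact j))) * 0 ^ 0).
  - apply (has_sum_single (fun i => g (i + j)%nat * RtoC (INR (fact (i + j)) / (INR (fact i) * INR (fact j))) * 0 ^ i)).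
    intros [|i] hi; [tauto|]. simpl. ring.
  - simpl (0 + j)%nat. simpl (fact 0). replace (INR 1) with 1%R by auto.
    replace (INR (fact j) / (1 * INR (fact j)))%R with 1%R by (field; apply INR_fact_neq_0). simpl. ring.
Qed.

Lemma has_sum_at_0 (u : nat -> C) : has_sum (fun k => u k * 0 ^ k) (u O).
Proof.
  replace (u O) with (u O * 0 ^ 0) by (simpl; ring).
  apply (has_sum_single (fun k => u k * 0 ^ k)). intros [|k] hk; [tauto | simpl; ring].
Qed.

Lemma taylor_expansion (g : nat -> C) (z0 h : C) : subexp g -> (Cmod z0 + Cmod h < 1)%R ->
  abs_summable (fun j => taylor_coef g z0 j * h ^ j) /\
  has_sum (fun j => taylor_coef g z0 j * h ^ j) (powser g (z0 + h)).
Proof.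
  intros Hg Hh. destruct (Ceq_dec h 0) as [->|hn].
  - rewrite Cmod_0, Rplus_0_r in Hh. split.
    + set (t := ((1 - Cmod z0) / 2)%R).
      assert (Pt : (0 < t)%R) by (unfold t; lra).
      destruct (taylor_expansion_nonzero g z0 (RtoC t) Hg) as [A _].
      { rewrite Cmod_R, Rabs_pos_eq; unfold t; lra. }
      { apply RtoC_neq. lra. }
      apply abs_summable_le with (2 := A). intros j. rewrite !Cmod_mult. apply Rmult_le_compat_l.
      apply Cmod_ge_0. rewrite !Cmod_pow, Cmod_0, Cmod_R. apply pow_incr. split. lra. apply Rabs_pos.
    + rewrite Cplus_0_r, <- (taylor_coef_0 g z0 Hh). apply has_sum_at_0.
  - apply taylor_expansion_nonzero; auto.
Qed.

(** * Power series at a point and uniqueness of continuation *)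

Lemma scal_pow_n (z w : C) k : @scal C_Ring C_ModuleSpace (@pow_n C_Ring z k) w = w * z ^ k.
Proof.
  replace (@pow_n C_Ring z k) with (z ^ k). change (z ^ k * w = w * z ^ k). ring.
  induction k; [reflexivity|]. rewrite Cpow_S, IHk. reflexivity.
Qed.

Lemma is_pseries_C (u : nat -> C) (z s : C) :
  @is_pseries C_AbsRing C_NormedModule u z s <->
  @is_series C_AbsRing C_NormedModule (fun k => u k * z ^ k) s.
Proof.
  unfold is_pseries. split; intros H; eapply is_series_ext; try exact H; intros k.
  - apply scal_pow_n.
  - symmetry. apply scal_pow_n.
Qed.

Lemma has_sum_is_pseries (u : nat -> C) z s :
  has_sum (fun k => u k * z ^ k) s -> @is_pseries C_AbsRing C_NormedModule u z s.
Proof. intros H. apply is_pseries_C, has_sum_is_series, H. Qed.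

Lemma bounded_of_eventually (v : nat -> R) N M : (forall n, (N <= n)%nat -> (v n <= M)%R) ->
  exists M', forall n, (v n <= M')%R.
Proof.
  intros H. induction N as [|N IH].
  - exists M. intros; apply H; lia.
  - destruct (Rle_dec (v N) M) as [h|h].
    + apply IH. intros n hn. destruct (Nat.eq_dec n N) as [->|]; auto. apply H; lia.
    + destruct (eventually_nonincr_bounded (fun k => Rmax M (Rmax (v k) M)) (S N)) as [M' HM'].
      { intros k hk. rewrite (Rmax_right (v (S k))), (Rmax_right (v k)); try (apply H; lia). lra. }
      exists M'. intros n. eapply Rle_trans; [|apply HM'].
      eapply Rle_trans; [|apply Rmax_r]. apply Rmax_l.
Qed.

(* Coquelicot's convergence is conditional; inside the disc it is absolute. *)
Lemma pseries_has_sum (u : nat -> C) (F : C -> C) rho :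
  (forall h, (Cmod h < rho)%R -> @is_pseries C_AbsRing C_NormedModule u h (F h)) ->
  forall h, (Cmod h < rho)%R -> abs_summable (fun k => u k * h ^ k) /\ has_sum (fun k => u k * h ^ k) (F h).
Proof.
  intros H h Hh. assert (P := Cmod_ge_0 h).
  assert (A : abs_summable (fun k => u k * h ^ k)).
  { set (r := ((Cmod h + rho) / 2)%R). assert (Pr : (0 < r)%R) by (unfold r; lra).
    assert (Hr := H (RtoC r)). rewrite Cmod_R, Rabs_pos_eq in Hr by lra.
    specialize (Hr ltac:(unfold r; lra)). apply is_pseries_C in Hr. rewrite is_series_C_iff in Hr.
    destruct (Hr 1%R ltac:(lra)) as [N HN].
    destruct (bounded_of_eventually (fun n => Cmod (u n * RtoC r ^ n)) (S N) 2) as [M HM].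
    { intros n hn. destruct n as [|n]; [lia|].
      assert (h1 := HN n ltac:(lia)). assert (h2 := HN (S n) ltac:(lia)).
      rewrite (Csum_seq_last _ (S n)) in h2.
      set (p := Csum _ _) in *. set (s := F (RtoC r)) in *. set (q := u (S n) * RtoC r ^ S n) in *.
      assert (T := Cmod_triangle (p + q - s) (- (p - s))). rewrite Cmod_opp in T.
      replace (p + q - s + - (p - s)) with q in T by ring. lra. }
    apply abs_summable_le with (fun k => RtoC (M * (Cmod h / r) ^ k)).
    - intros k. specialize (HM k). rewrite Cmod_mult, Cmod_pow, Cmod_R, Rabs_pos_eq in HM by lra.
      rewrite Cmod_mult, Cmod_pow, Cmod_R.
      assert (rk : (0 < r ^ k)%R) by (apply pow_lt; lra).
      assert (hk : (0 <= Cmod h ^ k)%R) by (apply pow_le; auto).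
      assert (uk := Cmod_ge_0 (u k)).
      eapply Rle_trans; [|apply Rle_abs].
      unfold Rdiv. rewrite Rpow_mult_distr, pow_inv.
      replace (Cmod (u k) * Cmod h ^ k)%R with (Cmod (u k) * r ^ k * (Cmod h ^ k * / r ^ k))%R by (field; lra).
      apply Rmult_le_compat_r; auto. apply Rmult_le_pos; auto. left; apply Rinv_0_lt_compat; auto.
    - apply abs_summable_geom. split. apply Rmult_le_pos; auto. left; apply Rinv_0_lt_compat; auto.
      apply Rmult_lt_reg_r with r; auto. unfold Rdiv. rewrite Rmult_assoc, Rinv_l by lra. unfold r; lra. }
  split; auto. apply is_series_has_sum; auto. apply is_pseries_C; auto.
Qed.

Lemma has_sum_nat_tail (v : nat -> C) s : has_sum v s -> has_sum (fun k => v (S k)) (s - v O).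
Proof.
  intros H.
  assert (D : has_sum (fun k => match k with O => v O | _ => 0 end) (v O)).
  { apply (has_sum_single (fun k => match k with O => v O | _ => RtoC 0 end) O). intros [|k] hk; tauto. }
  apply (has_sum_inj S (fun k => match k with O => 0 | _ => v k end)).
  - intros; lia.
  - intros [|k] hk; auto. destruct (hk k); auto.
  - eapply has_sum_ext; [|apply (has_sum_minus _ _ _ _ H D)]. intros [|k]; cbv beta; ring.
Qed.

(** Zeros accumulate at the centre. If the coefficients below k vanish, dividing by h^k at a zero h
    gives |u k| <= M |h| / r^(k+1), and |h| can be taken arbitrarily small. *)
Lemma power_series_zero (u : nat -> C) (F : C -> C) rho : (0 < rho)%R ->
  (forall h, (Cmod h < rho)%R -> abs_summable (fun k => u k * h ^ k) /\ has_sum (fun k => u k * h ^ k) (F h)) ->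
  (forall d, (0 < d)%R -> exists h, (0 < Cmod h < d)%R /\ F h = 0) -> forall k, u k = 0.
Proof.
  intros Hr H Hz k. induction k as [k IH] using (well_founded_induction lt_wf).
  set (r := (rho / 2)%R).
  assert (Hrr : (Cmod (RtoC r) < rho)%R) by (rewrite Cmod_R, Rabs_pos_eq; unfold r; lra).
  destruct (H (RtoC r) Hrr) as [A _].
  set (M := tnorm (fun j => u j * RtoC r ^ j)).
  assert (rk : (0 < r ^ S k)%R) by (apply pow_lt; unfold r; lra).
  destruct (Ceq_dec (u k) 0) as [|Hn]; auto. exfalso.
  assert (Pu : (0 < Cmod (u k))%R) by (apply Cmod_gt_0; auto).
  assert (PM : (0 <= M)%R) by (apply (Rsum_le_tnorm _ nil A); constructor).
  destruct (Hz (Rmin r (Cmod (u k) * r ^ S k / (M + 1)))%R) as [h [[h1 h2] h3]].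
  { apply Rmin_pos. unfold r; lra. apply Rdiv_lt_0_compat; [apply Rmult_lt_0_compat; auto | lra]. }
  assert (hr : (Cmod h < r)%R) by (eapply Rlt_le_trans; [apply h2 | apply Rmin_l]).
  assert (hM : (Cmod h < Cmod (u k) * r ^ S k / (M + 1))%R) by (eapply Rlt_le_trans; [apply h2 | apply Rmin_r]).
  assert (hne : h <> 0) by (apply Cmod_gt_0; auto).
  destruct (H h ltac:(unfold r in *; lra)) as [Ah Sh]. rewrite h3 in Sh.
  assert (hk : h ^ k <> 0) by (apply Cpow_nz; auto).
  assert (S1 : has_sum (fun j => u (j + k)%nat * h ^ j) 0).
  { apply (has_sum_inj (fun j => (j + k)%nat) (fun j => u j * h ^ j)) in Sh.
    - replace (RtoC 0) with (/ h ^ k * 0) by ring.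
      eapply has_sum_ext; [|apply (has_sum_scal _ _ _ Sh)]. intros j. cbv beta. rewrite Cpow_add_r. field; auto.
    - intros; lia.
    - intros j hj. destruct (Nat.lt_ge_cases j k). rewrite IH by auto. ring.
      destruct (hj (j - k)%nat). lia. }
  assert (S2 := has_sum_nat_tail _ _ S1). cbv beta in S2.
  replace (0 - u (0 + k)%nat * h ^ 0) with (- u k) in S2 by (simpl; ring).
  assert (B : (Cmod (- u k) <= Cmod h * / r ^ S k * M)%R).
  { apply (has_sum_Cmod_le _ _ _ S2). intros L HL.
    apply Rle_trans with (Rsum (fun j => (Cmod h * / r ^ S k) * Cmod (u (S j + k)%nat * RtoC r ^ (S j + k)))%R L).
    - apply Rsum_le. intros j _. rewrite !Cmod_mult, !Cmod_pow, Cmod_R, Rabs_pos_eq by (unfold r; lra).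
      replace (Cmod h * / r ^ S k * (Cmod (u (S j + k)%nat) * r ^ (S j + k)))%R with
        (Cmod (u (S j + k)%nat) * (Cmod h * r ^ j))%R.
      + apply Rmult_le_compat_l. apply Cmod_ge_0. simpl. apply Rmult_le_compat_l. lra. apply pow_incr; lra.
      + replace (S j + k)%nat with (j + S k)%nat at 3 by lia. rewrite pow_add. field. assert (0 < r)%R by (unfold r; lra); lra.
    - rewrite Rsum_scal. apply Rmult_le_compat_l.
      + apply Rmult_le_pos. lra. left; apply Rinv_0_lt_compat; auto.
      + rewrite <- (Rsum_map (fun j => (S j + k)%nat) (fun j => Cmod (u j * RtoC r ^ j))).
        apply Rsum_le_tnorm; auto. apply FinFun.Injective_map_NoDup; auto. intros x y; lia. }
  rewrite Cmod_opp in B.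
  assert (hM2 : (Cmod h * (M + 1) < Cmod (u k) * r ^ S k)%R).
  { apply Rlt_le_trans with (Cmod (u k) * r ^ S k / (M + 1) * (M + 1))%R.
    apply Rmult_lt_compat_r; lra. right; field; lra. }
  assert (B2 : (Cmod (u k) * r ^ S k <= Cmod h * M)%R).
  { apply Rle_trans with (Cmod h * / r ^ S k * M * r ^ S k)%R. apply Rmult_le_compat_r; lra.
    right. field. assert (0 < r)%R by (unfold r; lra); lra. }
  nra.
Qed.

(* The t in [0,1] such that the two continuations agree on [0,t] z form an open and
   closed subset: at its supremum the local power series of the difference vanishes. *)
Lemma continuation_unique (co : nat -> C) z Om1 f1 Om2 f2 :
  star_shaped Om1 -> star_shaped Om2 -> Om1 z -> Om2 z -> analytic_on Om1 f1 -> analytic_on Om2 f2 ->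
  (exists rho, (0 < rho)%R /\ has_power_series_on_disc f1 (RtoC 0) rho co) ->
  (exists rho, (0 < rho)%R /\ has_power_series_on_disc f2 (RtoC 0) rho co) -> f1 z = f2 z.
Proof.
  intros St1 St2 O1 O2 A1 A2 [r1 [R1 P1]] [r2 [R2 P2]].
  assert (E0 : forall w, (Cmod w < Rmin r1 r2)%R -> f1 w = f2 w).
  { intros w Hw.
    assert (C1 := pseries_has_sum co f1 r1). assert (C2 := pseries_has_sum co f2 r2).
    destruct (C1) with (h := w) as [_ S1].
    { intros h Hh. specialize (P1 h). replace (h - 0) with h in P1 by ring. auto. }
    { eapply Rlt_le_trans; [apply Hw | apply Rmin_l]. }
    destruct (C2) with (h := w) as [_ S2].
    { intros h Hh. specialize (P2 h). replace (h - 0) with h in P2 by ring. auto. }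
    { eapply Rlt_le_trans; [apply Hw | apply Rmin_r]. }
    apply (has_sum_unique _ _ _ S1 S2). }
  (* For z = 0 the segment is a point and gives no accumulating zeros, but the two series at the
     origin already agree. *)
  destruct (Ceq_dec z 0) as [->|Hz].
  { apply E0. rewrite Cmod_0. apply Rmin_pos; auto. }
  assert (Pz : (0 < Cmod z)%R) by (apply Cmod_gt_0; auto).
  set (E := fun t => f1 (RtoC t * z) = f2 (RtoC t * z)).
  set (S := fun t => (0 <= t <= 1)%R /\ forall tau, (0 <= tau <= t)%R -> E tau).
  assert (CS : forall x t, Cmod (RtoC x * z - RtoC t * z) = (Rabs (x - t) * Cmod z)%R).
  { intros x t. replace (RtoC x * z - RtoC t * z) with (RtoC (x - t) * z) by (rewrite RtoC_minus; ring).
    rewrite Cmod_mult, Cmod_R. auto. }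
  destruct (completeness S) as [T [Tub Tlub]].
  { exists 1%R. intros t [h _]. lra. }
  { exists 0%R. split. lra. intros tau h. apply E0. rewrite Cmod_mult, Cmod_R.
    replace tau with 0%R by lra. rewrite Rabs_R0, Rmult_0_l. apply Rmin_pos; auto. }
  assert (T0 : (0 <= T)%R).
  { apply Tub. split. lra. intros tau h. apply E0. rewrite Cmod_mult, Cmod_R.
    replace tau with 0%R by lra. rewrite Rabs_R0, Rmult_0_l. apply Rmin_pos; auto. }
  assert (T1 : (T <= 1)%R). { apply Tlub. intros t [h _]. lra. }
  assert (Tlt : forall tau, (0 <= tau < T)%R -> E tau).
  { intros tau h. apply NNPP. intros hn. assert (T <= tau)%R; [|lra]. apply Tlub.
    intros t [ht1 ht2]. apply Rnot_lt_le. intros hl. apply hn, ht2. lra. }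
  set (w0 := RtoC T * z).
  destruct (A1 w0 (St1 z T O1 (conj T0 T1))) as [p1 [u1 [Hp1 [_ Q1]]]].
  destruct (A2 w0 (St2 z T O2 (conj T0 T1))) as [p2 [u2 [Hp2 [_ Q2]]]].
  set (rho := Rmin p1 p2). assert (Hrho : (0 < rho)%R) by (apply Rmin_pos; auto).
  assert (D : forall h, (Cmod h < rho)%R -> abs_summable (fun k => (u1 k - u2 k) * h ^ k) /\
     has_sum (fun k => (u1 k - u2 k) * h ^ k) (f1 (w0 + h) - f2 (w0 + h))).
  { intros h Hh.
    destruct (pseries_has_sum u1 (fun h => f1 (w0 + h)) p1) with (h := h) as [B1 S1].
    { intros k Hk. specialize (Q1 (w0 + k)). replace (w0 + k - w0) with k in Q1 by ring. auto. }
    { eapply Rlt_le_trans; [apply Hh | apply Rmin_l]. }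
    destruct (pseries_has_sum u2 (fun h => f2 (w0 + h)) p2) with (h := h) as [B2 S2].
    { intros k Hk. specialize (Q2 (w0 + k)). replace (w0 + k - w0) with k in Q2 by ring. auto. }
    { eapply Rlt_le_trans; [apply Hh | apply Rmin_r]. }
    split.
    - eapply abs_summable_ext; [|apply (abs_summable_plus _ _ B1 (abs_summable_scal (RtoC (-1)) _ B2))].
      intros k. cbv beta. ring.
    - eapply has_sum_ext; [|apply (has_sum_minus _ _ _ _ S1 S2)]. intros k. cbv beta. ring. }
  assert (Zero : forall k, u1 k - u2 k = 0).
  { apply (power_series_zero _ (fun h => f1 (w0 + h) - f2 (w0 + h)) rho Hrho D).
    intros d Hd.
    (* Points of agreement near T z: from below on the segment if T > 0, and inside the common
       initial disc if T = 0. *)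
    assert (X : exists tau, tau <> T /\ E tau /\ (Rabs (tau - T) * Cmod z < d)%R).
    { destruct (Rle_lt_or_eq_dec 0 T T0) as [hT|hT].
      - set (e := Rmin (T / 2) (d / (2 * Cmod z))).
        assert (He : (0 < e)%R). { apply Rmin_pos. lra. apply Rdiv_lt_0_compat; lra. }
        assert (He1 : (e <= T / 2)%R) by apply Rmin_l.
        assert (He2 : (e <= d / (2 * Cmod z))%R) by apply Rmin_r.
        exists (T - e)%R. split; [lra|]. split. apply Tlt. lra.
        replace (T - e - T)%R with (- e)%R by ring. rewrite Rabs_Ropp, Rabs_pos_eq by lra.
        apply Rle_lt_trans with (d / (2 * Cmod z) * Cmod z)%R. apply Rmult_le_compat_r; lra.
        replace (d / (2 * Cmod z) * Cmod z)%R with (d / 2)%R by (field; lra). lra.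
      - assert (Hm : (0 < Rmin r1 r2)%R) by (apply Rmin_pos; auto).
        set (e := (Rmin (Rmin r1 r2) d / (2 * Cmod z))%R).
        assert (Hmd : (0 < Rmin (Rmin r1 r2) d)%R) by (apply Rmin_pos; auto).
        assert (He : (0 < e)%R) by (apply Rdiv_lt_0_compat; lra).
        assert (Ez : (e * Cmod z = Rmin (Rmin r1 r2) d / 2)%R) by (unfold e; field; lra).
        assert (M1 := Rmin_l (Rmin r1 r2) d). assert (M2 := Rmin_r (Rmin r1 r2) d).
        exists e. split; [lra|]. split.
        + apply E0. rewrite Cmod_mult, Cmod_R, Rabs_pos_eq by lra. lra.
        + rewrite <- hT, Rminus_0_r, Rabs_pos_eq by lra. lra. }
    destruct X as [tau [h1 [h2 h3]]]. exists (RtoC tau * z - w0). unfold w0. rewrite CS. split.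
    - split; auto. apply Rmult_lt_0_compat; auto. apply Rabs_pos_lt. lra.
    - replace (RtoC T * z + (RtoC tau * z - RtoC T * z)) with (RtoC tau * z) by ring. rewrite h2. ring. }
  assert (Near : forall h, (Cmod h < rho)%R -> f1 (w0 + h) = f2 (w0 + h)).
  { intros h Hh. destruct (D h Hh) as [_ S1].
    assert (S0 : has_sum (fun k => (u1 k - u2 k) * h ^ k) 0).
    { apply has_sum_zero. intros k. rewrite Zero. ring. }
    assert (e := has_sum_unique _ _ _ S1 S0).
    replace (f1 (w0 + h)) with ((f1 (w0 + h) - f2 (w0 + h)) + f2 (w0 + h)) by ring. rewrite e. ring. }
  assert (NearT : forall tau, (Rabs (tau - T) * Cmod z < rho)%R -> E tau).
  { intros tau h. unfold E. replace (RtoC tau * z) with (w0 + (RtoC tau * z - w0)) by (unfold w0; ring).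
    apply Near. unfold w0. rewrite CS. auto. }
  destruct (Rle_lt_or_eq_dec T 1 T1) as [hT|hT].
  - exfalso. set (e := Rmin (1 - T) (rho / (2 * Cmod z))).
    assert (He : (0 < e)%R). { apply Rmin_pos. lra. apply Rdiv_lt_0_compat; lra. }
    assert (He1 : (e <= 1 - T)%R) by apply Rmin_l.
    assert (He2 : (e <= rho / (2 * Cmod z))%R) by apply Rmin_r.
    assert (T + e <= T)%R; [|lra]. apply Tub. split. lra. intros tau h.
    destruct (Rlt_dec tau T). apply Tlt; lra. apply NearT.
    rewrite Rabs_pos_eq by lra.
    apply Rle_lt_trans with (rho / (2 * Cmod z) * Cmod z)%R. apply Rmult_le_compat_r; lra.
    replace (rho / (2 * Cmod z) * Cmod z)%R with (rho / 2)%R by (field; lra). lra.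
  - assert (e1 : E T). { apply NearT. replace (T - T)%R with 0%R by ring. rewrite Rabs_R0, Rmult_0_l. auto. }
    unfold E in e1. rewrite hT, Cmult_1_l in e1. auto.
Qed.

(** * The continuation supplied by Pfaff's transformation *)

Section Pfaff.
Variables (a b C0 : C) (c : R).
Hypothesis c_range : (0 < c < 1)%R.

(** A disc tangent to Re w = 1/2 from the left, so w/(w - 1) stays in the unit disc. The affine map
    z = (1 - c) w + c sends it into the unit disc, 0 to c and c/(c - 1) to 0. Since 1 - z = (1 -
    c)(1 - w), one binomial series in z represents (1 - w)^(-a) on the whole disc, up to its value
    at z = c. *)
Definition pfaff_dom (w : C) : Prop := (Cmod (w * RtoC (1 - c) + RtoC c) < (1 + c) / 2)%R.

(* Pfaff: (1-w)^(-a) 2F1(a, c-b; c; w/(w-1)), the power being normalized at w = 0. *)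
Definition pfaff_fun (w : C) : C :=
  binser a (w * RtoC (1 - c) + RtoC c) / binser a (RtoC c) * powser (pfaff_term a b C0) (w / (w - 1)).

Lemma pfaff_dom_half w : pfaff_dom w -> (fst w < 1 / 2)%R.
Proof.
  intros H. unfold pfaff_dom in H. assert (T := re_le_Cmod (w * RtoC (1 - c) + RtoC c)).
  destruct w as [x y]. unfold Re in T. simpl in T. simpl.
  assert (T2 := Rle_abs (x * (1 - c) - y * 0 + c)). nra.
Qed.

Lemma Cmod_lt_half w : (fst w < 1 / 2)%R -> (Cmod w < Cmod (1 - w))%R.
Proof.
  intros H. destruct w as [x y]. unfold Cmod; simpl in *. apply sqrt_lt_1; nra.
Qed.

Lemma Cmod_c : (Cmod (RtoC c) < 1)%R.
Proof. rewrite Cmod_R, Rabs_pos_eq; lra. Qed.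

(** With h = w - w0 and u = h/(1 - w0), the power (1 - w)^(-a) acquires the factor (1 - u)^(-a), and
    w/(w - 1) = z0 - u/((1 - w0)(1 - u)). The claim is then [pfaff_expansion] for the Taylor series
    of the inner function at z0. *)
Lemma pfaff_local w0 : pfaff_dom w0 -> exists rho, (0 < rho)%R /\
  (forall w, (Cmod (w - w0) < rho)%R -> pfaff_dom w) /\
  has_power_series_on_disc pfaff_fun w0 rho (fun m =>
    binser a (w0 * RtoC (1 - c) + RtoC c) / binser a (RtoC c) *
    pfaff_coef a (fun k => taylor_coef (pfaff_term a b C0) (w0 / (w0 - 1)) k * (- / (1 - w0)) ^ k) m
    * / (1 - w0) ^ m).
Proof.
  intros Hw0. assert (H0 := Cmod_lt_half w0 (pfaff_dom_half w0 Hw0)).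
  assert (P0 := Cmod_ge_0 w0).
  assert (N0 : 1 - w0 <> 0). { apply Cmod_gt_0. lra. }
  assert (N0' : w0 - 1 <> 0). { intros e. apply N0. replace (1 - w0) with (- (w0 - 1)) by ring. rewrite e; ring. }
  set (mu := Cmod (1 - w0)) in *.
  set (z0 := w0 / (w0 - 1)).
  assert (Z0 : (Cmod z0 = Cmod w0 / mu)%R).
  { unfold z0. rewrite Cmod_div by auto. f_equal. unfold mu. rewrite <- Cmod_opp. f_equal. ring. }
  assert (Z1 : (Cmod z0 < 1)%R).
  { rewrite Z0. apply Rmult_lt_reg_r with mu. lra. unfold Rdiv. rewrite Rmult_assoc, Rinv_l by lra. lra. }
  set (A0 := Cmod (w0 * RtoC (1 - c) + RtoC c)) in *.
  (* The three bounds keep w in [pfaff_dom], keep |u| below 1/2, and keep the expansion at z0, even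
     with its majorant |u|/(1 - |u|), inside the unit disc. *)
  set (rho := Rmin ((1 + c) / 2 - A0) (Rmin (mu / 2) (mu ^ 2 * (1 - Cmod z0) / 4))).
  assert (Hrho : (0 < rho)%R).
  { unfold pfaff_dom in Hw0. fold A0 in Hw0. repeat apply Rmin_pos; try lra.
    apply Rdiv_lt_0_compat; [|lra]. apply Rmult_lt_0_compat; [apply pow_lt; lra | lra]. }
  assert (rho1 : (rho <= (1 + c) / 2 - A0)%R) by apply Rmin_l.
  assert (rho2 : (rho <= mu / 2)%R) by (eapply Rle_trans; [apply Rmin_r | apply Rmin_l]).
  assert (rho3 : (rho <= mu ^ 2 * (1 - Cmod z0) / 4)%R) by (eapply Rle_trans; [apply Rmin_r | apply Rmin_r]).
  assert (Shift : forall h, (w0 + h) * RtoC (1 - c) + RtoC c = (w0 * RtoC (1 - c) + RtoC c) + h * RtoC (1 - c)) by (intros; ring).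
  assert (Hh1 : forall h, (Cmod (h * RtoC (1 - c)) <= Cmod h)%R).
  { intros h. rewrite Cmod_mult, Cmod_R, Rabs_pos_eq by lra. assert (p := Cmod_ge_0 h). nra. }
  exists rho. split; [auto|]. split.
  - intros w Hw. unfold pfaff_dom. replace w with (w0 + (w - w0)) by ring. rewrite Shift.
    eapply Rle_lt_trans; [apply Cmod_triangle|]. fold A0. specialize (Hh1 (w - w0)). lra.
  - intros w Hw. set (h := w - w0) in *. assert (Ew : w = w0 + h) by (unfold h; ring).
    set (u := h / (1 - w0)).
    assert (Pu := Cmod_ge_0 u). assert (Ph := Cmod_ge_0 h).
    assert (Eu : (Cmod u = Cmod h / mu)%R) by (unfold u; rewrite Cmod_div by auto; auto).
    assert (Eh : (Cmod h = Cmod u * mu)%R) by (rewrite Eu; field; lra).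
    assert (Hu : (Cmod u < 1 / 2)%R).
    { apply Rmult_lt_reg_r with mu; lra. }
    assert (Hu1 : (Cmod u < 1)%R) by lra.
    assert (Nu := one_minus_neq_0 u Hu1).
    set (kap := - / (1 - w0)).
    assert (Ek : (Cmod kap = / mu)%R) by (unfold kap; rewrite Cmod_opp, Cmod_inv by auto; auto).
    assert (Ht : (Cmod z0 + / mu * (Cmod u / (1 - Cmod u)) < 1)%R).
    { assert (Cmod u / (1 - Cmod u) <= 2 * Cmod u)%R.
      { apply Rmult_le_reg_r with (1 - Cmod u)%R. lra. unfold Rdiv. rewrite Rmult_assoc, Rinv_l by lra. nra. }
      assert (Cmod u < mu * (1 - Cmod z0) / 4)%R.
      { apply Rmult_lt_reg_r with mu. lra. rewrite <- Eh. replace (mu * (1 - Cmod z0) / 4 * mu)%R with (mu ^ 2 * (1 - Cmod z0) / 4)%R by field. lra. }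
      assert (Im : (0 < / mu)%R) by (apply Rinv_0_lt_compat; lra).
      assert (/ mu * (Cmod u / (1 - Cmod u)) <= / mu * (2 * Cmod u))%R by (apply Rmult_le_compat_l; lra).
      assert (/ mu * (2 * Cmod u) < / mu * (mu * (1 - Cmod z0) / 2))%R by (apply Rmult_lt_compat_l; lra).
      replace (/ mu * (mu * (1 - Cmod z0) / 2))%R with ((1 - Cmod z0) / 2)%R in * by (field; lra). lra. }
    assert (Sub := subexp_pfaff_term a b C0).
    set (g := pfaff_term a b C0) in *.
    assert (Uden : (0 <= Cmod u / (1 - Cmod u))%R).
    { apply Rmult_le_pos; auto. left; apply Rinv_0_lt_compat; lra. }
    destruct (taylor_expansion g z0 (kap * RtoC (Cmod u / (1 - Cmod u))) Sub) as [TA _].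
    { rewrite Cmod_mult, Ek, Cmod_R, Rabs_pos_eq; auto. }
    destruct (taylor_expansion g z0 (kap * (u / (1 - u))) Sub) as [_ TB].
    { eapply Rle_lt_trans; [|apply Ht]. apply Rplus_le_compat_l. rewrite Cmod_mult, Ek.
      apply Rmult_le_compat_l. left; apply Rinv_0_lt_compat; lra.
      rewrite Cmod_div by auto. apply Rmult_le_compat_l; auto. apply Rinv_le_contravar. lra.
      assert (T := Cmod_triangle (1 - u) u). replace (1 - u + u) with (RtoC 1) in T by ring. rewrite Cmod_1 in T. lra. }
    assert (N1 : 1 - w <> 0).
    { intros e. apply Nu. unfold u. replace (1 - h / (1 - w0)) with ((1 - w) / (1 - w0)).
      rewrite e. field; auto. rewrite Ew. field; auto. }
    assert (N1' : w - 1 <> 0). { intros e. apply N1. replace (1 - w) with (- (w - 1)) by ring. rewrite e; ring. }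
    assert (Ez : z0 + kap * (u / (1 - u)) = w / (w - 1)).
    { assert (E1u : 1 - u = (1 - w) / (1 - w0)). { unfold u. rewrite Ew. field; auto. }
      rewrite E1u. unfold z0, kap, u. rewrite Ew in *. field. repeat split; auto.
      }
    rewrite Ez in TB.
    assert (PE := pfaff_expansion a (fun k => taylor_coef g z0 k * kap ^ k) u (powser g (w / (w - 1))) Hu1).
    assert (PE1 := PE ltac:(eapply abs_summable_ext; [|apply TA]; intros k; cbv beta; rewrite Cpow_mult_l; ring)
                      ltac:(eapply has_sum_ext; [|apply TB]; intros k; cbv beta; rewrite Cpow_mult_l; ring)).
    clear PE.
    apply has_sum_is_pseries.
    assert (BT : binser a (w * RtoC (1 - c) + RtoC c) = binser a (w0 * RtoC (1 - c) + RtoC c) * binser a u).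
    { rewrite Ew, Shift, binser_translate.
      - f_equal. f_equal. unfold u.
        replace (1 - (w0 * RtoC (1 - c) + RtoC c)) with ((1 - w0) * RtoC (1 - c)) by (rewrite RtoC_minus; ring).
        field. split; auto. apply RtoC_neq; lra.
      - fold A0. specialize (Hh1 h). lra. }
    unfold pfaff_fun. fold g. rewrite BT.
    assert (Nc := binser_neq_0 a (RtoC c) Cmod_c).
    replace (binser a (w0 * RtoC (1 - c) + RtoC c) * binser a u / binser a (RtoC c) * powser g (w / (w - 1))) with
      (binser a (w0 * RtoC (1 - c) + RtoC c) / binser a (RtoC c) * (binser a u * powser g (w / (w - 1)))) by (field; auto).
    eapply has_sum_ext; [|apply (has_sum_scal _ _ _ PE1)].
    intros m. cbv beta. fold kap. unfold u. unfold Cdiv. rewrite Cpow_mult_l, Cpow_inv by auto. field.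
    split; auto. apply Cpow_nz; auto.
Qed.

Lemma pfaff_is_hyp2F1reg :
  is_hyp2F1reg a b C0 (RtoC (c / (c - 1))) (powser (pfaff_term a b C0) (RtoC c) / binser a (RtoC c)).
Proof.
  assert (Nc := binser_neq_0 a (RtoC c) Cmod_c).
  exists pfaff_dom, pfaff_fun. repeat split.
  (* The cut starts at 1, beyond the line Re w = 1/2 that bounds the domain. *)
  - intros w Hw [h1 h2]. assert (T := pfaff_dom_half w Hw). lra.
  - intros w t Hw Ht. unfold pfaff_dom in *.
    replace (RtoC t * w * RtoC (1 - c) + RtoC c) with (RtoC t * (w * RtoC (1 - c) + RtoC c) + RtoC ((1 - t) * c))
      by (rewrite RtoC_mult, !RtoC_minus; ring).
    eapply Rle_lt_trans; [apply Cmod_triangle|]. rewrite Cmod_mult, !Cmod_R.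
    rewrite !Rabs_pos_eq by (try apply Rmult_le_pos; lra).
    set (X := Cmod _) in *. assert (0 <= X)%R by apply Cmod_ge_0.
    destruct (Rlt_dec t 1).
    + assert (0 <= t * ((1 + c) / 2 - X))%R by (apply Rmult_le_pos; lra).
      assert (0 < (1 - t) * ((1 - c) / 2))%R by (apply Rmult_lt_0_compat; lra). nra.
    + replace t with 1%R by lra. lra.
  - unfold pfaff_dom. rewrite <- RtoC_mult, <- RtoC_plus.
    replace (c / (c - 1) * (1 - c) + c)%R with 0%R by (field; lra). rewrite Cmod_0. lra.
  - intros w0 Hw0. destruct (pfaff_local w0 Hw0) as [rho [H1 [H2 H3]]]. eauto.
  - assert (H0 : pfaff_dom 0).
    { unfold pfaff_dom. replace (0 * RtoC (1 - c) + RtoC c) with (RtoC c) by ring. rewrite Cmod_R, Rabs_pos_eq; lra. }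
    destruct (pfaff_local 0 H0) as [rho [H1 [H2 H3]]]. exists rho. split; auto.
    intros w Hw. specialize (H3 w Hw).
    match type of H3 with is_pseries ?u _ _ => replace (hyp2F1reg_coef a b C0) with u; auto end.
    apply functional_extensionality. intros m. rewrite <- pfaff_coef_hyp.
    replace (0 * RtoC (1 - c) + RtoC c) with (RtoC c) by ring.
    replace (1 - 0) with (RtoC 1) by ring. rewrite Cpow_1_l.
    replace (0 / (0 - 1)) with (RtoC 0) by (field; apply RtoC_neq; lra).
    replace (fun k => taylor_coef (pfaff_term a b C0) 0 k * (- / 1) ^ k) with
      (fun k => pfaff_term a b C0 k * RtoC (-1) ^ k).
    + field. auto.
    + apply functional_extensionality. intros k. rewrite taylor_coef_at_0. do 2 f_equal.
      field.
  - unfold pfaff_fun. rewrite <- RtoC_mult, <- RtoC_plus.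
    replace (c / (c - 1) * (1 - c) + c)%R with 0%R by (field; lra). rewrite binser_at_0.
    replace (RtoC (c / (c - 1)) / (RtoC (c / (c - 1)) - 1)) with (RtoC c). field; auto.
    rewrite <- RtoC_minus, <- RtoC_div.
    + f_equal. field. lra.
    + replace (c / (c - 1) - 1)%R with (/ (c - 1))%R by (field; lra). apply Rinv_neq_0_compat. lra.
Qed.

(** The choice operator returns the value of some continuation; uniqueness identifies it with the
    one constructed. *)
Lemma hyp2F1reg_pfaff :
  hyp2F1reg a b C0 (RtoC (c / (c - 1))) = powser (pfaff_term a b C0) (RtoC c) / binser a (RtoC c).
Proof.
  assert (H1 := pfaff_is_hyp2F1reg).
  assert (H2 : is_hyp2F1reg a b C0 (RtoC (c / (c - 1))) (hyp2F1reg a b C0 (RtoC (c / (c - 1))))).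
  { unfold hyp2F1reg; apply epsilon_spec. eexists; apply H1. }
  destruct H1 as [Om1 [f1 [_ [A1 [A2 [A3 [A4 A5]]]]]]].
  destruct H2 as [Om2 [f2 [_ [B1 [B2 [B3 [B4 B5]]]]]]].
  rewrite <- A5, <- B5. eapply continuation_unique; [apply B1 | apply A1 | eauto ..].
Qed.

End Pfaff.
End Hypergeometric.

(** * The real binomial series and the Lax flow *)

Definition rbinc (p : R) (k : nat) : R := fst (binc (RtoC p) k).

(** * The binomial series with real exponent is a real power *)

Section RealBinomial.

Lemma binc_real p k : binc (RtoC p) k = RtoC (rbinc p k).
Proof.
  assert (E : exists y, binc (RtoC p) k = RtoC y).
  { unfold binc.
    assert (P : exists y, pochhammer (RtoC p) k = RtoC y).
    { induction k as [|k [y IH]]; simpl. exists 1; auto.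
      exists (y * (p + INR k))%R. rewrite IH, RtoC_mult, RtoC_plus. auto. }
    destruct P as [y ->]. exists (y / INR (fact k))%R. rewrite RtoC_div; auto. apply INR_fact_neq_0. }
  destruct E as [y Hy]. unfold rbinc. rewrite Hy. auto.
Qed.

Lemma rbinc_series p t : Rabs t < 1 ->
  is_series (fun k => rbinc p k * t ^ k) (fst (binser (RtoC p) (RtoC t))).
Proof.
  intros Ht. assert (S := binser_sum (RtoC p) (RtoC t) ltac:(rewrite Cmod_R; auto)).
  apply has_sum_is_series_parts in S. destruct S as [S _].
  eapply is_series_ext; [|apply S]. intros k. cbv beta. rewrite binc_real, Cpow_RtoC, <- RtoC_mult. auto.
Qed.

Lemma rbinc_PSeries p t : Rabs t < 1 -> PSeries (rbinc p) t = fst (binser (RtoC p) (RtoC t)).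
Proof. intros Ht. apply is_series_unique, rbinc_series; auto. Qed.

Lemma rbinc_radius p t : Rabs t < 1 -> Rbar_lt (Rabs t) (CV_radius (rbinc p)).
Proof.
  intros Ht. apply Rbar_not_le_lt. intros H.
  set (x := (Rabs t + 1) / 2). assert (P := Rabs_pos t).
  assert (Hx : Rabs x = x) by (apply Rabs_pos_eq; unfold x; lra).
  apply (CV_disk_outside (rbinc p) x).
  - eapply Rbar_le_lt_trans; [apply H|]. simpl. rewrite Hx. unfold x; lra.
  - apply ex_series_lim_0. eexists. apply rbinc_series. rewrite Hx. unfold x; lra.
Qed.

Lemma binser_real_im p t : Rabs t < 1 -> snd (binser (RtoC p) (RtoC t)) = 0.
Proof.
  intros Ht. assert (S := binser_sum (RtoC p) (RtoC t) ltac:(rewrite Cmod_R; auto)).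
  assert (S2 := has_sum_Cconj _ _ S).
  assert (E : Cconj (binser (RtoC p) (RtoC t)) = binser (RtoC p) (RtoC t)).
  { apply (has_sum_unique _ _ _ S2). eapply has_sum_ext; [|apply S]. intros k. cbv beta.
    rewrite binc_real, Cpow_RtoC, <- RtoC_mult, Cconj_RtoC. auto. }
  apply (f_equal snd) in E. simpl in E. lra.
Qed.

Lemma PSeries_rbinc_derive p t : Rabs t < 1 ->
  PSeries (PS_derive (rbinc p)) t * (1 - t) = p * PSeries (rbinc p) t.
Proof.
  intros Ht.
  assert (E : forall k, PS_derive (rbinc p) k = p * rbinc (p + 1) k).
  { intros k. unfold PS_derive. apply RtoC_inj. rewrite !RtoC_mult, <- !binc_real, RtoC_plus.
    unfold binc. rewrite pochhammer_S_l, fact_simpl, mult_INR, RtoC_mult. field.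
    split. apply fact_C_neq_0. apply RtoC_neq, not_0_INR; lia. }
  rewrite (PSeries_ext _ _ t E).
  change (fun k => p * rbinc (p + 1) k) with (PS_scal p (rbinc (p + 1))).
  rewrite PSeries_scal, !rbinc_PSeries by auto.
  assert (R := binser_raise (RtoC p) (RtoC t) ltac:(rewrite Cmod_R; auto)).
  rewrite <- R, <- RtoC_plus, <- RtoC_minus. simpl.
  rewrite binser_real_im by auto. ring.
Qed.

(** The product of the series with (1 - t)^p has zero derivative and value 1 at t = 0. It serves the
    modulus of the constant in front of the Meixner functions, where the exponent becomes real. *)
Lemma binser_Rpower p c : 0 < c < 1 -> binser (RtoC p) (RtoC c) = RtoC (Rpower (1 - c) (- p)).
Proof.
  intros Hc.
  set (y := PSeries (rbinc p)).
  set (f := fun t => y t * exp (p * ln (1 - t))).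
  assert (D : forall t, 0 <= t <= c -> is_derive f t zero).
  { intros t Ht. assert (Ht1 : Rabs t < 1) by (rewrite Rabs_pos_eq; lra).
    assert (D1 := is_derive_PSeries (rbinc p) t (rbinc_radius p t Ht1)).
    assert (D2 : is_derive (fun t => exp (p * ln (1 - t))) t (- p / (1 - t) * exp (p * ln (1 - t)))).
    { auto_derive. lra. unfold Rminus. field. lra. }
    assert (D3 := is_derive_mult _ _ t _ _ D1 D2 Rmult_comm).
    assert (Eq := PSeries_rbinc_derive p t Ht1).
    unfold f. evar_last. exact D3.
    unfold plus, mult, zero; simpl.
    replace (PSeries (PS_derive (rbinc p)) t) with (p * PSeries (rbinc p) t / (1 - t)).
    field. lra. rewrite <- Eq. field. lra. }
  assert (E := eq_is_derive f 0 c D ltac:(lra)).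
  unfold f in E. rewrite Rminus_0_r, ln_1, Rmult_0_r, exp_0 in E. unfold y in E.
  rewrite !rbinc_PSeries in E by (rewrite Rabs_pos_eq; lra).
  rewrite binser_at_0 in E. simpl in E.
  assert (I := binser_real_im p c ltac:(rewrite Rabs_pos_eq; lra)).
  destruct (binser (RtoC p) (RtoC c)) as [a b]. simpl in *. subst b.
  unfold RtoC. f_equal. unfold Rpower. rewrite Ropp_mult_distr_l_reverse, exp_Ropp.
  assert (P := exp_pos (p * ln (1 - c))).
  apply Rmult_eq_reg_r with (exp (p * ln (1 - c))); [|lra]. rewrite Rinv_l by lra. lra.
Qed.

End RealBinomial.

(** * The flow of (s, r) and the modulus c *)

Section LaxFlow.

Lemma halfline_estimate f t l : is_derive_halfline f t l -> forall e, 0 < e ->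
  exists d, 0 < d /\ forall y, 0 <= y -> y <> t -> Rabs (y - t) < d -> Rabs ((f y - f t) / (y - t) - l) < e.
Proof.
  intros H e He.
  destruct (proj1 (filterlim_locally _ _) H (mkposreal e He)) as [d Hd].
  exists d. split. apply d. intros y h1 h2 h3. apply (Hd y); auto.
Qed.

(** Freezing f at its value f 0 on the left gives a function continuous on the whole line and
    differentiable for t > 0, to which the mean value and intermediate value theorems apply. *)
Lemma halfline_extension f f' : (forall t, 0 <= t -> is_derive_halfline f t (f' t)) ->
  exists g, (forall t, 0 < t -> is_derive g t (f' t)) /\ continuity g /\ (forall t, 0 <= t -> g t = f t).
Proof.
  intros H. set (g := fun y => f (Rmax 0 y)).
  assert (G : forall t, 0 <= t -> g t = f t) by (intros; unfold g; rewrite Rmax_right; auto).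
  assert (D : forall t, 0 < t -> is_derive g t (f' t)).
  { intros t Ht. apply is_derive_Reals. intros e He.
    destruct (halfline_estimate f t (f' t) (H t ltac:(lra)) e He) as [d [Hd K]].
    assert (Hm : 0 < Rmin d t) by (apply Rmin_pos; lra).
    exists (mkposreal _ Hm). intros h h1 h2. simpl in h2.
    assert (M1 := Rmin_l d t). assert (M2 := Rmin_r d t).
    assert (A := Rabs_def2 _ _ h2).
    rewrite !G by lra. specialize (K (t + h) ltac:(lra) ltac:(lra)).
    replace (t + h - t) with h in K by ring. apply K. lra. }
  exists g. split; [exact D | split; [|exact G]].
  intros t. destruct (Rtotal_order t 0) as [ht|[ht|ht]].
  - intros e He. exists (- t). split; [lra|]. intros x [_ Hx]. simpl in *. unfold R_dist in *.
    apply Rabs_def2 in Hx. unfold g. rewrite !Rmax_left by lra. rewrite Rminus_diag, Rabs_R0. auto.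
  - subst t. intros e He.
    destruct (halfline_estimate f 0 (f' 0) (H 0 ltac:(lra)) 1 ltac:(lra)) as [d [Hd K]].
    set (M := Rabs (f' 0) + 1). assert (PM : 0 < M) by (unfold M; assert (h := Rabs_pos (f' 0)); lra).
    exists (Rmin d (e / M)). split. { apply Rmin_pos; auto. apply Rdiv_lt_0_compat; auto. }
    intros x [_ Hx]. simpl in *. unfold R_dist in *. rewrite Rminus_0_r in Hx.
    rewrite (G 0) by lra.
    destruct (Rle_dec x 0) as [hx|hx].
    + unfold g. rewrite Rmax_left by lra. rewrite Rminus_diag, Rabs_R0. auto.
    + rewrite G by lra. specialize (K x ltac:(lra) ltac:(lra)).
      rewrite Rminus_0_r in K. specialize (K (Rlt_le_trans _ _ _ Hx (Rmin_l _ _))).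
      assert (Hx2 := Rlt_le_trans _ _ _ Hx (Rmin_r _ _)).
      assert (B : Rabs ((f x - f 0) / x) < M).
      { replace ((f x - f 0) / x) with (((f x - f 0) / x - f' 0) + f' 0) by ring.
        eapply Rle_lt_trans; [apply Rabs_triang|]. unfold M; lra. }
      replace (f x - f 0) with ((f x - f 0) / x * x) by (field; lra). rewrite Rabs_mult.
      assert (0 < Rabs x) by (apply Rabs_pos_lt; lra).
      apply Rlt_le_trans with (M * Rabs x). apply Rmult_lt_compat_r; auto.
      apply Rle_trans with (M * (e / M)). apply Rmult_le_compat_l; lra. right; field; lra.
  - apply derivable_continuous_pt. exists (f' t). apply is_derive_Reals. auto.
Qed.

Lemma sign_opposite_product a b : sign a = - sign b -> a * b <= 0.
Proof.
  intros H. destruct (Rtotal_order a 0) as [h|[h|h]]; destruct (Rtotal_order b 0) as [k|[k|k]];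
    subst; try (rewrite ?Rmult_0_l, ?Rmult_0_r; lra); try nra;
    rewrite ?(sign_eq_m1 a), ?(sign_eq_1 a), ?(sign_eq_m1 b), ?(sign_eq_1 b) in H by lra; lra.
Qed.

(* Since u r <= 0 and s > 0, (r^2)' = - 4 u r s >= 0, so r cannot vanish. *)
Lemma lax_flow_invariants (r s u : R -> R)
  (ode_s : forall t, 0 <= t -> is_derive_halfline s t (- 2 * u t * r t))
  (ode_r : forall t, 0 <= t -> is_derive_halfline r t (- 2 * u t * s t))
  (sgn_u : forall t, 0 < t -> sign (u t) = - sign (r t))
  (s0_pos : 0 < s 0) (r0_pos : 0 < r 0)
  (s2r2_pos : forall t, 0 <= t -> 0 < s t ^ 2 - r t ^ 2) :
  forall t, 0 <= t -> 0 < r t /\ 0 < s t /\ s t ^ 2 - r t ^ 2 = s 0 ^ 2 - r 0 ^ 2.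
Proof.
  destruct (halfline_extension s _ ode_s) as [S [Ds [Cs Es]]].
  destruct (halfline_extension r _ ode_r) as [Rr [Dr [Cr Er]]].
  (* A zero of s would contradict s^2 > r^2 >= 0. *)
  assert (Spos : forall t, 0 <= t -> 0 < s t).
  { intros t Ht. apply Rnot_le_lt. intros hs.
    destruct (IVT_cor S 0 t Cs Ht) as [z [hz1 hz2]].
    { rewrite !Es by lra. nra. }
    rewrite Es in hz2 by lra. specialize (s2r2_pos z ltac:(lra)). rewrite hz2 in s2r2_pos. nra. }
  set (Q := fun y => Rr y * Rr y).
  assert (CQ : continuity Q) by (intros x; apply continuity_pt_mult; apply Cr).
  assert (mono : forall a t, 0 < a -> a <= t -> r a ^ 2 <= r t ^ 2).
  { intros a t Ha Hat. destruct (Rle_lt_or_eq_dec a t Hat) as [Hlt|<-]; [|lra].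
    destruct (MVT_gen Q a t (fun y => 2 * Rr y * (- 2 * u y * s y))) as [z [hz1 hz2]].
    - intros x Hx. rewrite Rmin_left, Rmax_right in Hx by lra.
      assert (D := Dr x ltac:(lra)).
      evar_last. apply (is_derive_mult Rr Rr x _ _ D D Rmult_comm). unfold plus, mult; simpl. ring.
    - intros x Hx. apply CQ.
    - rewrite Rmin_left, Rmax_right in hz1 by lra. unfold Q in hz2. rewrite !Er in hz2 by lra.
      assert (P := sign_opposite_product _ _ (sgn_u z ltac:(lra))). assert (Sz := Spos z ltac:(lra)).
      assert (0 <= 2 * r z * (- 2 * u z * s z) * (t - a)).
      { replace (2 * r z * (- 2 * u z * s z) * (t - a)) with (4 * (- (u z * r z)) * s z * (t - a)) by ring.
        repeat apply Rmult_le_pos; lra. }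
      nra. }
  (* The sign condition concerns t > 0 only, so monotonicity is established from positive times on
     and extended to 0 by continuity. *)
  assert (Rsq : forall t, 0 <= t -> r 0 ^ 2 <= r t ^ 2).
  { intros t Ht. destruct (Rle_lt_or_eq_dec 0 t Ht) as [Ht'|<-]; [|lra].
    apply Rnot_lt_le. intros hlt.
    destruct (CQ 0 (r 0 ^ 2 - r t ^ 2)) as [d [Hd K]]; [lra|].
    set (x := Rmin (d / 2) t).
    assert (Hx : 0 < x) by (apply Rmin_pos; lra).
    assert (Hx1 : x <= d / 2) by apply Rmin_l. assert (Hx2 : x <= t) by apply Rmin_r.
    assert (Kx : Rabs (Q x - Q 0) < r 0 ^ 2 - r t ^ 2).
    { apply K. split. split; [exact I | lra]. simpl. unfold R_dist. rewrite Rminus_0_r, Rabs_pos_eq; lra. }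
    unfold Q in Kx. rewrite !Er in Kx by lra. apply Rabs_def2 in Kx.
    assert (M := mono x t Hx Hx2). nra. }
  assert (Rpos : forall t, 0 <= t -> 0 < r t).
  { intros t Ht. apply Rnot_le_lt. intros hs.
    destruct (IVT_cor Rr 0 t Cr Ht) as [z [hz1 hz2]].
    { rewrite !Er by lra. nra. }
    rewrite Er in hz2 by lra. assert (h := Rsq z ltac:(lra)). rewrite hz2 in h. nra. }
  intros t Ht. repeat split; auto.
  destruct (Rle_lt_or_eq_dec 0 t Ht) as [Ht'|<-]; [|lra].
  destruct (MVT_gen (fun y => S y * S y - Rr y * Rr y) 0 t (fun _ => 0)) as [z [_ hz]].
  - intros x Hx. rewrite Rmin_left, Rmax_right in Hx by lra.
    assert (D1 := Dr x ltac:(lra)). assert (D2 := Ds x ltac:(lra)).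
    evar_last.
    apply (is_derive_minus (fun y => S y * S y) (fun y => Rr y * Rr y) x _ _
      (is_derive_mult S S x _ _ D2 D2 Rmult_comm) (is_derive_mult Rr Rr x _ _ D1 D1 Rmult_comm)).
    unfold minus, plus, mult, opp; simpl. rewrite Es, Er by lra. ring.
  - intros x Hx. apply continuity_pt_minus; apply continuity_pt_mult; auto.
  - rewrite !Es, !Er in hz by lra. lra.
Qed.

(** The equation says that sqrt c is a root of p^2 + 1 = 2 y p. The roots are y - w and its inverse
    y + w, with w = sqrt (y^2 - 1), and only the former lies in (0,1). *)
Lemma modulus_unique y : 1 < y ->
  unique (fun c => 0 < c < 1 /\ y = (1 + c) / (2 * sqrt c)) (exp (- 2 * arccosh y)).
Proof.
  intros Hy. set (w := sqrt (y ^ 2 - 1)).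
  assert (Pw : 0 < w) by (apply sqrt_lt_R0; nra).
  assert (Ew : w * w = y ^ 2 - 1) by (apply sqrt_sqrt; nra).
  assert (E : exp (- 2 * arccosh y) = / (y + w) * / (y + w)).
  { unfold arccosh. fold w. replace (- 2 * ln (y + w)) with (- ln (y + w) + - ln (y + w)) by ring.
    rewrite exp_plus, exp_Ropp, exp_ln by lra. auto. }
  rewrite E. set (q := / (y + w)). assert (Eq : q = y - w).
  { unfold q. apply Rmult_eq_reg_l with (y + w); [|lra]. rewrite Rinv_r by lra. nra. }
  assert (Pq : 0 < q) by (apply Rinv_0_lt_compat; lra).
  assert (Q1 : q < 1).
  { unfold q. rewrite <- Rinv_1. apply Rinv_lt_contravar; lra. }
  assert (quad : q * q + 1 = 2 * y * q) by (rewrite Eq; nra).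
  split.
  - split. nra. rewrite sqrt_square by lra. apply Rmult_eq_reg_r with (2 * q); [|lra].
    field_simplify; [|lra]. nra.
  - intros c [Hc Ec]. set (p := sqrt c) in *.
    assert (Pp : 0 < p) by (apply sqrt_lt_R0; lra).
    assert (Epp : p * p = c) by (apply sqrt_sqrt; lra).
    assert (p1 : p < 1). { unfold p. rewrite <- sqrt_1. apply sqrt_lt_1; lra. }
    assert (quad2 : p * p + 1 = 2 * y * p). { rewrite Ec, Epp. field. lra. }
    assert (Z : (q - p) * (1 - q * p) = 0) by nra.
    apply Rmult_integral in Z. destruct Z as [Z|Z]; [|nra].
    rewrite <- Epp. replace p with q by lra. auto.
Qed.

End LaxFlow.

(** * Meixner functions *)

Section Meixner.
Open Scope C_scope.

Lemma Csqrt_RtoC x : (0 <= x)%R -> Csqrt (RtoC x) = RtoC (sqrt x).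
Proof.
  intros Hx. unfold Csqrt. rewrite Cmod_R, Rabs_pos_eq by auto. simpl.
  destruct Rlt_dec; [lra|]. unfold RtoC. f_equal.
  - f_equal. field.
  - replace ((x - x) / 2)%R with 0%R by field. rewrite sqrt_0. ring.
Qed.

Lemma Csqrt_conj_product z : Csqrt (z * Cconj z) = RtoC (Cmod z).
Proof.
  rewrite <- Cmod_sq, Csqrt_RtoC by apply pow2_ge_0. rewrite sqrt_pow2; auto. apply Cmod_ge_0.
Qed.

Lemma powerRZ_zp q k : powerRZ q (Znonneg k) = (q ^ k)%R.
Proof. unfold Znonneg. symmetry. apply pow_powerRZ. Qed.

Lemma Z_opp_cases (n : Z) : (exists k, n = Znonneg k) \/ (exists k, n = (- Znonneg k)%Z).
Proof.
  destruct (Z_le_dec 0 n); [left; exists (Z.to_nat n) | right; exists (Z.to_nat (- n))]; unfold Znonneg; lia.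
Qed.

Lemma binser_raise_Z s (x : R) n : (0 < x < 1)%R ->
  binser (RtoC (IZR n) + s) (RtoC x) = binser s (RtoC x) * RtoC (powerRZ (1 - x) (- n)).
Proof.
  intros Hx. assert (Hc : (Cmod (RtoC x) < 1)%R) by (rewrite Cmod_R, Rabs_pos_eq; lra).
  assert (N : RtoC (1 - x) <> 0) by (apply RtoC_neq; lra).
  assert (P : forall k s, binser (RtoC (INR k) + s) (RtoC x) = binser s (RtoC x) / RtoC ((1 - x) ^ k)).
  { intros k s'. rewrite Cplus_comm, binser_raise_n by auto. rewrite <- RtoC_minus, Cpow_RtoC. auto. }
  assert (Nk : forall k, RtoC ((1 - x) ^ k) <> 0) by (intros k; apply RtoC_neq, pow_nonzero; lra).
  destruct (Z_opp_cases n) as [[k ->]|[k ->]].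
  - unfold Znonneg at 1. rewrite <- INR_IZR_INZ, P.
    rewrite powerRZ_neg', powerRZ_zp, RtoC_inv by (apply pow_nonzero; lra). auto.
  - rewrite Z.opp_involutive, powerRZ_zp.
    assert (T := P k (RtoC (IZR (- Znonneg k)) + s)).
    replace (RtoC (INR k) + (RtoC (IZR (- Znonneg k)) + s)) with s in T.
    + rewrite T. field; auto.
    + unfold Znonneg. rewrite opp_IZR, <- INR_IZR_INZ, RtoC_opp. ring.
Qed.

Lemma weight1_pos x : (0 < weight1 x)%R.
Proof. unfold weight1; lra. Qed.

Lemma finite_support_list f : finite_support f -> exists L : list Z, NoDup L /\ forall k, ~ In k L -> f k = 0.
Proof.
  intros [N HN]. set (M := Z.to_nat (Z.abs N)).
  destruct (exists_NoDup_list (map (fun i => (Z.of_nat i - Z.of_nat M)%Z) (seq 0 (2 * M + 1)))) as [L [HL Hin]].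
  exists L. split; auto. intros k Hk. apply HN. apply Z.nle_gt. intros h. apply Hk, Hin, in_map_iff.
  exists (Z.to_nat (k + Z.of_nat M)). split; [|apply in_seq]; unfold M in *; lia.
Qed.

Lemma finite_support_in_l2 f : finite_support f -> in_l2 weight1 f.
Proof.
  intros H. destruct (finite_support_list f H) as [L [HL Hz]].
  apply (finite_in_l2 weight1 weight1_pos f L HL Hz).
Qed.

Lemma basis_finite_support n : finite_support (basis_vec n).
Proof. exists (Z.abs n). intros k Hk. unfold basis_vec. destruct Z.eq_dec; auto. subst; lia. Qed.

Lemma lincomb_finite_support a f g : finite_support f -> finite_support g ->
  finite_support (fun k => a * f k + g k).
Proof.
  intros [N HN] [M HM]. exists (Z.max N M). intros k Hk. rewrite HN, HM by lia. ring.
Qed.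

(** * Meixner functions as rescaled matrix coefficients *)

Variables (lam : C) (eps c : R).
Hypothesis Re_lam : Re lam = (- (1 / 2))%R.
Hypothesis eps_range : (0 <= eps < 1)%R.
Hypothesis lam_eps : (lam, eps) <> (RtoC (- (1 / 2)), (1 / 2)%R).
Hypothesis c_range : (0 < c < 1)%R.

Definition sgm : C := RtoC eps + lam + 1.
Definition nome : R := sqrt c.

Lemma nome_range : (0 < nome < 1)%R.
Proof.
  unfold nome. split. apply sqrt_lt_R0; lra. rewrite <- sqrt_1. apply sqrt_lt_1; lra.
Qed.

Lemma nome_sq : (nome ^ 2 = c)%R.
Proof. unfold nome. apply pow2_sqrt. lra. Qed.

Lemma nome_sq_C : RtoC c = RtoC nome * RtoC nome.
Proof. rewrite <- RtoC_mult, <- nome_sq. f_equal. ring. Qed.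

(** Re lambda = -1/2 makes the two Gamma arguments complex conjugate to each other. *)
Lemma sgm_conj : Cconj sgm = RtoC eps - lam.
Proof.
  unfold sgm. destruct lam as [a b]. simpl in Re_lam. subst a.
  unfold Cminus, Cconj, RtoC, Copp, Cplus; simpl. f_equal; field.
Qed.

Lemma par1_eq n : par1 lam eps n = RtoC (IZR n) + sgm.
Proof. unfold par1, sgm. rewrite RtoC_plus. ring. Qed.

Lemma par2_eq n : par2 lam eps n = RtoC (IZR n) + Cconj sgm.
Proof. unfold par2. rewrite sgm_conj, RtoC_plus. ring. Qed.

(** The real part eps + 1/2 + i can vanish only for i = -1 and eps = 1/2; the imaginary part then
    forces lambda = -1/2, the excluded pair. *)
Lemma sgm_not_int (i : Z) : sgm + RtoC (IZR i) <> 0.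
Proof.
  intros H. assert (h1 := f_equal fst H). assert (h2 := f_equal snd H).
  unfold sgm, RtoC, Cplus in h1, h2. simpl in h1, h2. unfold Re in Re_lam.
  assert (hi : i = (-1)%Z).
  { assert (i < 0)%Z by (apply lt_IZR; lra). assert (-2 < i)%Z by (apply lt_IZR; lra). lia. }
  subst i. apply lam_eps. rewrite (surjective_pairing lam). unfold RtoC. f_equal; [f_equal|]; lra.
Qed.

Definition rGamma_at (n : Z) : C := rGamma (RtoC (IZR n) + sgm).

Lemma rg_conj n : rGamma (RtoC (IZR n) + Cconj sgm) = Cconj (rGamma_at n).
Proof. unfold rGamma_at. rewrite <- rGamma_conj, Cplus_conj, Cconj_RtoC. auto. Qed.

Lemma rg_neq_0 n : rGamma_at n <> 0.
Proof. apply rGamma_shift_neq_0. apply sgm_not_int. Qed.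

Lemma Cconj_neq_0 (z : C) : z <> 0 -> Cconj z <> 0.
Proof. intros H E. apply H. rewrite <- (Cconj_conj z), E. apply Cconj_RtoC. Qed.

Lemma rg_pos n : (0 < Cmod (rGamma_at n))%R.
Proof. apply Cmod_gt_0, rg_neq_0. Qed.

Lemma Gamma_product n :
  Gamma (par1 lam eps n) * Gamma (par2 lam eps n) = RtoC (/ Cmod (rGamma_at n) ^ 2).
Proof.
  assert (N := rg_neq_0 n). assert (N' := Cconj_neq_0 _ N). assert (P := rg_pos n).
  rewrite par1_eq, par2_eq. unfold Gamma. rewrite rg_conj. fold (rGamma_at n).
  rewrite RtoC_inv by (apply pow_nonzero; lra). rewrite Cmod_sq. field; auto.
Qed.

Lemma meixner_weight_eq x :
  meixner_weight lam eps c x = (powerRZ c (- x) * Cmod (rGamma_at x) ^ 2)%R.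
Proof.
  assert (P := rg_pos x). unfold meixner_weight.
  assert (0 < Cmod (rGamma_at x) ^ 2)%R by (apply pow_lt; auto).
  rewrite Gamma_product, <- RtoC_div.
  - unfold Re, RtoC; simpl fst. unfold Rdiv. rewrite Rinv_inv. auto.
  - apply Rinv_neq_0_compat. lra.
Qed.

Lemma meixner_weight_pos x : (0 < meixner_weight lam eps c x)%R.
Proof.
  rewrite meixner_weight_eq. apply Rmult_lt_0_compat.
  apply powerRZ_lt; lra. apply pow_lt, rg_pos.
Qed.

(** What remains in n when the square root of the Gamma product, 1/|1/Gamma|, meets the conjugate of
    1/Gamma produced by Pfaff's transformation. *)
Definition phase (n : Z) : C := Cconj (rGamma_at n) / RtoC (Cmod (rGamma_at n)).

Lemma phase_unimodular n : phase n * Cconj (phase n) = 1.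
Proof.
  assert (N := rg_neq_0 n). assert (P := rg_pos n).
  assert (N2 : RtoC (Cmod (rGamma_at n)) <> 0) by (apply RtoC_neq; lra).
  unfold phase. rewrite Cdiv_conj, Cconj_conj, Cconj_RtoC by auto.
  transitivity ((rGamma_at n * Cconj (rGamma_at n)) / (RtoC (Cmod (rGamma_at n)) * RtoC (Cmod (rGamma_at n)))).
  field; auto. rewrite <- Cmod_sq. simpl. rewrite Rmult_1_r, RtoC_mult. field. auto.
Qed.

Notation X := (matcoef nome sgm).

(** Term k of the hypergeometric series is, up to a factor independent of k, the summand y = k of
    the Laurent convolution with j = n + k - x. For j < 0 a zero of 1/Gamma matches the vanishing
    binomial coefficient. *)
Lemma powser_pfaff_term n x :
  powser (pfaff_term (par1 lam eps n) (par2 lam eps n) (IZC (n + 1 - x))) (RtoC c) =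
  sgnZ (x - n) * RtoC (powerRZ nome (x - n)) * Cconj (rGamma_at n) / Cconj (rGamma_at x) * X n x.
Proof.
  assert (Q := nome_range). assert (Nx := Cconj_neq_0 _ (rg_neq_0 x)).
  apply tsum_eq.
  set (K := sgnZ (x - n) * RtoC (powerRZ nome (x - n)) * Cconj (rGamma_at n) / Cconj (rGamma_at x)).
  assert (S := laurent_sum nome Q (RtoC (IZR n) + sgm) (1 - (RtoC (IZR n) + Cconj sgm)) (x - n)).
  assert (S2 := has_sum_scal K _ _ S). apply (has_sum_inj Znonneg) in S2.
  - eapply has_sum_ext; [|apply S2]. intros k. cbv beta. unfold pfaff_term. rewrite par1_eq, par2_eq.
    replace (IZC (n + 1 - x) - (RtoC (IZR n) + Cconj sgm)) with (1 - (RtoC (IZR x) + Cconj sgm))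
      by (unfold IZC; rewrite IZR_C_minus, IZR_C_plus; ring).
    rewrite bincZ_nat.
    destruct (Z_cases (Znonneg k - (x - n))) as [h|[j Hj]].
    + rewrite (bincZ_neg _ _ _ h).
      replace (IZC (n + 1 - x) + RtoC (INR k)) with (- RtoC (INR (Z.to_nat (x - n - 1 - Znonneg k)))).
      rewrite rGamma_nonpos_nat. ring.
      rewrite !INR_IZR_INZ, Z2Nat.id by (unfold Znonneg in *; lia). unfold IZC. rewrite <- RtoC_opp, <- opp_IZR, <- IZR_C_plus.
      do 2 f_equal. unfold Znonneg; lia.
    + rewrite Hj, bincZ_nat.
      assert (E : (n + Znonneg k = x + Znonneg j)%Z) by lia.
      replace (IZC (n + 1 - x) + RtoC (INR k)) with (RtoC (INR j) + 1).
      2: { unfold IZC. rewrite !INR_IZR_INZ, <- !IZR_C_plus. do 2 f_equal. unfold Znonneg in *; lia. }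
      rewrite rGamma_nat.
      assert (P := pochhammer_swap_reflected (Cconj sgm) n x k j E). rewrite !rg_conj in P.
      set (pk := pochhammer (1 - (RtoC (IZR x) + Cconj sgm)) k) in *.
      unfold binc. set (pj := pochhammer (1 - (RtoC (IZR n) + Cconj sgm)) j) in *.
      assert (Ex : (x - n = Znonneg k - Znonneg j)%Z) by lia.
      assert (Sg : sgnZ (x - n) = sgnZ (Znonneg k) * sgnZ (Znonneg j)).
      { rewrite <- sgnZ_plus. replace (Znonneg k + Znonneg j)%Z with ((x - n) + (Znonneg j + Znonneg j))%Z by lia.
        rewrite sgnZ_plus, (sgnZ_plus (Znonneg j)), sgnZ_sq. ring. }
      assert (Pw : RtoC (powerRZ nome (x - n)) * RtoC nome ^ j = RtoC nome ^ k).
      { rewrite !Cpow_RtoC, <- RtoC_mult, <- !powerRZ_zp, <- powerRZ_add by lra. do 2 f_equal. lia. }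
      rewrite nome_sq_C, Cpow_mult_l. unfold K. rewrite Sg.
      assert (F1 := fact_C_neq_0 j). assert (F2 := fact_C_neq_0 k).
      assert (Pk : pk = sgnZ (Znonneg k) * (sgnZ (Znonneg j) * pj * Cconj (rGamma_at n)) / Cconj (rGamma_at x)).
      { rewrite <- P. transitivity ((sgnZ (Znonneg k) * sgnZ (Znonneg k)) * pk). rewrite sgnZ_sq; ring. field; auto. }
      rewrite Pk. rewrite <- Pw at 2. field; auto.
  - apply Znonneg_inj.
  - intros y hy. destruct (Z_cases y) as [h|[k ->]]; [|destruct (hy k); auto].
    rewrite (bincZ_neg _ _ y) by auto. ring.
Qed.

(** Equal to (1 - c)^(sigma - eps), with the complex power read as a binomial series. *)
Definition mconst : C := / (RtoC (Rpower (1 - c) eps) * binser sgm (RtoC c)).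

Lemma Rpower_C_neq_0 y : RtoC (Rpower (1 - c) y) <> 0.
Proof. apply RtoC_neq. unfold Rpower. assert (h := exp_pos (y * ln (1 - c))). lra. Qed.

Lemma Cmod_c_lt_1 : (Cmod (RtoC c) < 1)%R.
Proof. rewrite Cmod_R, Rabs_pos_eq; lra. Qed.

Lemma mconst_sq : mconst * Cconj mconst = RtoC (1 - c).
Proof.
  assert (N := binser_neq_0 sgm (RtoC c) Cmod_c_lt_1). assert (R1 := Rpower_C_neq_0 eps).
  assert (N' := binser_neq_0 (Cconj sgm) (RtoC c) Cmod_c_lt_1).
  assert (BC : Cconj (binser sgm (RtoC c)) = binser (Cconj sgm) (RtoC c)).
  { apply (has_sum_unique _ _ _ (has_sum_Cconj _ _ (binser_sum sgm (RtoC c) Cmod_c_lt_1))).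
    eapply has_sum_ext; [|apply (binser_sum (Cconj sgm) (RtoC c) Cmod_c_lt_1)].
    intros k. cbv beta. rewrite Cmult_conj, Cpow_conj, Cconj_RtoC, binc_conj. auto. }
  unfold mconst. rewrite Cinv_conj, Cmult_conj, Cconj_RtoC, BC by (apply Cmult_neq_0; auto).
  assert (B := binser_mult sgm (Cconj sgm) (RtoC c) Cmod_c_lt_1).
  (* The exponents combine to a real one, so the squared modulus is a real power. *)
  replace (sgm + Cconj sgm) with (RtoC (2 * eps + 1)) in B.
  2: { rewrite sgm_conj. unfold sgm. rewrite RtoC_plus, RtoC_mult. ring. }
  rewrite binser_Rpower in B by auto.
  transitivity (/ (RtoC (Rpower (1 - c) eps) * RtoC (Rpower (1 - c) eps) *
      (binser sgm (RtoC c) * binser (Cconj sgm) (RtoC c)))).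
  { field; auto. }
  rewrite B, <- !RtoC_mult, <- !Rpower_plus.
  replace (eps + eps + - (2 * eps + 1))%R with (- (1))%R by ring.
  rewrite Rpower_Ropp, Rpower_1 by lra. rewrite <- RtoC_inv by (apply Rinv_neq_0_compat; lra).
  rewrite Rinv_inv. auto.
Qed.

Lemma powerRZ_neg_base y n : (y <> 0)%R -> RtoC (powerRZ (- y) n) = sgnZ n * RtoC (powerRZ y n).
Proof.
  intros Hy. assert (P : forall k, RtoC ((- y) ^ k) = sgnZ (Znonneg k) * RtoC (y ^ k)).
  { induction k. simpl. unfold sgnZ, Znonneg; simpl. ring.
    rewrite sgnZ_S. simpl. rewrite !RtoC_mult, IHk, RtoC_opp. ring. }
  assert (Nk : forall k, RtoC (y ^ k) <> 0) by (intros; apply RtoC_neq, pow_nonzero; auto).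
  assert (Ns : forall k, sgnZ k <> 0).
  { intros k h. assert (T := sgnZ_sq k). rewrite h in T. ring_simplify in T. apply RtoC_inj in T. lra. }
  destruct (Z_opp_cases n) as [[k ->]|[k ->]].
  - rewrite !powerRZ_zp. auto.
  - rewrite !powerRZ_neg', !powerRZ_zp, !RtoC_inv by (apply pow_nonzero; lra).
    rewrite P. replace (sgnZ (- Znonneg k)) with (sgnZ (Znonneg k)).
    + assert (T := sgnZ_sq (Znonneg k)). assert (Nz := Ns (Znonneg k)).
      transitivity ((sgnZ (Znonneg k) * sgnZ (Znonneg k)) * / (sgnZ (Znonneg k) * RtoC (y ^ k))).
      rewrite T. ring. field; auto.
    + unfold sgnZ. rewrite Z.even_opp. auto.
Qed.

Lemma powerRZ_mult_base a b n : (a <> 0)%R -> (b <> 0)%R ->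
  (powerRZ a n * powerRZ b n = powerRZ (a * b) n)%R.
Proof.
  intros Ha Hb. destruct (Z_opp_cases n) as [[k ->]|[k ->]].
  - rewrite !powerRZ_zp, Rpow_mult_distr. auto.
  - rewrite !powerRZ_neg', !powerRZ_zp, Rpow_mult_distr, Rinv_mult. auto.
Qed.

Lemma meixner_eq n x : meixner n x lam eps c =
  mconst * (sgnZ x * RtoC (powerRZ nome x)) / Cconj (rGamma_at x) * phase n * X n x.
Proof.
  assert (Q := nome_range). assert (Nx := Cconj_neq_0 _ (rg_neq_0 x)).
  assert (P := rg_pos n). assert (R1 := Rpower_C_neq_0 eps).
  assert (N := binser_neq_0 sgm (RtoC c) Cmod_c_lt_1).
  unfold meixner. rewrite hyp2F1reg_pfaff, powser_pfaff_term by auto.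
  rewrite par1_eq, binser_raise_Z, <- par1_eq, Gamma_product by auto.
  rewrite Csqrt_RtoC by (left; apply Rinv_0_lt_compat, pow_lt; auto).
  rewrite sqrt_inv, sqrt_pow2 by lra. fold nome.
  assert (N2 : RtoC (Cmod (rGamma_at n)) <> 0) by (apply RtoC_neq; lra).
  rewrite RtoC_inv by lra. unfold mconst, phase.
  rewrite powerRZ_neg'.
  assert (Pn : powerRZ (1 - c) n <> 0%R) by (apply powerRZ_NOR; lra).
  assert (PnC : RtoC (powerRZ (1 - c) n) <> 0) by (apply RtoC_neq; auto).
  rewrite RtoC_inv by auto.
  (* All n-dependent powers cancel: (-q)^n from the prefactor and (-q)^(x-n) from the series give
     (-q)^x, where q is [nome]. *)
  assert (E : RtoC (powerRZ (nome / (c - 1)) n) * RtoC (powerRZ (1 - c) n) * sgnZ (x - n) * RtoC (powerRZ nome (x - n))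
    = sgnZ x * RtoC (powerRZ nome x)).
  { rewrite <- RtoC_mult, powerRZ_mult_base.
    - replace (nome / (c - 1) * (1 - c))%R with (- nome)%R by (field; lra).
      rewrite powerRZ_neg_base by lra.
      transitivity ((sgnZ n * sgnZ (x - n)) * (RtoC (powerRZ nome n) * RtoC (powerRZ nome (x - n)))). ring.
      rewrite <- sgnZ_plus, <- RtoC_mult, <- powerRZ_add by lra.
      replace (n + (x - n))%Z with x by lia. auto.
    - apply Rmult_integral_contrapositive. split. lra. apply Rinv_neq_0_compat. lra.
    - lra. }
  rewrite <- E. field. repeat split; auto.
Qed.

Lemma Cconj_sgnZ k : Cconj (sgnZ k) = sgnZ k.
Proof. unfold sgnZ. destruct (Z.even k); apply Cconj_RtoC. Qed.

Definition xfactor (x : Z) : C := sgnZ x * RtoC (powerRZ nome x) / Cconj (rGamma_at x).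

Lemma xfactor_sq x : xfactor x * Cconj (xfactor x) = RtoC (/ meixner_weight lam eps c x).
Proof.
  assert (Q := nome_range). assert (N := rg_neq_0 x). assert (N' := Cconj_neq_0 _ N).
  assert (P := rg_pos x).
  unfold xfactor. rewrite Cdiv_conj, Cconj_conj, Cmult_conj, Cconj_sgnZ, Cconj_RtoC by auto.
  rewrite meixner_weight_eq, Rinv_mult, powerRZ_neg', Rinv_inv.
  replace (powerRZ c x) with (powerRZ nome x * powerRZ nome x)%R.
  2: { rewrite powerRZ_mult_base by lra. f_equal. rewrite <- nome_sq. ring. }
  rewrite !RtoC_mult, RtoC_inv by (apply pow_nonzero; lra). rewrite Cmod_sq.
  transitivity ((sgnZ x * sgnZ x) * (RtoC (powerRZ nome x) * RtoC (powerRZ nome x) / (rGamma_at x * Cconj (rGamma_at x)))).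
  field; auto. rewrite sgnZ_sq. field; auto.
Qed.

Lemma meixner_factor n x : meixner n x lam eps c = mconst * xfactor x * phase n * X n x.
Proof. rewrite meixner_eq. unfold xfactor, Cdiv. ring. Qed.

Lemma one_minus_c_neq_0 : RtoC (1 - c) <> 0.
Proof. apply RtoC_neq. lra. Qed.

Lemma meixner_rows n k : has_sum
  (fun x => meixner n x lam eps c * Cconj (meixner k x lam eps c) * RtoC (meixner_weight lam eps c x))
  (if Z.eq_dec n k then RtoC (/ weight1 n) else 0).
Proof.
  assert (T := has_sum_scal (RtoC (1 - c) * phase n * Cconj (phase k)) _ _
     (matcoef_rows nome nome_range sgm n k)).
  rewrite nome_sq in T.
  replace (if Z.eq_dec n k then RtoC (/ weight1 n) else 0) with
    (RtoC (1 - c) * phase n * Cconj (phase k) * (if Z.eq_dec n k then RtoC (/ (1 - c)) else 0)).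
  - eapply has_sum_ext; [|apply T]. intros x. cbv beta. rewrite !meixner_factor, !Cmult_conj.
    assert (F := xfactor_sq x). assert (Wp := meixner_weight_pos x).
    assert (WN : RtoC (meixner_weight lam eps c x) <> 0) by (apply RtoC_neq; lra).
    rewrite RtoC_inv in F by lra.
    transitivity ((mconst * Cconj mconst) * phase n * Cconj (phase k) * (X n x * Cconj (X k x)) *
      ((xfactor x * Cconj (xfactor x)) * RtoC (meixner_weight lam eps c x))).
    + rewrite mconst_sq, F. field; auto.
    + ring.
  - destruct Z.eq_dec as [->|]; [|ring].
    transitivity (RtoC (1 - c) * RtoC (/ (1 - c)) * (phase k * Cconj (phase k))). ring.
    rewrite phase_unimodular. unfold weight1. rewrite Rinv_1, RtoC_inv by lra.
    field. apply one_minus_c_neq_0.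
Qed.

Lemma meixner_cols x y : has_sum
  (fun n => Cconj (meixner n x lam eps c) * Cconj (Cconj (meixner n y lam eps c)) * RtoC (weight1 n))
  (if Z.eq_dec x y then RtoC (/ meixner_weight lam eps c x) else 0).
Proof.
  assert (T := has_sum_scal (RtoC (1 - c) * Cconj (xfactor x * Cconj (xfactor y))) _ _
    (has_sum_Cconj _ _ (matcoef_cols nome nome_range sgm sgm_not_int x y))).
  rewrite nome_sq in T.
  replace (if Z.eq_dec x y then RtoC (/ meixner_weight lam eps c x) else 0) with
    (RtoC (1 - c) * Cconj (xfactor x * Cconj (xfactor y)) * Cconj (if Z.eq_dec x y then RtoC (/ (1 - c)) else 0)).
  - eapply has_sum_ext; [|apply T]. intros n. cbv beta. rewrite !meixner_factor, !Cmult_conj, !Cconj_conj.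
    unfold weight1.
    transitivity ((mconst * Cconj mconst) * (phase n * Cconj (phase n)) *
      (Cconj (xfactor x) * xfactor y) * (Cconj (X n x) * X n y)).
    + rewrite mconst_sq, phase_unimodular. ring.
    + ring.
  - destruct Z.eq_dec as [->|].
    + rewrite xfactor_sq, !Cconj_RtoC, <- !RtoC_mult. f_equal.
      assert (Wp := meixner_weight_pos y). field. lra.
    + rewrite Cconj_RtoC. ring.
Qed.

(** The functional equation of 1/Gamma, conjugated and normalized. It converts the linear
    coefficients of the recurrence for the phi_n into the square roots by which E and F act. *)
Lemma phase_step n : phase (n + 1) * (RtoC (IZR n) + Cconj sgm) = phase n * RtoC (Cmod (RtoC (IZR n) + sgm)).
Proof.
  assert (N := rg_neq_0 (n + 1)). assert (P := rg_pos (n + 1)).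
  assert (E : rGamma_at n = (RtoC (IZR n) + sgm) * rGamma_at (n + 1)).
  { unfold rGamma_at. rewrite rGamma_step. do 2 f_equal. rewrite IZR_C_plus. ring. }
  assert (Ns : RtoC (IZR n) + sgm <> 0). { rewrite Cplus_comm. apply sgm_not_int. }
  assert (Pn : (0 < Cmod (RtoC (IZR n) + sgm))%R) by (apply Cmod_gt_0; auto).
  unfold phase. rewrite E, Cmod_mult, Cmult_conj, Cplus_conj, Cconj_RtoC, RtoC_mult.
  field. split; apply RtoC_neq; lra.
Qed.

(** The radicand is z times its conjugate, so the principal root is |z|. *)
Lemma coef_up_eq n : coef_up lam eps n = RtoC (Cmod (RtoC (IZR n) + sgm)).
Proof.
  rewrite <- Csqrt_conj_product. unfold coef_up. f_equal.
  rewrite Cplus_conj, Cconj_RtoC, sgm_conj. unfold sgm. rewrite RtoC_plus. ring.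
Qed.

Lemma coef_down_eq n : coef_down lam eps n = - RtoC (Cmod (RtoC (IZR (n - 1)) + sgm)).
Proof.
  rewrite <- Csqrt_conj_product. unfold coef_down. do 2 f_equal.
  rewrite Cplus_conj, Cconj_RtoC, sgm_conj. unfold sgm. rewrite IZR_C_minus, RtoC_plus. ring.
Qed.

(** [matcoef_recurrence] with the phases absorbed by Q1 and Q2. On the diagonal, (1-c)(x-n) +
    (1+c)(n+eps) - 2c(n+eps) collapses to (1-c)(x+eps). *)
Lemma meixner_recurrence n x :
  RtoC nome * (coef_up lam eps n * meixner (n + 1) x lam eps c - coef_down lam eps n * meixner (n - 1) x lam eps c)
  + RtoC ((1 + c) * (eps + IZR n)) * meixner n x lam eps c
  = RtoC ((1 - c) * (IZR x + eps)) * meixner n x lam eps c.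
Proof.
  rewrite coef_up_eq, coef_down_eq, !meixner_factor.
  assert (R := matcoef_recurrence nome nome_range sgm n x). rewrite nome_sq in R.
  assert (P1 := phase_step n). assert (P2 := phase_step (n - 1)).
  replace (n - 1 + 1)%Z with n in P2 by lia.
  set (a := RtoC (Cmod (RtoC (IZR n) + sgm))) in *.
  set (b := RtoC (Cmod (RtoC (IZR (n - 1)) + sgm))) in *.
  assert (U0 := phase_unimodular n). assert (U1 := phase_unimodular (n + 1)).
  assert (Aa : (RtoC (IZR n) + sgm) * (RtoC (IZR n) + Cconj sgm) = a * a).
  { unfold a. rewrite <- RtoC_mult. replace (RtoC (IZR n) + Cconj sgm) with (Cconj (RtoC (IZR n) + sgm))
      by (rewrite Cplus_conj, Cconj_RtoC; auto). rewrite <- Cmod_sq. f_equal. ring. }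
  assert (Na : a <> 0).
  { unfold a. apply RtoC_neq. assert (h : RtoC (IZR n) + sgm <> 0) by (rewrite Cplus_comm; apply sgm_not_int).
    apply Cmod_gt_0 in h. lra. }
  assert (Q1 : a * phase (n + 1) = phase n * (RtoC (IZR n) + sgm)).
  { transitivity (phase (n + 1) * (a * a) / a). field; auto. rewrite <- Aa.
    transitivity ((phase (n + 1) * (RtoC (IZR n) + Cconj sgm)) * (RtoC (IZR n) + sgm) / a). field; auto.
    rewrite P1. field; auto. }
  assert (Q2 : b * phase (n - 1) = phase n * (RtoC (IZR n) + Cconj sgm - 1)).
  { transitivity (phase (n - 1) * b). ring. rewrite <- P2, IZR_C_minus. ring. }
  transitivity (mconst * xfactor x * (RtoC nome * ((a * phase (n + 1)) * X (n + 1) x + (b * phase (n - 1)) * X (n - 1) x)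
    + RtoC ((1 + c) * (eps + IZR n)) * phase n * X n x)). ring.
  rewrite Q1, Q2.
  assert (S2 : sgm + Cconj sgm = RtoC (2 * eps + 1)).
  { rewrite sgm_conj. unfold sgm. rewrite RtoC_plus, RtoC_mult. ring. }
  transitivity (mconst * xfactor x * phase n *
    (((RtoC (IZR n) + sgm) * (RtoC c * X n x + RtoC nome * X (n + 1) x)
      + (RtoC (IZR n) + Cconj sgm - 1) * (RtoC c * X n x + RtoC nome * X (n - 1) x))
     + (RtoC ((1 + c) * (eps + IZR n)) - RtoC c * (2 * RtoC (IZR n) + (sgm + Cconj sgm) - 1)) * X n x)). ring.
  rewrite <- R, S2.
  rewrite IZR_C_minus.
  repeat first [rewrite RtoC_plus | rewrite RtoC_minus | rewrite RtoC_mult]. ring.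
Qed.

(** * The operator identity *)

Lemma pi_rep_finite_support Y f : finite_support f -> finite_support (pi_rep lam eps Y f).
Proof.
  intros [N HN]. exists (Z.abs N + 1)%Z. intros k Hk. unfold pi_rep, piH, piE, piF.
  rewrite !HN by lia. ring.
Qed.

Lemma pi_rep_linear Y a f g :
  pi_rep lam eps Y (fun k => a * f k + g k) = (fun k => a * pi_rep lam eps Y f k + pi_rep lam eps Y g k).
Proof. apply functional_extensionality. intros k. unfold pi_rep, piH, piE, piF. ring. Qed.

(** Nested as a f + g, the only shape in which linearity of U is given. The last basis vector then
    has coefficient 1, compensated by the -1 in the term before it. *)
Lemma pi_rep_lax_basis s r n :
  pi_rep lam eps (lax s r) (basis_vec n) = (fun k =>
    (RtoC r * coef_up lam eps n) * basis_vec (n + 1) k + (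
    (RtoC (s * (2 * (eps + IZR n)))) * basis_vec n k + (
    (- RtoC r * coef_down lam eps n - 1) * basis_vec (n - 1) k + basis_vec (n - 1) k))).
Proof.
  apply functional_extensionality. intros k. unfold pi_rep, lax, piH, piE, piF, basis_vec; simpl.
  rewrite (RtoC_mult s).
  destruct (Z.eq_dec k n), (Z.eq_dec (k - 1) n), (Z.eq_dec (k + 1) n), (Z.eq_dec k (n + 1)), (Z.eq_dec k (n - 1));
    try lia; subst; try ring.
Qed.

Lemma meixner_diagonalizes s r U f x : (0 < r)%R -> (s / r = (1 + c) / (2 * sqrt c))%R ->
  is_meixner_transform lam eps c U -> finite_support f ->
  U (pi_rep lam eps (lax s r) f) x =
  mult_op (fun x => 2 * sqrt (s ^ 2 - r ^ 2) * (IZR x + eps))%R (U f) x.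
Proof.
  intros Hr Hs [[_ [linU _]] EU] Hf. fold nome in Hs. assert (Q := nome_range).
  assert (Es : (s = r * (1 + c) / (2 * nome))%R).
  { replace s with (s / r * r)%R by (field; lra). rewrite Hs. field. lra. }
  (* With s = r (1 + c)/(2 q) and q^2 = c, the difference (1 + c)^2 - 4 c is a square. Hence L is
     r/q times the operator of the recurrence, with eigenvalue 2 C (x + eps). *)
  assert (Ec : (sqrt (s ^ 2 - r ^ 2) = r * (1 - c) / (2 * nome))%R).
  { replace (s ^ 2 - r ^ 2)%R with ((r * (1 - c) / (2 * nome)) ^ 2)%R.
    - apply sqrt_pow2. apply Rmult_le_pos. apply Rmult_le_pos; lra. left; apply Rinv_0_lt_compat; lra.
    - rewrite Es. apply Rmult_eq_reg_r with ((2 * nome) ^ 2)%R; [|apply pow_nonzero; lra].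
      assert (E4 : ((2 * nome) ^ 2 = 4 * c)%R) by (rewrite <- nome_sq; ring).
      transitivity (r ^ 2 * (1 - c) ^ 2)%R. field; lra.
      transitivity (r ^ 2 * (1 + c) ^ 2 - r ^ 2 * (2 * nome) ^ 2)%R. rewrite E4. ring. field; lra. }
  set (A := fun h => U (pi_rep lam eps (lax s r) h) x = mult_op (fun x => 2 * sqrt (s ^ 2 - r ^ 2) * (IZR x + eps))%R (U h) x).
  assert (Ab : forall n, A (basis_vec n)).
  { intros n. unfold A. rewrite pi_rep_lax_basis.
    assert (B := basis_finite_support).
    rewrite !linU by auto using finite_support_in_l2, lincomb_finite_support.
    unfold mult_op. rewrite !EU. rewrite Ec, Es.
    assert (R := meixner_recurrence n x).
    assert (Nn : RtoC nome <> 0) by (apply RtoC_neq; lra).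
    transitivity (RtoC (r / nome) * (RtoC nome * (coef_up lam eps n * meixner (n + 1) x lam eps c - coef_down lam eps n * meixner (n - 1) x lam eps c)
       + RtoC ((1 + c) * (eps + IZR n)) * meixner n x lam eps c)).
    - replace (r * (1 + c) / (2 * nome) * (2 * (eps + IZR n)))%R with ((r / nome) * ((1 + c) * (eps + IZR n)))%R by (field; lra).
      rewrite !(RtoC_mult (r / nome)), RtoC_div by lra. field; auto.
    - rewrite R. replace (2 * (r * (1 - c) / (2 * nome)) * (IZR x + eps))%R with ((r / nome) * ((1 - c) * (IZR x + eps)))%R by (field; lra).
      rewrite (RtoC_mult (r / nome)). ring. }
  assert (Alin : forall a g h, finite_support g -> finite_support h -> A g -> A h -> A (fun k => a * g k + h k)).
  { intros a g h Hg Hh HAg HAh. unfold A in *. rewrite pi_rep_linear.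
    rewrite linU by auto using finite_support_in_l2, pi_rep_finite_support.
    rewrite HAg, HAh. unfold mult_op. rewrite linU by auto using finite_support_in_l2. ring. }
  (* The zero function starts the induction; it is obtained as -e_0 + e_0 from the stability of A
     under combinations. *)
  assert (A0 : A (fun _ => RtoC 0)).
  { replace (fun _ : Z => RtoC 0) with (fun k => RtoC (-1) * basis_vec 0 k + basis_vec 0 k).
    apply Alin; auto using basis_finite_support.
    apply functional_extensionality; intros k. ring. }
  assert (Z0 : finite_support (fun _ => RtoC 0)) by (exists 0%Z; auto).
  destruct (finite_support_list f Hf) as [L [HL Hz]].
  assert (Acut : forall L, NoDup L -> A (restrict_to L f) /\ finite_support (restrict_to L f)).
  { clear L HL Hz. induction L as [|a L IH]; intros HL.
    - replace (restrict_to nil f) with (fun _ : Z => RtoC 0). auto.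
      apply functional_extensionality; intros; reflexivity.
    - inversion HL; subst. destruct (IH H2) as [IA IF].
      replace (restrict_to (a :: L) f) with (fun k => f a * basis_vec a k + restrict_to L f k).
      + split; [apply Alin | apply lincomb_finite_support]; auto using basis_finite_support.
      + apply functional_extensionality; intros k. unfold restrict_to, basis_vec.
        destruct (in_dec Z.eq_dec k L), (in_dec Z.eq_dec k (a :: L)), (Z.eq_dec k a);
          subst; simpl in *; try tauto; try ring; exfalso; intuition. }
  replace f with (restrict_to L f). apply Acut; auto.
  apply functional_extensionality; intros k. unfold restrict_to. destruct in_dec; auto. symmetry; auto.
Qed.

Lemma meixner_transform_exists : exists U, is_meixner_transform lam eps c U.
Proof.
  exists (kernel_op weight1 (fun n x => meixner n x lam eps c)). split.
  - apply kernel_bounded_linear. apply weight1_pos. apply meixner_weight_pos. apply meixner_rows.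
    intros x. apply in_l2_abs. apply weight1_pos.
    assert (T := meixner_cols x x). destruct Z.eq_dec; [|tauto].
    apply has_sum_abs_summable with (/ meixner_weight lam eps c x)%R.
    apply sq_weight_pos, weight1_pos.
    eapply has_sum_ext; [|apply T]. intros n. cbv beta.
    rewrite Cconj_conj, RtoC_mult, Cmod_sq. ring.
  - intros n x. rewrite kernel_basis. unfold weight1. ring.
Qed.

End Meixner.

Theorem theorem4p6 (r s u : R -> R) (lam : C) (eps : R)
  (r_C1 : C1_halfline r) (s_C1 : C1_halfline s) (u_C0 : continuous_halfline u)
  (ode_s : forall t, 0 <= t -> is_derive_halfline s t (- 2 * u t * r t))
  (ode_r : forall t, 0 <= t -> is_derive_halfline r t (- 2 * u t * s t))
  (sgn_u : forall t, 0 < t -> sign (u t) = - sign (r t))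
  (s0_pos : 0 < s 0) (r0_pos : 0 < r 0)
  (s2r2_pos : forall t, 0 <= t -> 0 < s t ^ 2 - r t ^ 2)
  (Re_lam : Re lam = - (1 / 2)) (Im_lam : 0 <= Im lam)
  (eps_range : 0 <= eps < 1)
  (lam_eps : (lam, eps) <> (RtoC (- (1 / 2)), 1 / 2)) :
  (forall t, 0 <= t ->
     0 < r t /\ 0 < s t /\ s t ^ 2 - r t ^ 2 = s 0 ^ 2 - r 0 ^ 2) /\
  (forall t, 0 < t ->
     exists c : R,
       unique (fun c => 0 < c < 1 /\ s t / r t = (1 + c) / (2 * sqrt c)) c /\
       c = exp (- 2 * arccosh (s t / r t)) /\
       (exists U, is_meixner_transform lam eps c U) /\
       (forall U, is_meixner_transform lam eps c U ->
          unitary weight1 (meixner_weight lam eps c) U /\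
          exists Uadj,
            is_adjoint weight1 (meixner_weight lam eps c) U Uadj /\
            forall f, finite_support f ->
              let g := U f in
              finite_support (Uadj g) /\
              forall x : Z,
                U (pi_rep lam eps (lax (s t) (r t)) (Uadj g)) x
                = mult_op (fun x => 2 * sqrt (s t ^ 2 - r t ^ 2) * (IZR x + eps))
                    g x)).
Proof.
  assert (Inv := lax_flow_invariants r s u ode_s ode_r sgn_u s0_pos r0_pos s2r2_pos).
  split; [exact Inv|]. intros t Ht.
  destruct (Inv t ltac:(lra)) as [Hr [Hs _]]. assert (H2 := s2r2_pos t ltac:(lra)).
  assert (Hy : 1 < s t / r t).
  { apply Rmult_lt_reg_r with (r t); auto. unfold Rdiv. rewrite Rmult_assoc, Rinv_l by lra. nra. }
  assert (Un := modulus_unique (s t / r t) Hy).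
  set (c := exp (- 2 * arccosh (s t / r t))) in *. exists c.
  destruct (proj1 Un) as [c_range Hc].
  split; [exact Un|]. split; [reflexivity|].
  split; [apply meixner_transform_exists; auto|].
  intros U HU.
  destruct (orthonormal_kernel_unitary weight1 (meixner_weight lam eps c)
    (fun n x => meixner n x lam eps c) U) as [_ [Uni [Adj VU]]].
  - apply weight1_pos.
  - apply meixner_weight_pos; auto.
  - intros n k. apply meixner_rows; auto.
  - intros x y. apply meixner_cols; auto.
  - apply HU.
  - intros n x. rewrite (proj2 HU). unfold weight1. rewrite Cmult_1_l. auto.
  (* The adjoint is the inverse kernel operator, so it takes U f back to the finitely supported f,
     and the identity reduces to diagonalization on f. *)
  - split; [exact Uni|]. eexists. split; [exact Adj|].
    intros f Hf g. unfold g. rewrite (VU f) by (apply finite_support_in_l2; auto).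
    split; auto. intros x. apply (meixner_diagonalizes lam eps c); auto.
Qed.
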